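(* Let $(W,S)$ be a minimal odd-angled Coxeter system containing no finite index reflection subgroup, and assume that the divisibility diagram $\mathrm{Cox}_{\mathrm{div}}(W)$ is connected. Then $\mathrm{Cox}_{\mathrm{div}}(W)$ is one of the following diagrams: (A) three vertices; two edges labeled $k$ and $l$ with $k,l\ge 5$; the third pair of vertices is either not joined or joined by an edge labeled $m\ge 5$; (B) three vertices, with the three edges labeled $p$, $l$ and $3$, where $p\ge 7$ and $l\ge 5$; (C) four vertices $v_1,v_2,v_3,v_4$; $v_1v_2$ is labeled $k\ge5$, $v_3v_4$ is labeled $l\ge 5$, $v_2v_3$ is labeled $3$, and each of the pairs $v_1v_3$, $v_1v_4$, $v_2v_4$ is either joined by an edge labeled $3$ or not joined; (D) four vertices $v_1,v_2,v_3,v_4$; $v_1v_2$, $v_2v_3$, $v_3v_4$ are labeled $5$, $v_1v_3$ and $v_2v_4$ are labeled $3$, and $v_1,v_4$ are either joined by an edge labeled $3$ or $5$, or not joined; (E) four vertices $v_1,v_2,v_3,v_4$; $v_1v_2$, $v_1v_3$, $v_1v_4$ are labeled $5$, and $v_2v_3$, $v_2v_4$, $v_3v_4$ are labeled $3$; (F) $n\ge 5$ vertices $v_1,\dots,v_n$; $v_1v_2$ is labeled $k\ge5$, $v_{n-1}v_n$ is labeled $l\ge 5$, $v_iv_{i+1}$ is labeled $3$ for $2\le i\le n-2$, each of the pairs $v_1v_3$ and $v_{n-2}v_n$ is either joined by an edge labeled $3$ or not joined, and all other pairs are not joined.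
   Context: A Coxeter system $(W,S)$ consists of a nonempty finite set $S=\{s_1,\dots,s_r\}$ and the group $W=\langle S\mid (s_is_j)^{m_{ij}}=1\ \forall i,j\rangle$, where $m_{ii}=1$ and $m_{ij}=m_{ji}\in\{2,3,4,\dots\}\cup\{\infty\}$ for $i\ne j$ ($m_{ij}=\infty$ means no relation is imposed on $s_is_j$). It is odd-angled if every $m_{ij}$ with $i\neq j$ is odd or infinite. A reflection of $W$ is an element conjugate in $W$ to an element of $S$. A reflection subgroup is a proper subgroup (index greater than $1$) generated by reflections; the trivial subgroup counts as generated by the empty set of reflections. A special subgroup is the subgroup generated by a nonempty subset $S'\subset S$; it is a Coxeter group with generating set $S'$. $W$ is a minimal group containing no finite index reflection subgroup if $W$ has no finite index reflection subgroup while each proper special subgroup (i.e. $S'\subsetneq S$) has one. The divisibility diagram $\mathrm{Cox}_{\mathrm{div}}(W)$ is the labeled graph with vertices corresponding to the elements of $S$; the vertices of $s_i\ne s_j$ are joined by an edge labeled by the smallest divisor $k>1$ of $m_{ij}$ if $m_{ij}<\infty$, and are not joined if $m_{ij}=\infty$. All labels are thus (for odd-angled systems) finite odd primes. *)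

(* Defs.v *)
From HB Require Import structures.
From mathcomp Require Import all_boot.
From mathcomp Require Import boolp classical_sets cardinality.
Set Implicit Arguments.
Unset Strict Implicit.
Unset Printing Implicit Defensive.

Local Open Scope quotient_scope.
Local Open Scope classical_set_scope.
Local Open Scope group_scope.

(* A letter (a, false) stands for the generator a, and (a, true) for its formal
   inverse. *)
Definition word (I : choiceType) := seq (I * bool).

Definition letter_inv (I : choiceType) (a : I * bool) : I * bool :=
  (a.1, ~~ a.2).

Definition word_inv (I : choiceType) (w : word I) : word I :=
  rev (map (@letter_inv I) w).

(* u and v represent the same element of < I | r = 1 for all r in R >. *)
Inductive pres_eq (I : choiceType) (R : set (word I)) : word I -> word I -> Prop :=
  | pres_refl u : pres_eq R u u
  | pres_sym u v : pres_eq R u v -> pres_eq R v u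
  | pres_trans u v w : pres_eq R u v -> pres_eq R v w -> pres_eq R u w
  | pres_cancel u a v : pres_eq R (u ++ [:: a; letter_inv a] ++ v) (u ++ v)
  | pres_relator u r v : R r -> pres_eq R (u ++ r ++ v) (u ++ v).

Section PresentedGroup.
Variables (I : choiceType) (R : set (word I)).

Lemma pres_catl w u v : pres_eq R u v -> pres_eq R (w ++ u) (w ++ v).
Proof.
elim=> [x|x y _|x y z _ xy _|x a y|x r y Rr].
- exact: pres_refl.
- exact: pres_sym.
- exact: pres_trans.
- by rewrite !(catA w); apply: pres_cancel.
- by rewrite !(catA w); apply: pres_relator.
Qed.

Lemma pres_catr w u v : pres_eq R u v -> pres_eq R (u ++ w) (v ++ w).
Proof.
elim=> [x|x y _|x y z _ xy _|x a y|x r y Rr].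
- exact: pres_refl.
- exact: pres_sym.
- exact: pres_trans.
- by rewrite -!catA; apply: pres_cancel.
- by rewrite -!catA; apply: pres_relator.
Qed.

Lemma pres_cat u u' v v' :
  pres_eq R u u' -> pres_eq R v v' -> pres_eq R (u ++ v) (u' ++ v').
Proof. by move=> /(pres_catr v) uu' /(pres_catl u'); apply: pres_trans. Qed.

Lemma letter_invK : involutive (@letter_inv I).
Proof. by case=> a b; rewrite /letter_inv /= negbK. Qed.

Lemma word_inv_cat (u v : word I) : word_inv (u ++ v) = word_inv v ++ word_inv u.
Proof. by rewrite /word_inv map_cat rev_cat. Qed.

Lemma word_invK : involutive (@word_inv I).
Proof.
move=> u; rewrite /word_inv map_rev revK -map_comp.
by apply: map_id_in => a _; apply: letter_invK.
Qed.

Lemma pres_wordV u : pres_eq R (u ++ word_inv u) [::].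
Proof.
elim: u => [|a u IHu]; first exact: pres_refl.
rewrite -cat1s word_inv_cat -catA (catA u).
apply: pres_trans (pres_catl [:: a] (pres_catr _ IHu)) _.
exact: (pres_cancel R [::] a [::]).
Qed.

Lemma pres_Vword u : pres_eq R (word_inv u ++ u) [::].
Proof. by rewrite -{2}(word_invK u); apply: pres_wordV. Qed.

Lemma pres_inv u v : pres_eq R u v -> pres_eq R (word_inv u) (word_inv v).
Proof.
move=> uv; apply: pres_sym.
have := pres_catl (word_inv v) (pres_sym (pres_catr (word_inv u) uv)).
rewrite catA => /(pres_trans _) vu.
have {}vu : pres_eq R (word_inv v ++ u ++ word_inv u) (word_inv u).
  apply: pres_trans (pres_catl _ (pres_catr _ uv)) _.
  by rewrite catA; apply: (pres_catr (word_inv u) (pres_Vword v)).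
apply: pres_trans vu; apply: pres_sym.
by rewrite -{2}[word_inv v]cats0; apply/pres_catl/pres_wordV.
Qed.

Definition pres_rel (u v : word I) : bool := `[< pres_eq R u v >].

Lemma pres_rel_refl : reflexive pres_rel.
Proof. by move=> u; apply/asboolP/pres_refl. Qed.

Lemma pres_rel_sym : symmetric pres_rel.
Proof. by move=> u v; apply/asboolP/asboolP; apply: pres_sym. Qed.

Lemma pres_rel_trans : transitive pres_rel.
Proof. by move=> v u w /asboolP uv /asboolP vw; apply/asboolP/(pres_trans uv). Qed.

Canonical pres_equiv := EquivRel pres_rel pres_rel_refl pres_rel_sym pres_rel_trans.

Definition pres_group := {eq_quot pres_equiv}.

HB.instance Definition _ := Choice.on pres_group.
HB.instance Definition _ := EqQuotient.on pres_group.

Definition pres_class (u : word I) : pres_group := \pi_pres_group u.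

Lemma pres_classP u v : pres_class u = pres_class v <-> pres_eq R u v.
Proof.
split; first by move=> /eqmodP/asboolP.
by move=> uv; apply/eqmodP/asboolP.
Qed.

Lemma pres_classK (x : pres_group) : pres_class (repr x) = x.
Proof. exact: reprK. Qed.

Lemma repr_pres_class u : pres_eq R (repr (pres_class u)) u.
Proof. by apply/pres_classP; rewrite pres_classK. Qed.

Definition pres_one : pres_group := pres_class [::].
Definition pres_mul (x y : pres_group) : pres_group :=
  pres_class (repr x ++ repr y).
Definition pres_invg (x : pres_group) : pres_group :=
  pres_class (word_inv (repr x)).

Lemma pres_mulE u v : pres_mul (pres_class u) (pres_class v) = pres_class (u ++ v).
Proof. by apply/pres_classP/pres_cat; apply: repr_pres_class. Qed.

Lemma pres_invE u : pres_invg (pres_class u) = pres_class (word_inv u).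
Proof. by apply/pres_classP/pres_inv/repr_pres_class. Qed.

Lemma pres_mulA : associative pres_mul.
Proof.
move=> x y z; rewrite -(pres_classK x) -(pres_classK y) -(pres_classK z).
by rewrite !pres_mulE catA.
Qed.

Lemma pres_mul1 : left_id pres_one pres_mul.
Proof. by move=> x; rewrite -(pres_classK x) pres_mulE. Qed.

Lemma pres_mulr1 : right_id pres_one pres_mul.
Proof. by move=> x; rewrite -(pres_classK x) pres_mulE cats0. Qed.

Lemma pres_mulV : left_inverse pres_one pres_invg pres_mul.
Proof.
move=> x; rewrite -(pres_classK x) pres_invE pres_mulE.
exact/pres_classP/pres_Vword.
Qed.

Lemma pres_mulrV : right_inverse pres_one pres_invg pres_mul.
Proof.
move=> x; rewrite -(pres_classK x) pres_invE pres_mulE.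
exact/pres_classP/pres_wordV.
Qed.

HB.instance Definition _ := isGroup.Build pres_group
  pres_mulA pres_mul1 pres_mulr1 pres_mulV pres_mulrV.

End PresentedGroup.

Section Subgroups.
Variable G : groupType.

Definition is_subgroup (H : set G) : Prop :=
  H 1 /\ forall x y, H x -> H y -> H (x / y).

Definition generated (A : set G) : set G := smallest is_subgroup A.

Definition finite_index (K H : set G) : Prop :=
  finite_set [set [set x * h | h in H] | x in K].

End Subgroups.

(* The entry None encodes m_ij = oo. *)
Definition is_coxeter_matrix (S : finType) (m : S -> S -> option nat) : Prop :=
  [/\ forall s, m s s = Some 1%N,
      forall s t, m s t = m t s
    & forall s t k, s != t -> m s t = Some k -> (2 <= k)%N].

Definition odd_angled (S : finType) (m : S -> S -> option nat) : Prop :=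
  forall s t k, s != t -> m s t = Some k -> odd k.

Section CoxeterGroup.
Variables (S : finType) (m : S -> S -> option nat).

Definition coxeter_relators : set (word S) :=
  [set r | exists s t k, m s t = Some k /\
     r = flatten (nseq k [:: (s, false); (t, false)])].

Definition coxeter_group := pres_group coxeter_relators.

HB.instance Definition _ := Group.on coxeter_group.

Definition coxeter_gen (s : S) : coxeter_group :=
  pres_class coxeter_relators [:: (s, false)].

Definition special_subgroup (T : set S) : set coxeter_group :=
  generated (coxeter_gen @` T).

(* Reflections of the Coxeter group (W_T, T), so only conjugation inside W_T is
   allowed; the reflections of W itself are those for T = setT. *)
Definition reflections (T : set S) : set coxeter_group :=
  [set coxeter_gen s ^ g | s in T & g in special_subgroup T].

Definition reflection_subgroup (T : set S) (H : set coxeter_group) : Prop :=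
  H `<` special_subgroup T /\
  exists2 A, A `<=` reflections T & H = generated A.

Definition has_finite_index_reflection_subgroup (T : set S) : Prop :=
  exists2 H, reflection_subgroup T H & finite_index (special_subgroup T) H.

Definition minimal_no_finite_index_reflection_subgroup : Prop :=
  ~ has_finite_index_reflection_subgroup setT /\
  forall T : set S, T !=set0 -> T `<` setT ->
    has_finite_index_reflection_subgroup T.

(* [pdiv k] is the smallest divisor greater than 1 of k > 1. *)
Definition cox_div (s t : S) : option nat :=
  if s == t then None else omap pdiv (m s t).

End CoxeterGroup.

(* A labeled graph on V is given by d : V -> V -> option nat, where
   d x y = Some k means that x and y are joined by an edge labeled k and
   d x y = None that they are not joined. *)
Section Diagrams.
Variables (V : finType) (d : V -> V -> option nat).
Local Open Scope nat_scope.

Definition diagram_connected : Prop :=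
  forall x y, connect [rel u v | d u v != None] x y.

(* v 1, ..., v n lists the vertices without repetition. *)
Definition vertices (n : nat) (v : nat -> V) : Prop :=
  perm_eq [seq v i | i <- iota 1 n] (enum V).

Definition diagram_A : Prop :=
  exists v k l, [/\ vertices 3 v, 5 <= k, 5 <= l,
    d (v 1) (v 2) = Some k /\ d (v 2) (v 3) = Some l
    & d (v 1) (v 3) = None \/ exists2 p, 5 <= p & d (v 1) (v 3) = Some p].

Definition diagram_B : Prop :=
  exists v p l, [/\ vertices 3 v, 7 <= p, 5 <= l
    & [/\ d (v 1) (v 2) = Some p, d (v 2) (v 3) = Some l
        & d (v 1) (v 3) = Some 3]].

Definition three_or_none (x y : V) : Prop := d x y = Some 3 \/ d x y = None.

Definition diagram_C : Prop :=
  exists v k l, [/\ vertices 4 v, 5 <= k, 5 <= l,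
    [/\ d (v 1) (v 2) = Some k, d (v 3) (v 4) = Some l
      & d (v 2) (v 3) = Some 3]
    & [/\ three_or_none (v 1) (v 3), three_or_none (v 1) (v 4)
        & three_or_none (v 2) (v 4)]].

Definition diagram_D : Prop :=
  exists v, [/\ vertices 4 v,
    [/\ d (v 1) (v 2) = Some 5, d (v 2) (v 3) = Some 5
      & d (v 3) (v 4) = Some 5],
    d (v 1) (v 3) = Some 3 /\ d (v 2) (v 4) = Some 3
    & [\/ d (v 1) (v 4) = Some 3, d (v 1) (v 4) = Some 5
        | d (v 1) (v 4) = None]].

Definition diagram_E : Prop :=
  exists v, [/\ vertices 4 v,
    [/\ d (v 1) (v 2) = Some 5, d (v 1) (v 3) = Some 5
      & d (v 1) (v 4) = Some 5]
    & [/\ d (v 2) (v 3) = Some 3, d (v 2) (v 4) = Some 3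
      & d (v 3) (v 4) = Some 3]].

Definition diagram_F : Prop :=
  exists n v k l, [/\ 5 <= n, vertices n v & 5 <= k /\ 5 <= l] /\
    [/\ d (v 1) (v 2) = Some k /\ d (v n.-1) (v n) = Some l,
        forall i, 2 <= i <= n - 2 -> d (v i) (v i.+1) = Some 3,
        three_or_none (v 1) (v 3),
        three_or_none (v (n - 2)) (v n)
      & forall i j, 1 <= i -> i.+1 < j -> j <= n ->
          (i, j) != (1, 3) -> (i, j) != (n - 2, n) -> d (v i) (v j) = None].

End Diagrams.

(* Main.v *)
From HB Require Import structures.
Require Import Defs.
From mathcomp Require Import all_boot all_order all_algebra all_field.
From mathcomp Require Import boolp classical_sets cardinality.
From mathcomp Require Import ring zify.
Set Implicit Arguments.
Unset Strict Implicit.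
Unset Printing Implicit Defensive.

Local Open Scope classical_set_scope.
Local Open Scope group_scope.

(** Call an edge of the divisibility diagram large when its label is at least 5.  The
    labels are odd primes, so the other labels are 3.

    _Obstruction._  Let H be a finite index reflection subgroup of W_T.  The elements of
    W_T that no reflection of H separates from 1 form a fundamental domain, so they
    are finitely many.  They are the vertices of an edge-coloured graph: crossing
    the wall of type s gives an edge of colour s, or a loop of colour s when
    that wall bounds the domain.  For colours s and t with m s t odd, the
    components of colours s, t are isolated points, paths whose number of points
    divides m s t, and cycles, so a path has at least as many points as the label
    of st, and a cycle twice as many.  Hence all colours have equally many loops and
    edges, and each pair of colours satisfies a linear inequality between edges, path
    ends and cycles ([ends_bound], [tops_bound]).  No vertex has only loops, so
    each spanning tree of the diagram bounds the loops by path ends ([tree_bound]).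
    Finally the vertices, edges and cycles have Euler characteristic at least 1
    ([model_euler]): every vertex other than the base has a descent, and two descents
    span a finite dihedral group whose whole orbit stays in the domain
    ([double_descent]).  [chamber_model] records these facts, and for
    the diagrams of the theorem the inequalities are inconsistent.  Only for two disjoint
    large edges with four threes between them a finer, local count is needed
    ([excluded_C_complete]).

    _Construction._  Conversely an action of W on a finite set gives a finite index
    reflection subgroup when its graph of moves unfolds into W
    ([finite_index_of_action]).  Such actions exist if there is no large edge, exactly one,
    or two adjacent ones labeled 5 that form a triangle with a 3: the action of
    the colours in the large edges is explicit, and every other colour only
    adds pendant points ([finite_index_of_pendants]).

    _Classification._  By minimality a diagram that occurs on some of the vertices and
    has no finite index reflection subgroup occurs on all of them ([spanning]).  If
    none of the listed diagrams occurs, adjacent large edges are labeled 5 and form a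
    triangle with a 3, three large edges do not meet in a vertex, and two
    disjoint ones do not exist, because a shortest walk between them would
    give a diagram with four vertices or a chain ([no_linked]).  This leaves the three
    cases of the construction, contrary to the hypothesis on W. *)

(** * Subgroups generated by involutions *)

Section GeneratedByInvolutions.
Variable G : groupType.
Implicit Types (A H : set G) (l : seq G) (x y : G).

Definition prodl l : G := foldr *%g 1 l.

Lemma prodl_cat l1 l2 : prodl (l1 ++ l2) = prodl l1 * prodl l2.
Proof. by elim: l1 => [|x l1 IH] /=; rewrite ?mul1g // IH mulgA. Qed.

Lemma prodl_rcons l x : prodl (rcons l x) = prodl l * x.
Proof. by rewrite -cats1 prodl_cat /= mulg1. Qed.

Definition list_in A l : Prop := forall a, a \in l -> A a.

Lemma list_in_cons A a l : list_in A (a :: l) <-> A a /\ list_in A l.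
Proof.
split=> [Al|[Aa Al] b].
  by split=> [|b bl]; apply: Al; rewrite inE ?eqxx ?bl ?orbT.
by rewrite inE => /predU1P[->//|/Al].
Qed.

Lemma list_in_cat A l1 l2 :
  list_in A (l1 ++ l2) <-> list_in A l1 /\ list_in A l2.
Proof.
split=> [Al|[A1 A2] b].
  by split=> b bl; apply: Al; rewrite mem_cat bl ?orbT.
by rewrite mem_cat => /orP[/A1|/A2].
Qed.

Lemma subgroup1 H : is_subgroup H -> H 1. Proof. by case. Qed.

Lemma subgroupV H x : is_subgroup H -> H x -> H x^-1.
Proof. by case=> H1 HD Hx; rewrite -div1g; apply: HD. Qed.

Lemma subgroupM H x y : is_subgroup H -> H x -> H y -> H (x * y).
Proof.
by move=> sH Hx Hy; rewrite -(invgK y); apply: (proj2 sH) => //; apply: subgroupV.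
Qed.

Lemma subgroupJ H x y : is_subgroup H -> H x -> H y -> H (x ^ y).
Proof.
by move=> sH Hx Hy; rewrite conjgE; do 2?apply: subgroupM => //; apply: subgroupV.
Qed.

Lemma subgroup_prodl H l : is_subgroup H -> list_in H l -> H (prodl l).
Proof.
move=> sH; elim: l => [|a l IH] /=; first by move=> _; apply: subgroup1.
by move=> /list_in_cons[Ha /IH Hl]; apply: subgroupM.
Qed.

Lemma generated_subgroup A : is_subgroup (generated A).
Proof.
split=> [C [[]//]|x y Ax Ay C CA].
by case: (CA) => -[_ CD] _; apply: CD; [apply: Ax|apply: Ay].
Qed.

Lemma sub_generated A : A `<=` generated A.
Proof. by move=> a Aa C [_]; apply. Qed.

Lemma generated_min A H : is_subgroup H -> A `<=` H -> generated A `<=` H.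
Proof. by move=> sH AH x; apply. Qed.

(** Involutions are their own inverses, so no inverses are needed in the words. *)
Lemma generatedP A x : (forall a, A a -> a * a = 1) ->
  generated A x <-> exists2 l, list_in A l & x = prodl l.
Proof.
move=> A2; split=> [|[l Al ->]]; last first.
  apply: subgroup_prodl; first exact: generated_subgroup.
  by move=> a /Al; apply: sub_generated.
have revl l : list_in A l -> list_in A (rev l) /\ prodl (rev l) = (prodl l)^-1.
  elim: l => [|a l IH]; first by rewrite /= invg1.
  move=> /list_in_cons[Aa /IH[rl E]]; rewrite rev_cons; split.
    by move=> b; rewrite mem_rcons inE => /predU1P[->//|/rl].
  by rewrite prodl_rcons E /= invgM (mulg1_eq (A2 a Aa)).
move: x; apply: (@generated_min A [set x | exists2 l, list_in A l & x = prodl l]).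
  split=> [|_ _ [l1 A1 ->] [l2 /revl[A2' E2] ->]]; first by exists [::].
  by exists (l1 ++ rev l2); [apply/list_in_cat|rewrite prodl_cat E2].
by move=> a Aa; exists [:: a]; rewrite /= ?mulg1// => b; rewrite inE => /eqP->.
Qed.

End GeneratedByInvolutions.

(** * Actions of a Coxeter group *)

Section CoxeterActions.
Variables (S : finType) (m : S -> S -> option nat).
Local Notation W := (coxeter_group m).
Local Notation gen := (coxeter_gen m).

Definition is_coxeter_action (X : Type) (f : S -> X -> X) : Prop :=
  (forall s, involutive (f s)) /\
  forall s t k, m s t = Some k -> forall x, iter k (f s \o f t) x = x.

Section Action.
Variables (X : Type) (f : S -> X -> X).
Hypothesis fact : is_coxeter_action f.

Definition word_act (u : word S) (x : X) : X := foldr (fun a => f a.1) x u.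

Lemma word_act_pres_eq u v :
  pres_eq (coxeter_relators m) u v -> word_act u =1 word_act v.
Proof.
rewrite /word_act; elim=> {u v} [//|u v _ uv x|u v w _ uv _ vw x|u a v x|].
- by rewrite uv.
- by rewrite uv vw.
- by rewrite !foldr_cat /= (proj1 fact).
move=> u _ v [s [t [k [mst ->]]]] x; rewrite !foldr_cat; congr foldr.
suff E n y : foldr (fun a => f a.1) y
    (flatten (nseq n [:: (s, false); (t, false)])) = iter n (f s \o f t) y.
  by rewrite E (proj2 fact).
by elim: n => [//|n' IHn] /=; rewrite IHn.
Qed.

Definition cox_act (w : W) (x : X) : X := word_act (repr w) x.

Lemma cox_act_class u x : cox_act (pres_class _ u) x = word_act u x.
Proof. exact/word_act_pres_eq/repr_pres_class. Qed.

Lemma cox_act_gen s x : cox_act (gen s) x = f s x.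
Proof. by rewrite cox_act_class. Qed.

Lemma cox_actM u v x : cox_act (u * v) x = cox_act u (cox_act v x).
Proof.
by rewrite [u * v]/(pres_class _ _) cox_act_class /cox_act /word_act foldr_cat.
Qed.

Lemma cox_act1 x : cox_act 1 x = x.
Proof. by rewrite [1]/(pres_class _ _) cox_act_class. Qed.

End Action.

Hypothesis m_cox : is_coxeter_matrix m.

Lemma coxeter_gen2 s : gen s * gen s = 1.
Proof.
have -> : gen s * gen s = pres_class _ ([:: (s, false)] ++ [:: (s, false)]).
  exact: pres_mulE.
apply/pres_classP; rewrite -[X in pres_eq _ X]cat0s -[X in pres_eq _ X]cats0 -catA.
apply: (pres_relator (r := [:: (s, false); (s, false)]) [::] [::]).
by exists s, s, 1%N; case: m_cox => ->.
Qed.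

Lemma coxeter_genV s : (gen s)^-1 = gen s.
Proof. exact/mulg1_eq/coxeter_gen2. Qed.

Lemma coxeter_genK s (w : W) : gen s * (gen s * w) = w.
Proof. by rewrite mulgA coxeter_gen2 mul1g. Qed.

Lemma coxeter_braid s t k : m s t = Some k -> (gen s * gen t) ^+ k = 1.
Proof.
move=> mst; have E n : (gen s * gen t) ^+ n =
    pres_class _ (flatten (nseq n [:: (s, false); (t, false)])).
  elim: n => [//|n IH]; rewrite expgS IH.
  have -> : gen s * gen t = pres_class _ ([:: (s, false)] ++ [:: (t, false)]).
    exact: pres_mulE.
  exact: pres_mulE.
rewrite E; apply/pres_classP.
rewrite -[X in pres_eq _ X]cat0s -[X in pres_eq _ X]cats0 -catA.
by apply: (pres_relator [::] [::]); exists s, t, k.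
Qed.

Lemma special_ind (T : set S) (P : W -> Prop) :
  P 1 ->
  (forall s w, T s -> @special_subgroup S m T w -> P w -> P (gen s * w)) ->
  forall w, @special_subgroup S m T w -> P w.
Proof.
move=> P1 PM w /generatedP[_ [s _ <-]|l]; first exact: coxeter_gen2.
move=> Tl ->; elim: l Tl => [//|a l IH] /list_in_cons[[s Ts <-] Tl] /=.
apply: PM => //; last exact: IH.
by apply/generatedP; [move=> _ [t _ <-]; apply: coxeter_gen2|exists l].
Qed.

Lemma special_setT w : @special_subgroup S m setT w.
Proof.
have sW := generated_subgroup (gen @` setT).
rewrite -(pres_classK w); elim: (repr w) => [|[s b] u IH].
  exact: (subgroup1 sW).
have -> : pres_class (coxeter_relators m) ((s, b) :: u) =
    (pres_class _ [:: (s, b)] : W) * pres_class _ u.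
  by rewrite [RHS]pres_mulE.
apply: (subgroupM sW) => //; have Ws : generated (gen @` setT) (gen s).
  by apply: sub_generated; exists s.
case: b => //; have <- : (gen s)^-1 = pres_class _ [:: (s, true)].
  exact: pres_invE.
exact: (subgroupV sW).
Qed.

End CoxeterActions.

(** * Inversions *)

Section Inversions.
Variables (S : finType) (m : S -> S -> option nat).
Hypothesis m_cox : is_coxeter_matrix m.
Local Notation W := (coxeter_group m).
Local Notation gen := (coxeter_gen m).
Local Notation gen2 := (coxeter_gen2 m_cox).
Local Notation genV := (coxeter_genV m_cox).
Local Notation genK := (coxeter_genK m_cox).

(** The second component counts modulo 2 how often conjugation turns the first
    one into the generator that acts, that is how often its wall is crossed. *)
Definition inversion_step (s : S) (tb : W * bool) : W * bool :=
  (gen s * tb.1 * gen s, tb.2 (+) (tb.1 == gen s)).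

Lemma inversion_step_iter s t n x b (r := gen s * gen t : W) :
  iter n (inversion_step s \o inversion_step t) (x, b) =
  (r ^+ n * x * r ^- n,
   b (+) odd (\sum_(0 <= j < n.*2) (x == (r ^- j * gen t)%g))).
Proof.
have rV : r^-1 = gen t * gen s by rewrite invgM !genV.
have tr j : gen t * r ^+ j = r ^- j * gen t.
  rewrite -expVgn; elim: j => [|j IH]; first by rewrite !expg0 mul1g mulg1.
  rewrite expgSr mulgA IH expgSr -!mulgA; congr (_ * _).
  by rewrite rV /r !mulgA.
elim: n => [|n IH].
  by rewrite expg0 invg1 mul1g mulg1 big_geq // addbF.
rewrite iterS IH /inversion_step /= doubleS !big_nat_recr //= !oddD !oddb -!addbA.
congr (_, _ (+) (_ (+) _)).
  by rewrite expgS invgM rV !mulgA.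
have shift k : (r ^+ n * x * r ^- n == r ^- k * gen t) =
      (x == r ^- (n.*2 + k) * gen t).
    rewrite -(inj_eq (@mulIg _ (r ^+ n))) mulgVK -mulgA tr.
    rewrite -(inj_eq (@mulgI _ (r ^- n))) mulKg !mulgA -!invgM -!expgnDr.
    by rewrite addnCA addnn addnC.
rewrite -[n.*2]addn0 -shift expg0 invg1 mul1g addn0 -addn1 -shift.
congr addb; rewrite expg1 rV.
by apply/eqP/eqP => [<-|->]; rewrite -!mulgA ?genK ?gen2 mulg1.
Qed.

(** In a dihedral group of order 2 n the elements r^-j t with j < 2 n run twice
    through the reflections, so the sum of [inversion_step_iter] is even for n = m s t. *)
Lemma inversion_step_action : is_coxeter_action m inversion_step.
Proof.
split=> [s [x b]|s t k mst [x b]].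
  rewrite /inversion_step /= -!mulgA genK gen2 mulg1; congr (_, _).
  rewrite mulgA -[X in _ (+) (_ == X)](genK s) mulgA gen2 mul1g.
  have -> : (gen s * x * gen s == gen s) = (x == gen s).
    by apply/eqP/eqP => [/(congr1 (fun y => gen s * y * gen s))|->];
       rewrite -!mulgA ?genK ?gen2 ?mulg1.
  by rewrite -addbA addbb addbF.
have r1 := coxeter_braid mst.
rewrite inversion_step_iter r1 invg1 mulg1 mul1g; congr (_, _).
rewrite -addnn (@big_cat_nat _ _ _ k) ?leq_addr //= -{2}[k]add0n big_addn addnK.
have -> : \sum_(0 <= j < k) (x == ((gen s * gen t) ^- (j + k) * gen t)%g) =
          \sum_(0 <= j < k) (x == ((gen s * gen t) ^- j * gen t)%g).
  by apply: eq_bigr => j _; rewrite expgnDr r1 mulg1.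
by rewrite addnn odd_double addbF.
Qed.

(** [inverts w t] holds when the reflection [t] is a right inversion of [w],
    that is when [w * t] is shorter than [w].  It is read off an action of the
    group, so that no length function or normal form is needed to define it. *)
Definition inverts (w t : W) : bool := (cox_act inversion_step w (t, false)).2.

Lemma cox_act_inversion w t b :
  cox_act inversion_step w (t, b) = (t ^ w^-1, b (+) inverts w t).
Proof.
have actM := cox_actM inversion_step_action.
rewrite /inverts; move: t b.
elim/(special_ind m_cox): w / (special_setT w) => [t b|].
  by rewrite !(cox_act1 inversion_step_action) invg1 conjg1 addbF.
move=> s w _ _ IH t b; rewrite !actM !(cox_act_gen inversion_step_action) (IH t b) (IH t false).
rewrite /inversion_step /= -addbA; congr (_, _).
by rewrite invgM genV conjgM [_ ^ gen s]conjgE genV [RHS]mulgA.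
Qed.

Lemma inversion1 t : inverts 1 t = false.
Proof. by rewrite /inverts (cox_act1 inversion_step_action). Qed.

Lemma inversion_gen s t : inverts (gen s) t = (t == gen s).
Proof. by rewrite /inverts (cox_act_gen inversion_step_action). Qed.

(** The wall of t separates 1 from (u w)^-1 when it separates w^-1 from exactly
    one of the two. *)
Lemma inversionM u w t :
  inverts (u * w) t = inverts w t (+) inverts u (t ^ w^-1).
Proof.
by rewrite {1}/inverts (cox_actM inversion_step_action) cox_act_inversion
  cox_act_inversion.
Qed.

Lemma inversionV w t : inverts w^-1 t = inverts w (t ^ w).
Proof.
have := inversionM w w^-1 t; rewrite mulgV inversion1 invgK.
by case: inverts; case: inverts.
Qed.

Lemma inversion_conj s g : inverts (gen s ^ g) (gen s ^ g).
Proof.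
rewrite {1}conjgE !inversionM inversionV inversion_gen !conjgK eqxx.
rewrite invgM !conjgM genV conjgK [gen s ^ gen s]conjgE gen2 mulg1 genV.
by case: inverts.
Qed.

End Inversions.

(** * The chambers of a reflection subgroup *)

Section ReflectionSubgroups.
Variables (S : finType) (m : S -> S -> option nat).
Hypothesis m_cox : is_coxeter_matrix m.
Local Notation W := (coxeter_group m).
Local Notation gen := (coxeter_gen m).
Local Notation special := (@special_subgroup S m).
Local Notation gen2 := (coxeter_gen2 m_cox).
Local Notation genV := (coxeter_genV m_cox).
Local Notation inv := (@inverts S m).
Local Notation invM := (inversionM m_cox).
Local Notation invV := (inversionV m_cox).
Local Notation inv1 := (inversion1 m_cox).
Local Notation inv_gen := (inversion_gen m_cox).

Implicit Types (H P : set W) (T : set S).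

(** No wall of H separates 1 from p^-1, which is thus in the same chamber of H. *)
Definition in_chamber H (p : W) : Prop := forall t, H t -> ~~ inv p t.

Lemma in_chamber1 H : in_chamber H 1.
Proof. by move=> t _; rewrite inv1. Qed.

(** Each element of [P] is a reflection in a wall of the chamber of H. *)
Definition wall_reflections H P : Prop :=
  P `<=` H /\ forall r, P r -> r * r = 1 /\ forall t, H t -> inv r t = (t == r).

(** The walls crossed by a gallery are known letter by letter from
    [inversionM]; the letter whose wall is that of t can be deleted. *)
Lemma exchange H P l t : is_subgroup H -> wall_reflections H P ->
  list_in P l -> H t -> inv (prodl l) t ->
  exists l', [/\ list_in P l', (size l').+1 = size l & prodl l * t = prodl l'].
Proof.
move=> sH [PH Pw]; elim: l t => [|r l IH] t /=.
  by rewrite inv1.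
move=> /list_in_cons[Pr Pl] Ht; rewrite invM.
have Hl : H (prodl l) by apply: subgroup_prodl => // a /Pl/PH.
case lt : (inv (prodl l) t) => /=; last first.
  rewrite (proj2 (Pw r Pr)); last by apply: subgroupJ => //; apply: subgroupV.
  move=> /eqP tr; exists l; split=> //.
  have -> : t = r ^ prodl l by rewrite -tr conjgKV.
  by rewrite -mulgA conjgE mulVKg mulgA (proj1 (Pw r Pr)) mul1g.
have [l' [Pl' szl' El']] := IH t Pl Ht lt.
move=> _; exists (r :: l'); rewrite /= szl' -mulgA El'; split=> //.
exact/list_in_cons.
Qed.

(** The walls of H separate the elements of H from 1: an element of H that
    no wall separates from 1 has the empty word as a shortest expression in the
    wall reflections, since the last letter of a shortest expression
    is an inversion. *)
Lemma in_chamber_eq1 H P h : is_subgroup H -> wall_reflections H P ->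
  generated P h -> in_chamber H h -> h = 1.
Proof.
move=> sH wP; have [PH Pw] := wP.
have PP a (Pa : P a) := proj1 (Pw a Pa).
move=> /(generatedP _ PP) [l0 Pl0 Eh] Ch.
pose Q n := `[< exists l, [/\ list_in P l, size l = n & h = prodl l] >].
have exQ : exists n, Q n by exists (size l0); apply/asboolP; exists l0.
case: (ex_minnP exQ) => n /asboolP[l [Pl szl El]] minn.
case: (lastP l) Pl szl El => [_ _ -> //|{}l r] Plr szl El.
have [Pl Pr'] : list_in P l /\ P r.
  move: Plr; rewrite -cats1 => /list_in_cat[Pl Pr]; split=> //.
  by apply: Pr; rewrite inE.
have [r2 invr] := Pw r Pr'.
have Hr := PH r Pr'; have := Ch r Hr.
rewrite El prodl_rcons invM invr // eqxx /= negbK.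
rewrite [_ ^ r^-1]conjgE invgK mulgA r2 mul1g -[r^-1]mulg1 -r2 mulKg.
move=> /(exchange sH wP Pl Hr)[l' [Pl' szl' El']].
have /minn : Q (size l').
  by apply/asboolP; exists l'; split=> //; rewrite El prodl_rcons.
by rewrite -szl size_rcons -szl' ltnNge leqnSn.
Qed.

Lemma gen_wall T : wall_reflections (special T) (gen @` T).
Proof.
split=> [|_ [s Ts <-]]; first exact: sub_generated.
by split=> [|t _]; [exact: gen2|exact: inv_gen].
Qed.

Lemma specialM T u v : special T u -> special T v -> special T (u * v).
Proof. exact: (subgroupM (generated_subgroup _)). Qed.

Lemma special_gen T s : T s -> special T (gen s).
Proof. by move=> Ts; apply: sub_generated; exists s. Qed.

(** The reflections of [H] in the walls of the chamber of [H] inside [W_T]. *)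
Definition chamber_walls T H : set W :=
  [set r | exists s p, [/\ T s, special T p, in_chamber H p, r = gen s ^ p & H r]].

Lemma in_chamber_step H p s :
  in_chamber H p -> ~ H (gen s ^ p) -> in_chamber H (gen s * p).
Proof.
move=> Cp nH t Ht; rewrite invM inv_gen.
rewrite (negbTE (Cp t Ht)); apply/eqP => E; apply: nH.
by rewrite -E conjgKV.
Qed.

(** For r = p^-1 s p, the gallery from 1 through p^-1 and p^-1 s = r p^-1 to r
    crosses no wall of H on its first part, and hence none on the last part, its
    image under r. *)
Lemma chamber_walls_wall T H : is_subgroup H ->
  wall_reflections H (chamber_walls T H).
Proof.
move=> sH; split=> [_ [s [p [_ _ _ _ //]]]|_ [s [p [Ts Wp Cp -> Hr]]]].
have r2 : gen s ^ p * gen s ^ p = 1 by rewrite -conjMg gen2 conj1g.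
split=> // t Ht.
have E : gen s ^ p = p^-1 * gen s * p by rewrite conjgE mulgA.
rewrite {1}E !invM invV inv_gen (negbTE (Cp t Ht)) /=.
have -> : ((t ^ p^-1) ^ (gen s)^-1) ^ p = t ^ (gen s ^ p).
  by rewrite genV -!conjgM [gen s ^ p]conjgE mulgA.
rewrite (negbTE (Cp _ _)); last exact: subgroupJ.
rewrite addbF.
by apply/eqP/eqP => [<-|->]; rewrite ?(conjgKV p) ?(conjgK p).
Qed.

(** Read a word for w from the right and drop each letter whose wall belongs to
    H: this keeps p inside the chamber and changes h by a wall reflection. *)
Lemma chamber_decomposition T H w : is_subgroup H -> special T w ->
  exists p h, [/\ w = p * h, special T p, in_chamber H p
                & generated (chamber_walls T H) h].
Proof.
move=> sH; have sG := generated_subgroup (chamber_walls T H).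
elim/(special_ind m_cox): w / => [|s w Ts _ [p [h [-> Wp Cp Gh]]]].
  exists 1, 1; rewrite mulg1; split=> //.
  - exact: (subgroup1 (generated_subgroup _)).
  - exact: in_chamber1.
  - exact: subgroup1.
have [Hsp|nHsp] := pselect (H (gen s ^ p)); last first.
  exists (gen s * p), h; rewrite mulgA; split=> //.
    by apply: specialM => //; apply: special_gen.
  exact: in_chamber_step.
exists p, (gen s ^ p * h); split=> //; first by rewrite [RHS]mulgA -conjgC mulgA.
by apply: (subgroupM sG) => //; apply: sub_generated; exists s, p.
Qed.

(** A reflection g^-1 s g in H, with g = p h, is conjugate by h to the
    reflection p^-1 s p, which lies in a wall of the chamber of 1. *)
Lemma reflection_subgroup_walls T A : A `<=` reflections T ->
  generated A `<=` generated (chamber_walls T (generated A)).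
Proof.
move=> AT; set H := generated A; have sH : is_subgroup H := generated_subgroup A.
have sG := generated_subgroup (chamber_walls T H).
apply: generated_min => // a Aa; have [s Ts [g Wg ga]] := AT a Aa.
have [p [h [gE Wp Cp Gh]]] := chamber_decomposition sH Wg.
have Hh : H h.
  by apply: generated_min Gh => // r [? [? []]].
have Hr : H (gen s ^ p).
  rewrite -[gen s ^ p](conjgK h) -[(gen s ^ p) ^ h]conjgM -gE ga.
  by apply: (subgroupJ sH); [apply: sub_generated|apply: (subgroupV sH)].
rewrite -ga gE conjgM; apply: (subgroupJ sG) => //.
by apply: sub_generated; exists s, p.
Qed.

(** The chamber is a fundamental domain for H. *)
Lemma chamber_inj T A p h : A `<=` reflections T -> generated A h ->
  in_chamber (generated A) p -> in_chamber (generated A) (p * h) -> h = 1.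
Proof.
move=> AT Hh Cp Cph; have sH := generated_subgroup A.
apply: (in_chamber_eq1 sH (chamber_walls_wall T sH)).
  exact: reflection_subgroup_walls.
move=> t Ht; have := Cph t Ht; rewrite invM.
rewrite (_ : inv p _ = false) ?addbF //; apply/negbTE/Cp.
by apply: (subgroupJ sH) => //; apply: (subgroupV sH).
Qed.

End ReflectionSubgroups.

(** * Two descents in a dihedral subgroup *)

Section DihedralTops.
Variables (S : finType) (m : S -> S -> option nat).
Hypothesis m_cox : is_coxeter_matrix m.
Local Notation W := (coxeter_group m).
Local Notation gen := (coxeter_gen m).
Local Notation special := (@special_subgroup S m).
Local Notation gen2 := (coxeter_gen2 m_cox).
Local Notation inv := (@inverts S m).
Local Notation invM := (inversionM m_cox).
Local Notation invV := (inversionV m_cox).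

Lemma inverts_reflection (T : set S) w t : special T w -> inv w t ->
  exists s z, [/\ T s, special T z & t = gen s ^ z].
Proof.
elim/(special_ind m_cox): w /; first by rewrite inversion1.
move=> s w Ts Ww IH; rewrite invM (inversion_gen m_cox).
case: (inv w t) IH => [IH _|_ /= /eqP E]; first exact: IH.
by exists s, w; rewrite -E conjgKV.
Qed.

Lemma inverts_sqr w t : inv w t -> t * t = 1.
Proof.
move=> /(inverts_reflection (special_setT w))[s [z [_ _ ->]]].
by rewrite -conjMg gen2 conj1g.
Qed.

Fixpoint alternating (a b : W) n : seq W :=
  if n is n'.+1 then rcons (alternating b a n') a else [::].

Lemma size_alternating a b n : size (alternating a b n) = n.
Proof. by elim: n a b => //= n IH a b; rewrite size_rcons IH. Qed.

Lemma alternating_suffix a b k n :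
  exists z, alternating a b (k + n) = z ++ alternating a b n /\ size z = k.
Proof.
elim: n a b => [|n IH] a b; first by exists (alternating a b k); rewrite addn0 cats0 size_alternating.
by have [z [E sz]] := IH b a; exists z; rewrite addnS /= E rcons_cat.
Qed.

Lemma alternating_expg a b n : a * a = 1 -> b * b = 1 ->
  (prodl (alternating a b n))^-1 * prodl (alternating b a n) = (a * b) ^+ n.
Proof.
elim: n a b => [|n IH] a b a2 b2; first by rewrite /= mulg1 invg1.
have swap k : a * (b * a) ^+ k = (a * b) ^+ k * a.
  elim: k => [|k IHk]; first by rewrite !expg0 mulg1 mul1g.
  by rewrite !expgS -!mulgA -IHk.
rewrite /= !prodl_rcons invgM (mulg1_eq a2) -mulgA [_^-1 * _]mulgA IH //.
by rewrite mulgA swap -mulgA -expgSr.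
Qed.

Section Pair.
Variables i j : S.
Hypothesis gen_neq : gen i != gen j.
Local Notation K := (special [set i; j]).
Local Notation P := (gen @` [set i; j]).

Let subK : is_subgroup K. Proof. exact: generated_subgroup. Qed.
Let wallK : wall_reflections K P. Proof. exact: (gen_wall m_cox). Qed.
Let Pi : P (gen i). Proof. by exists i => //; left. Qed.
Let Pj : P (gen j). Proof. by exists j => //; right. Qed.
Let Ki : K (gen i). Proof. exact: (sub_generated Pi). Qed.
Let Kj : K (gen j). Proof. exact: (sub_generated Pj). Qed.

Definition shortest (l : seq W) : Prop :=
  forall l', list_in P l' -> prodl l' = prodl l -> (size l <= size l')%N.

Lemma exists_shortest w : K w ->
  exists l, [/\ list_in P l, prodl l = w & shortest l].
Proof.
move=> /generatedP[a [s _ <-]|l0 Pl0 E0]; first exact: gen2.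
pose Q n := `[< exists l, [/\ list_in P l, size l = n & w = prodl l] >].
have exQ : exists n, Q n by exists (size l0); apply/asboolP; exists l0.
case: (ex_minnP exQ) => n /asboolP[l [Pl <- El]] minn; exists l; split=> // l' Pl' El'.
by apply: minn; apply/asboolP; exists l'; rewrite El' -El.
Qed.

Lemma shortest_alternating l : list_in P l -> shortest l ->
  l = alternating (gen i) (gen j) (size l) \/
  l = alternating (gen j) (gen i) (size l).
Proof.
elim/last_ind: l => [|l c IH]; first by left.
rewrite -{1}cats1 => /list_in_cat[Pl Pc] min_lc.
have {}Pc : P c by apply: Pc; rewrite inE.
have min_l : shortest l.
  move=> l' Pl' El'; rewrite -ltnS -(size_rcons l c) -(size_rcons l' c).
  apply: min_lc; last by rewrite !prodl_rcons El'.
  by rewrite -cats1; apply/list_in_cat; split=> // a; rewrite inE => /eqP->.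
have step a b n : a * a = 1 -> c = a \/ c = b -> l = alternating a b n ->
    rcons l c = alternating c (if c == a then b else a) n.+1.
  move=> a2 cab El; rewrite /= El; congr rcons.
  case: n El => [//|n] /= El; case: eqP cab => [ca _|_ [//|->//]].
  have Pl1 : list_in P (alternating b a n).
    by move: Pl; rewrite El -cats1 => /list_in_cat[].
  have := min_lc _ Pl1; rewrite El ca !prodl_rcons -mulgA a2 mulg1 => /(_ erefl).
  by rewrite !size_rcons ltnNge leqnSn.
have g2 s : gen s * gen s = 1 := gen2 s.
case: Pc => s sij sc; rewrite size_rcons.
have cij : c = gen i \/ c = gen j by rewrite -sc; case: sij => ->; [left|right].
case: (IH Pl min_l) => El.
  rewrite (step _ _ _ (g2 i) cij El); case: cij => ->.
    by left; rewrite eqxx.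
  by right; rewrite eq_sym (negbTE gen_neq).
have cji : c = gen j \/ c = gen i by case: cij; [right|left].
rewrite (step _ _ _ (g2 j) cji El); case: cij => ->; last by right; rewrite eqxx.
by left; rewrite (negbTE gen_neq).
Qed.

(** An element x of a dihedral group that both generators shorten on the
    right has two shortest expressions, the alternating words ending in
    either generator; their equality is the braid relation.  A longer
    alternating word is not shortest, since the braid relation makes two
    letters cancel, so every shortest word is a suffix of one of these two, and x
    has every right inversion that an element of the group can have. *)
Lemma dihedral_top x : K x -> inv x (gen i) -> inv x (gen j) ->
  (exists2 n, (0 < n)%N & (gen i * gen j) ^+ n = 1) /\
  forall y t, K y -> K t -> inv y t -> inv x t.
Proof.
move=> Kx invi invj; have [l [Pl Ex min_l]] := exists_shortest Kx.
set n := size l.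
have ends s : P (gen s) -> inv x (gen s) ->
    exists2 l', (size l').+1 = n & list_in P (rcons l' (gen s)) /\
      prodl (rcons l' (gen s)) = x.
  move=> Ps; rewrite -Ex => /(exchange m_cox subK wallK Pl (sub_generated Ps)).
  case=> l' [Pl' szl' El']; exists l' => //; split.
    by rewrite -cats1; apply/list_in_cat; split=> // a; rewrite inE => /eqP->.
  by rewrite prodl_rcons -El' -mulgA gen2 mulg1.
have shortestn l' : size l' = n -> prodl l' = x -> shortest l'.
  by move=> szl' El' l'' Pl'' El''; rewrite szl'; apply: min_l => //; rewrite El'' El' Ex.
have [li szi [Pli Eli]] := ends i Pi invi.
have [lj szj [Plj Elj]] := ends j Pj invj.
have szr (l' : seq W) c : (size l').+1 = n -> size (rcons l' c) = n by rewrite size_rcons.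
have xij : prodl (alternating (gen i) (gen j) n) = x.
  have [] := shortest_alternating Pli (shortestn _ (szr _ _ szi) Eli).
    by rewrite (szr _ _ szi) => <-.
  rewrite (szr _ _ szi) -szi /= => /rcons_inj[_ E].
  by have := gen_neq; rewrite E eqxx.
have xji : prodl (alternating (gen j) (gen i) n) = x.
  have [] := shortest_alternating Plj (shortestn _ (szr _ _ szj) Elj).
    rewrite (szr _ _ szj) -szj /= => /rcons_inj[_ E].
    by have := gen_neq; rewrite E eqxx.
  by rewrite (szr _ _ szj) => <-.
have n_gt0 : (0 < n)%N by rewrite -szi.
split; first by exists n; rewrite // -alternating_expg ?gen2 // xij xji mulVg.
move=> y t Ky Kt invy; have [ly [Ply Ey min_ly]] := exists_shortest Ky.
have main a b : prodl (alternating a b n) = x ->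
    prodl (alternating b a n) = x -> (forall c, c \in [:: a; b] -> P c) ->
    ly = alternating a b (size ly) -> inv x t.
  move=> xab xba Pab Ely.
  have Palt k : list_in P (alternating a b k) /\ list_in P (alternating b a k).
    elim: k => [//|k [IH1 IH2]] /=; rewrite -!cats1.
    by split; apply/list_in_cat; split=> // c; rewrite inE => /eqP->; apply: Pab; rewrite !inE eqxx ?orbT.
  have [n_lt|le_n] := ltnP n (size ly).
    have [z [Ez szz]] := alternating_suffix a b (size ly - n.+1) n.+1.
    rewrite subnK // -Ely in Ez.
    (* both expressions of x are the long word without one of its end letters *)
    have [q [c [Pq szq Eq Ec]]] : exists q c, [/\ list_in P q, size q = n.-1,
        alternating b a n = c :: q & c * c = 1 /\
        prodl (alternating a b n.+1) = c * x].
      have [z1 [E1 sz1]] := alternating_suffix a b 1 n.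
      case: z1 sz1 E1 => [//|c [|//]] _ E1.
      case E2 : (alternating b a n) => [|c' q].
        by have := size_alternating b a n; rewrite E2 /= => n0; rewrite -n0 in n_gt0.
      exists q, c.
      have Pcq : list_in P (c' :: q) by rewrite -E2; case: (Palt n).
      have cc' : c' = c by move: E1; rewrite add1n /= E2 => -[].
      subst c'; move/list_in_cons: Pcq => [[s _ Es] Pq].
      split=> //; first by rewrite -(size_alternating b a n) E2.
      split; first by rewrite -Es gen2.
      by move: E1; rewrite add1n => ->; rewrite /= xab.
    case: Ec => c2 Ec.
    have yq : prodl (z ++ q) = y.
      rewrite prodl_cat -Ey Ez prodl_cat Ec -xba Eq /=.
      by congr (_ * _); rewrite mulgA c2 mul1g.
    have Pzq : list_in P (z ++ q).
      apply/list_in_cat; split=> //.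
      by move: Ply; rewrite Ez => /list_in_cat[].
    have := min_ly _ Pzq; rewrite yq Ey => /(_ erefl).
    by rewrite Ez !size_cat szq size_alternating leq_add2l leqNgt ltnS leq_pred.
  have [z [Ez szz]] := alternating_suffix a b (n - size ly) (size ly).
  rewrite subnK // -Ely in Ez.
  have Pz : list_in P z by have [] := Palt n; rewrite Ez => /list_in_cat[].
  have Ezy : x = prodl z * y by rewrite -xab Ez prodl_cat Ey.
  rewrite Ezy invM invy /=; apply/negP => invz.
  have Kty : K (t ^ y^-1) by apply: (subgroupJ subK) => //; apply: (subgroupV subK).
  have [z' [Pz' szz' Ez']] := exchange m_cox subK wallK Pz Kty invz.
  move: invy; rewrite -Ey => invy.
  have [y' [Py' szy' Ey']] := exchange m_cox subK wallK Ply Kt invy.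
  have := min_l (z' ++ y').
  have -> : prodl (z' ++ y') = prodl l.
    rewrite prodl_cat -Ez' -Ey' Ex Ezy Ey conjgE invgK -!mulgA mulKg.
    by rewrite (inverts_sqr invy) mulg1.
  have Pzy : list_in P (z' ++ y') by apply/list_in_cat.
  move=> /(_ Pzy erefl); rewrite -/n size_cat -(subnK le_n) -szz -szz' -szy'.
  by rewrite addSn addnS ltnNge ltnW.
have Pij a : a \in [:: gen i; gen j] -> P a by rewrite !inE => /orP[]/eqP->.
have Pji a : a \in [:: gen j; gen i] -> P a by rewrite !inE => /orP[]/eqP->.
case: (shortest_alternating Ply min_ly) => Ely.
  exact: (main _ _ xij xji Pij Ely).
exact: (main _ _ xji xij Pji Ely).
Qed.

(** In terms of left descents: write w = v u with v in the dihedral group and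
    no wall of that group separating 1 from u^-1.  The left descents of w among the
    two generators are those of v, so the coset of w contains exactly one
    element with both descents, and a wall separating 1 from another element of
    the coset separates 1 from w as well. *)
Lemma double_descent (H : set W) w : in_chamber H w ->
  inv w (gen i ^ w) -> inv w (gen j ^ w) ->
  [/\ exists2 n, (0 < n)%N & (gen i * gen j) ^+ n = 1,
      forall y, K y -> in_chamber H (y * w)
    & forall y, K y -> inv (y * w) (gen i ^ (y * w)) ->
        inv (y * w) (gen j ^ (y * w)) -> y = 1].
Proof.
move=> Cw Di Dj.
have [p [h [wE _ Cp Gh]]] := chamber_decomposition m_cox subK (special_setT w^-1).
have Kh : K h by apply: generated_min Gh => // r [? [? []]].
have descent y t : K y -> K t -> inv (y * w) (t ^ (y * w)) = inv (h * y^-1) t.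
  move=> Ky Kt; rewrite -invV invgM wE -mulgA [LHS]invM.
  rewrite (_ : inv p _ = false) ?addbF //; apply/negbTE/Cp.
  apply: (subgroupJ subK) => //; apply: (subgroupV subK).
  by apply: (subgroupM subK) => //; apply: (subgroupV subK).
have K1 : K 1 := subgroup1 subK.
have hi : inv h (gen i) by have := descent 1 _ K1 Ki; rewrite mul1g Di invg1 mulg1.
have hj : inv h (gen j) by have := descent 1 _ K1 Kj; rewrite mul1g Dj invg1 mulg1.
have [ord_ij max_h] := dihedral_top Kh hi hj.
have KhV y : K y -> K (h * y^-1).
  by move=> Ky; apply: (subgroupM subK) => //; apply: (subgroupV subK).
split=> // [y Ky t Ht|y Ky]; last first.
  rewrite !descent // => yi yj.
  have [_ max_hy] := dihedral_top (KhV y Ky) yi yj.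
  have same t : K t -> inv (h * y^-1) t = inv h t.
    by move=> Kt; apply/idP/idP => [/(max_h _ t (KhV y Ky) Kt)|/(max_hy _ t Kh Kt)].
  suff E : (h * y^-1) * h^-1 = 1.
    by apply: invg_inj; rewrite invg1; apply: (mulgI h); rewrite mulg1 (divg1_eq E).
  apply: (in_chamber_eq1 m_cox subK wallK).
    apply: (subgroupM subK); first exact: KhV.
    exact: (subgroupV subK).
  move=> t Kt; have Kth : K (t ^ h) by apply: (subgroupJ subK).
  by rewrite invM invV invgK same // addbb.
have wE' : w = h^-1 * p^-1 by rewrite -invgM -wE invgK.
have disjoint v : K v -> ~~ (inv p^-1 t && inv v (t ^ p)).
  move=> Kv; apply/andP => -[]; rewrite invV => invp.
  move=> /(inverts_reflection Kv)[s [z [sij Kz tE]]].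
  have /Cp : K (t ^ p).
    by rewrite tE; apply: (subgroupJ subK) => //; case: sij => ->.
  by rewrite invp.
have KhV1 : K h^-1 := subgroupV subK Kh.
have := Cw t Ht; rewrite wE' mulgA.
rewrite [inv (h^-1 * p^-1) t]invM [inv (y * h^-1 * p^-1) t]invM invgK.
have := disjoint _ KhV1; have := disjoint _ (subgroupM subK Ky KhV1).
case: (inv p^-1 t) => /=; first by move=> /negbTE-> /negbTE->.
move=> _ _; apply: contra => /(inverts_reflection (subgroupM subK Ky KhV1)).
move=> [s [z [sij Kz ->]]]; rewrite invV -conjgM.
apply: (max_h (gen s ^ (z * h))); last exact: inversion_conj.
  by apply: (subgroupJ subK); [case: sij => ->|apply: (subgroupM subK)].
by apply: (subgroupJ subK); [case: sij => ->|apply: (subgroupM subK)].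
Qed.

End Pair.
End DihedralTops.

(** * A reflection representation *)

Section ReflectionRepresentation.
Local Open Scope ring_scope.
Import GRing.Theory Num.Theory.
Variables (S : finType) (m : S -> S -> option nat).
Hypotheses (m_cox : is_coxeter_matrix m) (m_odd : odd_angled m).

(** With a primitive k-th root of unity z and k odd, the Cartan entry -(z + 1/z)
    makes the product of two reflections have order exactly k, with
    eigenvalues z^2 and z^-2.  The value 2 at infinity gives the eigenvalue 4, hence a
    product of infinite order. *)
Definition order_root (o : option nat) : algC :=
  match o with
  | Some k.+1 => sval (C_prim_root_exists (ltn0Sn k))
  | _ => 2
  end.

Lemma order_root_neq0 o : order_root o != 0.
Proof.
case: o => [[|k]|] /=; rewrite ?pnatr_eq0 //; case: C_prim_root_exists => z /= z_prim.
by apply: contra_eq_neq (prim_expr_order z_prim) => ->; rewrite expr0n eq_sym oner_eq0.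
Qed.

Definition cartan (s t : S) : algC :=
  if s == t then 2 else - (order_root (m s t) + (order_root (m s t))^-1).

Definition reflection (s : S) (v : S -> algC) : S -> algC :=
  fun u => v u - cartan s u * v s.

Lemma reflectionK s : involutive (reflection s).
Proof.
by move=> v; apply: funext => u; rewrite /reflection [cartan s s]/cartan eqxx; ring.
Qed.

Section Pair.
Variables s t : S.
Hypothesis st : s != t.
Let z := order_root (m s t).
Let z_neq0 : z != 0. Proof. exact: order_root_neq0. Qed.

Lemma cartan_pair : cartan s t = - (z + z^-1) /\ cartan t s = - (z + z^-1).
Proof.
by case: m_cox => _ msym _; rewrite /cartan (eq_sym t s) (negbTE st) (msym t s).
Qed.

(** The functionals v_s + x v_t with x = z or 1 / z are eigenvectors of the
    product of the two reflections, for the eigenvalue x ^ 2. *)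
Lemma reflection_eigen x (v : S -> algC) : x = z \/ x = z^-1 ->
  reflection s (reflection t v) s + x * reflection s (reflection t v) t =
  x ^+ 2 * (v s + x * v t).
Proof.
have [cst cts] := cartan_pair.
rewrite /reflection cst cts [cartan s s]/cartan [cartan t t]/cartan !eqxx.
by case=> ->; field.
Qed.

Lemma reflection_eigen_iter x v n : x = z \/ x = z^-1 ->
  iter n (reflection s \o reflection t) v s
    + x * iter n (reflection s \o reflection t) v t =
  (x ^+ 2) ^+ n * (v s + x * v t).
Proof.
move=> xz; elim: n => [|n IH]; first by rewrite expr0 mul1r.
by rewrite !iterS [LHS]reflection_eigen // IH [in RHS]exprS mulrA.
Qed.

(** The product of two reflections changes v by a combination of two fixed
    vectors, so its iterates are controlled by the sums of two coordinates. *)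
Lemma reflection_iter_sum v n u :
  iter n (reflection s \o reflection t) v u = v u
  - cartan t u * \sum_(i < n) iter i (reflection s \o reflection t) v t
  - cartan s u * (\sum_(i < n) iter i (reflection s \o reflection t) v s
     - cartan t s * \sum_(i < n) iter i (reflection s \o reflection t) v t).
Proof.
elim: n => [|n IH]; first by rewrite !big_ord0 /=; ring.
have step w : reflection s (reflection t w) u =
  w u - cartan t u * w t - cartan s u * (w s - cartan t s * w t) by [].
rewrite iterS [LHS]step IH !big_ord_recr /=; set w := iter n _ v.
by ring.
Qed.

(** Both eigenvalues of the product are k-th roots of unity other than 1, so the
    geometric sums of their powers vanish, and with them every term of
    [reflection_iter_sum] but the first. *)
Lemma reflection_order k : m s t = Some k ->
  forall v, iter k (reflection s \o reflection t) v = v.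
Proof.
move=> mst v; apply: funext => u; rewrite reflection_iter_sum.
set A := \sum_(i < k) iter i _ v s; set B := \sum_(i < k) iter i _ v t.
have k_ge2 : (2 <= k)%N by case: m_cox => _ _ m2; apply: m2 mst.
have z_prim : k.-primitive_root z.
  rewrite /z mst; case: k k_ge2 {mst A B} => [//|k _] /=.
  by case: C_prim_root_exists.
have z2 : z ^+ 2 != 1.
  rewrite -(prim_order_dvd z_prim); apply: contraL (m_odd st mst).
  by move=> /(@dvdn_leq k 2 isT) k_le2; rewrite (_ : k = 2)%N //; apply/eqP; rewrite eqn_leq k_le2.
have zV2 : (z^-1) ^+ 2 != 1 by rewrite exprVn invr_eq1.
have sum0 x : x = z \/ x = z^-1 -> A + x * B = 0.
  move=> xz; have x2 : x ^+ 2 != 1 by case: xz => ->.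
  have xk : x ^+ k = 1.
    by case: xz => ->; rewrite ?exprVn (prim_expr_order z_prim) ?invr1.
  rewrite mulr_sumr -big_split /=.
  under eq_bigr => i _ do rewrite reflection_eigen_iter //.
  rewrite -mulr_suml; apply/eqP; rewrite mulf_eq0; apply/orP; left.
  rewrite -(inj_eq (mulfI (_ : x ^+ 2 - 1 != 0))) ?subr_eq0 // -subrX1.
  by rewrite exprAC xk expr1n subrr mulr0.
have B0 : B = 0.
  have /eqP : (z - z^-1) * B = 0.
    have -> : (z - z^-1) * B = (A + z * B) - (A + z^-1 * B) by ring.
    by rewrite !sum0 ?subrr //; [right|left].
  rewrite mulf_eq0 subr_eq0 => /orP[/eqP zV|/eqP//].
  by case/eqP: z2; rewrite expr2 {1}zV mulVf.
have A0 : A = 0 by have := sum0 z (or_introl erefl); rewrite B0 mulr0 addr0.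
by rewrite A0 B0; ring.
Qed.

End Pair.

Lemma reflection_action : is_coxeter_action m reflection.
Proof.
split=> [|s t k mst v]; first exact: reflectionK.
have [st|st] := eqVneq s t; last exact: (reflection_order st mst).
move: mst; rewrite -st; case: m_cox => -> _ _ [<-].
by rewrite /= reflectionK.
Qed.

Lemma coxeter_gen_inj : injective (coxeter_gen m).
Proof.
move=> s t E; apply/eqP/negP => /negP st.
pose v u : algC := (u == s)%:R.
have := cox_act_gen reflection_action s v; rewrite E (cox_act_gen reflection_action).
move=> /(congr1 (@^~ s)); rewrite /reflection /v eqxx (eq_sym t) (negbTE st).
rewrite /cartan eqxx mulr0 subr0 mulr1 => /eqP.
by rewrite -subr_eq0 (_ : _ - _ = 2) ?pnatr_eq0 //; ring.
Qed.

Lemma coxeter_gen_infinite_order s t n : m s t = None -> (0 < n)%N ->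
  ((coxeter_gen m s * coxeter_gen m t) ^+ n)%g <> 1%g.
Proof.
move=> mst n_gt0 E.
have st : s != t.
  by apply/eqP => st; move: mst; rewrite st; case: m_cox => ->.
pose v u : algC := (u == s)%:R.
have act k : cox_act reflection ((coxeter_gen m s * coxeter_gen m t) ^+ k)%g v =
    iter k (reflection s \o reflection t) v.
  elim: k => [|k IH]; first exact: cox_act1 reflection_action v.
  by rewrite expgS !(cox_actM reflection_action) IH !(cox_act_gen reflection_action).
have := reflection_eigen_iter st v n (or_introl erefl).
rewrite -act E (cox_act1 reflection_action) /v eqxx (eq_sym t) (negbTE st).
rewrite mulr0 addr0 mulr1 mst /= -exprM => /esym/eqP; apply/negP.
rewrite -natrX -[1]/(1%:R) eqr_nat; case: n n_gt0 {E act} => [//|n _].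
by rewrite mulnS expnD; apply/negP => /eqP/(congr1 (dvdn 2)); rewrite -mulnA dvdn_mulr.
Qed.

End ReflectionRepresentation.

(** * The alcoves of a chamber *)

(** The alcoves of a finite index reflection subgroup in its chamber, as a
    finite combinatorial object.  The map [f s] crosses the wall of type [s],
    or stays put when that wall bounds the chamber; [D s x] says that the wall
    of type [s] of [x] separates [x] from the base alcove. *)
Section ChamberModel.
Variables (S : finType) (m : S -> S -> option nat).

Inductive dihedral_orbit (X : Type) (f : S -> X -> X) s t x : X -> Prop :=
  | Orbit_refl : dihedral_orbit f s t x x
  | Orbit_left y : dihedral_orbit f s t x y -> dihedral_orbit f s t x (f s y)
  | Orbit_right y : dihedral_orbit f s t x y -> dihedral_orbit f s t x (f t y).

Record chamber_model (T : set S) (X : finType) (f : S -> X -> X)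
    (D : S -> pred X) : Prop := ChamberModel {
  model_invol : forall s, T s -> involutive (f s);
  model_order : forall s t k, T s -> T t -> m s t = Some k ->
    forall x, iter k (f s \o f t) x = x;
  model_simple : forall s t x, T s -> T t -> s != t -> f s x = f t x -> f s x = x;
  model_moved : forall x, exists2 s, T s & f s x != x;
  model_descent_moved : forall s x, T s -> D s x -> f s x != x;
  model_descent : forall s x, T s -> f s x != x -> D s (f s x) = ~~ D s x;
  model_base : exists x, forall s, T s -> ~~ D s x;
  model_top_order : forall s t x, T s -> T t -> s != t -> D s x -> D t x ->
    m s t != None;
  model_top_free : forall s t x, T s -> T t -> s != t -> D s x -> D t x ->
    forall y, dihedral_orbit f s t x y -> f s y != y /\ f t y != y;
  model_top_unique : forall s t x, T s -> T t -> s != t -> D s x -> D t x ->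
    forall y, dihedral_orbit f s t x y -> D s y -> D t y -> y = x }.

Hypotheses (m_cox : is_coxeter_matrix m) (m_odd : odd_angled m).
Local Notation W := (coxeter_group m).
Local Notation gen := (coxeter_gen m).
Local Notation special := (@special_subgroup S m).

(** The alcoves are the elements p of W_T with [in_chamber H p], one for each coset
    of H.  Crossing a wall that belongs to H would
    leave the chamber, and then the alcove is fixed instead: up to H this is left
    multiplication all the same, which gives the orders.  Two descents generate
    a dihedral group whose orbit stays in the chamber, by [double_descent]. *)
Lemma finite_index_model (T : set S) :
  has_finite_index_reflection_subgroup m T ->
  exists (X : finType) (f : S -> X -> X) (D : S -> pred X), chamber_model T f D.
Proof.
case=> H [[HT nTH] [A AT HE]] fin_H.
have sH : is_subgroup H by rewrite HE; apply: generated_subgroup.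
have uniqueH p h : H h -> in_chamber H p -> in_chamber H (p * h) -> h = 1.
  by rewrite HE => Hh; apply: (chamber_inj m_cox AT Hh).
pose P : set W := [set p | special T p /\ in_chamber H p].
pose coset (p : W) : set W := [set p * h | h in H].
have finP : finite_set P.
  have inj_coset : {in P &, injective coset}.
    move=> p q; rewrite !inE => -[_ Cp] [_ Cq] pq.
    have [h Hh ph] : coset q p by rewrite -pq; exists 1; rewrite ?mulg1 //; apply: subgroup1.
    have h1 : h = 1 by apply: (uniqueH q) => //; rewrite ph.
    by rewrite -ph h1 mulg1.
  rewrite -(eq_finite_set (inj_card_eq inj_coset)).
  by apply: sub_finite_set fin_H => _ [p [Wp _] <-]; exists p.
have [l Pl] := proj1 (finite_seqP P) finP.
have lP p : (p \in l) <-> P p by rewrite Pl.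
pose X : finType := seq_sub l.
pose f s (x : X) : X :=
  if `[< H (gen s ^ val x) >] then x else insubd x (gen s * val x).
pose D s (x : X) := inverts (val x) (gen s ^ val x).
have PX (x : X) : P (val x) by apply/lP/valP.
have f_fix s x : H (gen s ^ val x) -> f s x = x by rewrite /f => Hs; case: asboolP.
have P_step s p : T s -> P p -> ~ H (gen s ^ p) -> P (gen s * p).
  move=> Ts [Wp Cp] nH; split; last exact: in_chamber_step.
  by apply: specialM => //; apply: special_gen.
have f_move s x : T s -> ~ H (gen s ^ val x) -> val (f s x) = gen s * val x.
  move=> Ts nH; rewrite /f; case: asboolP => // _.
  by rewrite insubdK //; apply/lP/P_step.
clearbody f coset.
have moveP s x : T s -> reflect (~ H (gen s ^ val x)) (f s x != x).
  move=> Ts; apply: (iffP idP) => [/eqP fx Hs|nH].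
    by apply: fx; apply: f_fix.
  apply/eqP => /(congr1 val).
  rewrite f_move // -[RHS]mul1g => /mulIg gs1; apply: nH.
  by rewrite gs1 conj1g; apply: subgroup1.
have gen_conj s p : gen s ^ (gen s * p) = gen s ^ p.
  by rewrite conjgM [gen s ^ gen s]conjgE (coxeter_gen2 m_cox) mulg1 coxeter_genV.
have inv_gen s p : inverts (gen s * p) (gen s ^ p) = ~~ inverts p (gen s ^ p).
  by rewrite inversionM // inversion_gen // conjgK eqxx addbT.
have Df s x : T s -> f s x != x -> D s (f s x) = ~~ D s x.
  by move=> Ts /moveP nH; rewrite /D f_move ?gen_conj ?inv_gen //; apply: nH.
have valf s (x : X) : T s -> exists2 h, H h & val (f s x) = gen s * val x * h.
  move=> Ts; have [Hs|nH] := pselect (H (gen s ^ val x)).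
    exists (gen s ^ val x); rewrite // f_fix // -mulgA -conjgC.
    by rewrite mulgA (coxeter_gen2 m_cox) mul1g.
  by exists 1; rewrite ?mulg1 ?f_move //; apply: subgroup1.
have inv_f s : T s -> involutive (f s).
  move=> Ts x; case: (moveP s x Ts) => [nH|/contrapT/f_fix fx]; last by rewrite !fx.
  have nH2 : ~ H (gen s ^ val (f s x)) by rewrite f_move // gen_conj.
  by apply: val_inj; rewrite (f_move _ _ Ts nH2) (f_move _ _ Ts nH) coxeter_genK.
have free s t x (st : s != t) (Ts : T s) (Tt : T t) (Ds : D s x) (Dt : D t x) :
    forall y, dihedral_orbit f s t x y ->
    exists z, [/\ special [set s; t] z, val y = z * val x,
      ~ H (gen s ^ val y) & ~ H (gen t ^ val y)].
  have [_ Cx] := PX x.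
  have gst : gen s != gen t by apply: contra_neq st; apply: coxeter_gen_inj.
  have [_ Ck _] := double_descent m_cox gst Cx Ds Dt.
  have sK := generated_subgroup (gen @` [set s; t]).
  have Ks : special [set s; t] (gen s) by apply: special_gen; left.
  have Kt : special [set s; t] (gen t) by apply: special_gen; right.
  have nH r z : special [set s; t] z -> special [set s; t] (gen r) ->
      ~ H (gen r ^ (z * val x)).
    move=> Kz Kr Hr; have := Ck _ (subgroupM sK Kr Kz) _ Hr.
    rewrite -mulgA inv_gen negbK; apply/negP.
    exact: (Ck _ Kz).
  have orbit z (y : X) : special [set s; t] z -> val y = z * val x ->
    exists z, [/\ special [set s; t] z, val y = z * val x,
      ~ H (gen s ^ val y) & ~ H (gen t ^ val y)].
    by move=> Kz yz; exists z; rewrite yz; split=> //; apply: nH.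
  move=> y; elim=> [|{}y _ [z [Kz yz Hs Ht]]|{}y _ [z [Kz yz Hs Ht]]].
  - apply: (orbit 1); [exact: subgroup1|by rewrite mul1g].
  - apply: (orbit (gen s * z)); first exact: (subgroupM sK).
    by rewrite f_move // yz mulgA.
  - apply: (orbit (gen t * z)); first exact: (subgroupM sK).
    by rewrite f_move // yz mulgA.
exists X, f, D; split=> //.
- move=> s t k Ts Tt mst x.
  have iterE n : exists2 h, H h & val (iter n (f s \o f t) x) =
      (gen s * gen t) ^+ n * val x * h.
    elim: n => [|n [h Hh IH]].
      by exists 1; [apply: subgroup1|rewrite expg0 mul1g mulg1].
    set y := iter n _ x in IH *.
    have [h1 Hh1 E1] := valf t y Tt; have [h2 Hh2 E2] := valf s (f t y) Ts.
    exists (h * (h1 * h2)); first by do 2?apply: (subgroupM sH).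
    by rewrite iterS -/y /= E2 E1 IH expgS !mulgA.
  have [h Hh] := iterE k; rewrite (coxeter_braid mst) mul1g => E.
  apply: val_inj; rewrite E (uniqueH (val x) h) ?mulg1 //; first by case: (PX x).
  by rewrite -E; case: (PX (iter k (f s \o f t) x)).
- move=> s t x Ts Tt st fst; apply/eqP/negPn/negP => fsx.
  have ftx : f t x != x by rewrite -fst.
  have := congr1 val fst; rewrite !f_move //; try exact/moveP.
  by move=> /mulIg/(coxeter_gen_inj m_cox m_odd)/eqP; apply/negP.
- move=> x; apply: contrapT => nmove; apply: nTH.
  have Hs s : T s -> H (gen s ^ val x).
    move=> Ts; apply: contrapT => nH; apply: nmove; exists s => //.
    exact/moveP.
  have [Wx _] := PX x; have sW := generated_subgroup (gen @` T).
  have HJ w : special T w -> H (w ^ val x).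
    elim/(special_ind m_cox): w /; first by rewrite conj1g; apply: subgroup1.
    by move=> s w Ts _ Hw; rewrite conjMg; apply: (subgroupM sH) => //; apply: Hs.
  move=> w Ww; rewrite -(conjgKV (val x) w); apply: HJ.
  by apply: (subgroupJ sW) => //; apply: (subgroupV sW).
- move=> s x Ts Dx; apply/moveP => // Hs.
  by case: (PX x) => _ /(_ _ Hs); rewrite [inverts _ _]Dx.
- have P1 : P 1 by split; [apply: (subgroup1 (generated_subgroup _))|exact: in_chamber1].
  pose x1 : X := SeqSub (proj2 (lP 1) P1); exists x1 => s _.
  by rewrite /D /= inversion1.
- move=> s t x Ts Tt st Ds Dt; have [_ Cx] := PX x.
  have gst : gen s != gen t by apply: contra_neq st; apply: coxeter_gen_inj.
  have [[n n_gt0 En] _ _] := double_descent m_cox gst Cx Ds Dt.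
  by apply/eqP => mst; apply: (coxeter_gen_infinite_order m_cox m_odd mst n_gt0 En).
- move=> s t x Ts Tt st Ds Dt y /(free s t x st Ts Tt Ds Dt)[z [_ _ Hs Ht]].
  by split; apply/moveP.
move=> s t x Ts Tt st Ds Dt y /(free s t x st Ts Tt Ds Dt)[z [Kz yz _ _]].
rewrite /D yz => Dsy Dty; apply: val_inj; rewrite yz.
have [_ Cx] := PX x.
have gst : gen s != gen t by apply: contra_neq st; apply: coxeter_gen_inj.
have [_ _ uniq] := double_descent m_cox gst Cx Ds Dt.
by rewrite (uniq z) ?mul1g.
Qed.

End ChamberModel.

(** * Orbits of two involutions with a product of odd order *)

Section TwoInvolutions.
Local Open Scope set_scope.
Local Open Scope nat_scope.
Variables (X : finType) (a b : X -> X) (k : nat).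
Hypotheses (aK : involutive a) (bK : involutive b).
Hypothesis ordk : forall x, iter k (a \o b) x = x.
Local Notation r := (a \o b).
Local Notation r' := (b \o a).

Lemma rotK n : cancel (iter n r) (iter n r').
Proof. by elim: n => // n IH x; rewrite iterSr iterS /= aK bK IH. Qed.

Lemma rotVK n : cancel (iter n r') (iter n r).
Proof. by elim: n => // n IH x; rewrite iterSr iterS /= bK aK IH. Qed.

Lemma rot_inj n : injective (iter n r).
Proof. exact: can_inj (rotK n). Qed.

Lemma rot_conj n x : a (iter n r x) = iter n r' (a x).
Proof. by elim: n x => // n IH x; rewrite iterSr IH [RHS]iterSr /= !aK. Qed.

Lemma iter_rot_mul n j x : iter n r x = x -> iter (j * n) r x = x.
Proof. by move=> nx; elim: j => // j IH; rewrite mulSn iterD IH. Qed.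

Lemma rot_fixed_coprime n x : coprime n k -> iter n r x = x -> r x = x.
Proof.
move=> cnk nx; have [n0|n_gt0] := posnP n.
  by move: cnk; rewrite n0 /coprime gcd0n => /eqP k1; have := ordk x; rewrite k1.
have [u v uv _] := egcdnP k n_gt0.
have := iter_rot_mul u nx; rewrite uv (eqP cnk) addn1 iterS /=.
by rewrite iter_rot_mul.
Qed.

Hypothesis k_odd : odd k.

Lemma rot_conj_half n x : exists i, iter n r x = iter i.*2 r x.
Proof.
have [n_odd|n_even] := boolP (odd n); last first.
  by exists n./2; rewrite even_halfK.
exists (n + k)./2; rewrite even_halfK ?oddD ?n_odd ?k_odd //.
by rewrite iterD ordk.
Qed.

Lemma half_flip_fixed n x : a x = iter n r x -> exists i, a (iter i r x) = iter i r x.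
Proof.
have [i ->] := rot_conj_half n x => ax; exists i.
by rewrite rot_conj ax -addnn iterD rotK.
Qed.

(** Since k is odd, a and b are conjugate by a power of their product. *)
Lemma card_fixed_le : #|[set x | a x == x]| <= #|[set x | b x == x]|.
Proof.
rewrite -(card_imset _ (@rot_inj k./2)); apply/subset_leq_card/fintype.subsetP => z.
move=> /imsetP[x]; rewrite inE => /eqP ax ->; rewrite inE; apply/eqP.
have bx : b x = r' x by rewrite /= ax.
have b_conj n z0 : b (iter n r z0) = iter n r' (b z0).
  by elim: n z0 => // n IH z0; rewrite iterSr IH [RHS]iterSr.
have ek : iter k r x = iter k./2.+1 r (iter k./2 r x).
  by rewrite -iterD addSn addnn -[in LHS](odd_double_half k) k_odd.
by rewrite b_conj bx -iterSr -{1}(ordk x) ek rotK.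
Qed.

Hypothesis k_gt1 : 1 < k.

Lemma coprime_lt_pdiv d : 0 < d < pdiv k -> coprime d k.
Proof.
move=> /andP[d_gt0 d_lt]; rewrite coprime_has_primes //; last by rewrite ltnW.
apply/hasPn => q; rewrite !mem_primes => /and3P[q_pr _ q_k].
apply/negP => /and3P[_ _ q_d]; have := pdiv_min_dvd (prime_gt1 q_pr) q_k.
by rewrite leqNgt => /negP; apply; apply: leq_ltn_trans d_lt; apply: dvdn_leq.
Qed.

Lemma rot_small_fixed d x : d < pdiv k -> iter d r x = x -> d = 0 \/ a x = b x.
Proof.
move=> d_lt dx; have [->|d_gt0] := posnP d; [by left|right].
have := rot_fixed_coprime (coprime_lt_pdiv _) dx; rewrite d_gt0 d_lt => /(_ isT).
by move=> rx; rewrite -{1}rx /= aK.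
Qed.

Lemma rot_index_inj d d' x : d < pdiv k -> d' < pdiv k ->
  iter d r x = iter d' r x -> d = d' \/ a x = b x.
Proof.
wlog le_dd : d d' / d <= d'.
  move=> th dp dp' E; have [le|/ltnW le] := leqP d d'; first exact: th.
  by case: (th _ _ le dp' dp (esym E)) => [->|]; [left|right].
move=> dp dp'; rewrite -(subnKC le_dd) iterD => /rot_inj E.
have := rot_small_fixed (leq_ltn_trans (leq_subr _ _) dp') (esym E).
by case=> [->|]; [left; rewrite addn0|right].
Qed.

(** A point fixed by a only lies on a path of at least pdiv k points, on which
    it is the only fixed point of a. *)
Lemma card_half_fixed (F : {set X}) :
  (forall x i, iter i r x \in F -> a x != x) ->
  (pdiv k) * #|[set x | (a x == x) && (b x != x)]|
  + #|[set x | (a x == x) && (b x == x)]| + #|F| <= #|X|.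
Proof.
move=> FP; set A := [set x | (a x == x) && (b x != x)].
set B := [set x | (a x == x) && (b x == x)].
pose g (xi : X * 'I_(pdiv k)) := iter xi.2 r xi.1.
have notB x i : x \in A -> iter i r x \notin B.
  rewrite !inE => /andP[/eqP ax bx]; apply/negP => /andP[/eqP ay /eqP By].
  have ry : r (iter i r x) = iter i r x by rewrite /= By ay.
  have rx : r x = x by apply: (@rot_inj i); rewrite -[RHS]ry -iterSr.
  by case/eqP: bx; rewrite -[LHS]aK -[a (b x)]/(r x) rx ax.
have injg : {in [set xi : X * 'I_(pdiv k) | xi.1 \in A] &, injective g}.
  move=> [x i] [x' j]; rewrite !inE /g /= => /andP[/eqP ax bx] /andP[/eqP ax' bx'].
  have abx : a x <> b x by move=> E; case/eqP: bx; rewrite -E.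
  have main y y' (i' j' : 'I_(pdiv k)) : a y = y -> a y' = y' -> b y' != y' ->
      i' <= j' -> iter i' r y = iter j' r y' -> y = y'.
    move=> ay ay' by' le_ij; rewrite -(subnKC le_ij) iterD => /rot_inj yE.
    have d_lt : j' - i' < pdiv k by rewrite (leq_ltn_trans (leq_subr _ _)).
    set d := j' - i' in yE d_lt; suff d0 : d = 0 by rewrite yE d0.
    have d2 : iter d.*2 r y' = y'.
      have -> : iter d.*2 r y' = iter d r (a y) by rewrite -addnn iterD ay yE.
      by rewrite yE rot_conj ay' rotVK.
    have [//|d_gt0] := posnP d; case/eqP: by'.
    have ry' : r y' = y'.
      apply: rot_fixed_coprime d2; rewrite -mul2n coprimeMl coprime2n k_odd /=.
      by apply: coprime_lt_pdiv; rewrite d_gt0.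
    by rewrite -[LHS]aK -[a (b y')]/(r y') ry' ay'.
  move=> E; have xx' : x = x'.
    have [le|/ltnW le] := leqP i j; first exact: (main _ _ _ _ ax ax' bx' le E).
    exact/esym/(main _ _ _ _ ax' ax bx le (esym E)).
  rewrite -xx' in E *; case: (rot_index_inj (ltn_ord i) (ltn_ord j) E) => // ij.
  by congr (_, _); apply: val_inj.
have cardA : pdiv k * #|A| = #|g @: [set xi : X * 'I_(pdiv k) | xi.1 \in A]|.
  rewrite card_in_imset //.
  have -> : [set xi : X * 'I_(pdiv k) | xi.1 \in A] = finset.setX A [set: 'I_(pdiv k)].
    by apply/finset.setP => -[x i]; rewrite !inE andbT.
  by rewrite cardsX cardsT card_ord mulnC.
rewrite cardA; set G := g @: _.
have union (P Q : {set X}) : (forall y, y \in P -> y \notin Q) ->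
    #|P| + #|Q| = #|P :|: Q|.
  move=> PQ; have /leqifP := leq_card_setU P Q.
  case: ifP => [_ /eqP //|]; rewrite disjoint_subset => /fintype.subsetP[] y /PQ.
  by rewrite inE.
rewrite union => [|_ /imsetP[[x i] xi ->]]; last by apply: notB; rewrite inE in xi.
rewrite union ?max_card // => y; rewrite finset.in_setU => /orP[/imsetP[[x i]]|].
  rewrite !inE /g /= => /andP[/eqP ax _] ->; apply/negP => /FP.
  by rewrite ax eqxx.
rewrite inE => /andP[ay _]; apply/negP => Fy.
by have := FP y 0 Fy; rewrite ay.
Qed.

(** Distinct points of P lie in distinct orbits, and each of these orbits is
    a cycle of at least 2 pdiv k points inside F. *)
Lemma card_cycles (P F : {set X}) :
  (forall x i, x \in P -> iter i r x \in F /\ a (iter i r x) \in F) ->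
  (forall x, x \in F -> a x != x /\ a x != b x) ->
  (forall x i, x \in P -> iter i r x \in P -> iter i r x = x) ->
  (forall x i, x \in P -> a (iter i r x) \in P -> a (iter i r x) = x) ->
  2 * pdiv k * #|P| <= #|F|.
Proof.
move=> PF Fab P_rot P_flip.
have PFx x : x \in P -> x \in F by move=> /PF-/(_ 0)[].
pose g (xi : X * 'I_(pdiv k) * bool) :=
  let y := iter xi.1.2 r xi.1.1 in if xi.2 then a y else y.
have back x x' (i j : nat) : iter i r x = iter j r x' -> exists l, x = iter l r x'.
  move=> E; have : iter i r (iter (i * k.-1 + j) r x') = iter i r x.
    rewrite -iterD addnA -[X in X + _]/(i + i * k.-1) -mulnS prednK ?(ltnW k_gt1) //.
    by rewrite iterD iter_rot_mul.
  by move=> /rot_inj <-; exists (i * k.-1 + j).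
have same x x' (i j : 'I_(pdiv k)) : x \in P -> x' \in P ->
    iter i r x = iter j r x' -> (x, i) = (x', j).
  move=> Px Px' E; have [l xE] := back _ _ _ _ E.
  have xx' : x = x' by rewrite xE P_rot // -xE.
  rewrite xx' in E *; case: (rot_index_inj (ltn_ord i) (ltn_ord j) E) => [ij|ab].
    by congr (_, _); apply: val_inj.
  by have [_] := Fab _ (PFx _ Px'); rewrite ab eqxx.
have flip x x' (i j : nat) : x \in P -> x' \in P -> a (iter i r x) <> iter j r x'.
  move=> Px Px' E; have ax : a x = iter (i + j) r x'.
    by apply: (can_inj (rotVK i)); rewrite -rot_conj E iterD rotK.
  have xx' : x = x'.
    have xE : x = a (iter (i + j) r x') by rewrite -ax aK.
    by rewrite xE; apply: P_flip; rewrite -?xE.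
  move: ax; rewrite -xx' => /half_flip_fixed[l al].
  by have [/Fab[]] := PF x l Px; rewrite al eqxx.
have injg : {in [set xi : X * 'I_(pdiv k) * bool | xi.1.1 \in P] &, injective g}.
  move=> [[x i] c] [[x' j] c']; rewrite !inE /g /= => Px Px'.
  case: c; case: c'.
  - by move=> /(can_inj aK) E; rewrite (same _ _ _ _ Px Px' E).
  - by move=> /(flip _ _ _ _ Px Px').
  - by move=> /esym/(flip _ _ _ _ Px' Px).
  - by move=> E; rewrite (same _ _ _ _ Px Px' E).
have -> : 2 * pdiv k * #|P| =
    #|g @: [set xi : X * 'I_(pdiv k) * bool | xi.1.1 \in P]|.
  rewrite card_in_imset //.
  have -> : [set xi : X * 'I_(pdiv k) * bool | xi.1.1 \in P] =
      finset.setX (finset.setX P [set: 'I_(pdiv k)]) [set: bool].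
    by apply/finset.setP => -[[x i] c]; rewrite !inE !andbT.
  by rewrite !cardsX !cardsT card_ord card_bool; lia.
apply/subset_leq_card/fintype.subsetP => _ /imsetP[[[x i] c] + ->].
by rewrite inE /g /= => /PF-/(_ i)[]; case: c.
Qed.

End TwoInvolutions.

(** * Counting alcoves by colours *)

Section ModelCounting.
Local Open Scope set_scope.
Local Open Scope nat_scope.
Variables (S : finType) (m : S -> S -> option nat) (T : set S).
Variables (X : finType) (f : S -> X -> X) (D : S -> pred X).
Hypotheses (m_odd : odd_angled m) (m_cox : is_coxeter_matrix m).
Hypothesis M : chamber_model m T f D.

(** [loops s]: alcoves whose s-wall bounds the chamber.  [ends s t]: paths of
    more than one point that s and t form, counted at the end fixed by s.  [edges s]: edges of colour s,
    counted at the end farther from the base.  [tops s t]: farthest points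
    of the cycles that s and t form.  [interior s t]: alcoves on such
    cycles. *)
Definition loops s : {set X} := [set x | f s x == x].
Definition ends s t : nat := #|[set x | (f s x == x) && (f t x != x)]|.
Definition edges s : nat := #|[set x | D s x]|.
Definition tops s t : nat := #|[set x | D s x && D t x]|.
Definition interior s t : {set X} :=
  [set x | `[< forall y, dihedral_orbit f s t x y -> f s y != y /\ f t y != y >]].

Lemma card_model s : T s -> #|X| = #|loops s| + 2 * edges s.
Proof.
move=> Ts; have fK := model_invol M Ts.
have cardD : #|[set x | D s x]| = #|[set x | (f s x != x) && ~~ D s x]|.
  rewrite -(card_imset _ (can_inj fK)); congr #|pred_of_set _|.
  apply/finset.setP => x; rewrite inE; apply/imsetP/andP => [[y + ->]|[fx nDx]].
    rewrite inE => Dy; have fy := model_descent_moved M Ts Dy.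
    by rewrite (model_descent M Ts) // Dy fK eq_sym.
  by exists (f s x); rewrite ?fK // inE (model_descent M Ts).
rewrite -(cardsC (loops s)) /edges mul2n -addnn {2}cardD; congr (_ + _).
rewrite -(cardsID [set x | D s x]); congr (_ + _); apply: eq_card => x.
  rewrite !inE; apply/andP/idP => [[]//|Dx]; split=> //.
  exact: (model_descent_moved M Ts).
by rewrite !inE andbC.
Qed.

Definition odd_pair s t k : Prop := [/\ T s, T t, s != t & m s t = Some k].

Lemma odd_pair_sym s t k : odd_pair s t k -> odd_pair t s k.
Proof. by case=> Ts Tt st mst; split; rewrite 1?eq_sym //; case: m_cox => _ ->. Qed.

Lemma card_loops s t k : odd_pair s t k -> #|loops s| = #|loops t|.
Proof.
move=> st; have ts := odd_pair_sym st.
have le s' t' : odd_pair s' t' k -> #|loops s'| <= #|loops t'|.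
  move=> [Ts Tt st' mst]; apply: (card_fixed_le (k := k)).
  - exact: (model_invol M Ts).
  - exact: (model_invol M Tt).
  - exact: (model_order M Ts Tt mst).
  - exact: m_odd st' mst.
by apply/eqP; rewrite eqn_leq !le.
Qed.

Lemma card_ends s t : #|[set x | (f s x == x) && (f t x == x)]| + ends s t = #|loops s|.
Proof.
rewrite -(cardsID [set x | f t x == x] (loops s)); congr (_ + _).
  by apply: eq_card => x; rewrite !inE.
by apply: eq_card => x; rewrite !inE andbC.
Qed.

Lemma ends_sym s t k : odd_pair s t k -> ends s t = ends t s.
Proof.
move=> /card_loops; rewrite -(card_ends s t) -(card_ends t s).
have -> : #|[set x | (f s x == x) && (f t x == x)]| =
          #|[set x | (f t x == x) && (f s x == x)]|.
  by apply: eq_card => x; rewrite !inE andbC.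
exact: addnI.
Qed.

Lemma orbit_rot s t x i : dihedral_orbit f s t x (iter i (f s \o f t) x).
Proof.
by elim: i => [|i IH]; [exact: Orbit_refl|exact/Orbit_left/Orbit_right].
Qed.

Lemma orbit_trans s t x y z :
  dihedral_orbit f s t x y -> dihedral_orbit f s t y z -> dihedral_orbit f s t x z.
Proof.
by move=> xy; elim=> // u _; [apply: Orbit_left|apply: Orbit_right].
Qed.

Lemma orbit_sym s t x y : T s -> T t ->
  dihedral_orbit f s t x y -> dihedral_orbit f s t y x.
Proof.
move=> Ts Tt; elim=> [|u _ IH|u _ IH]; first exact: Orbit_refl.
  apply: orbit_trans IH; rewrite -{2}(model_invol M Ts u).
  exact/Orbit_left/Orbit_refl.
apply: orbit_trans IH; rewrite -{2}(model_invol M Tt u).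
exact/Orbit_right/Orbit_refl.
Qed.

Lemma interiorP s t x : reflect
  (forall y, dihedral_orbit f s t x y -> f s y != y /\ f t y != y)
  (x \in interior s t).
Proof. by rewrite inE; apply: asboolP. Qed.

Lemma interior_orbit s t x y : T s -> T t -> dihedral_orbit f s t x y ->
  (x \in interior s t) = (y \in interior s t).
Proof.
move=> Ts Tt xy; apply/interiorP/interiorP => H z zz; apply: H.
  exact: orbit_trans xy zz.
exact: orbit_trans (orbit_sym Ts Tt xy) zz.
Qed.

Lemma ends_bound s t k : odd_pair s t k ->
  (pdiv k).-1 * ends s t + #|interior s t| <= 2 * edges s.
Proof.
move=> [Ts Tt st mst]; have k2 : 1 < k by case: m_cox => _ _; apply; eassumption.
have := card_half_fixed (model_invol M Ts) (model_invol M Tt)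
  (model_order M Ts Tt mst) (m_odd st mst) k2 (F := interior s t).
rewrite -/(ends s t) => /(_ _)H; have {H} := H _.
rewrite (card_model Ts) -(card_ends s t) => H.
have {H} : pdiv k * ends s t + #|[set x | (f s x == x) && (f t x == x)]| +
    #|interior s t| <= #|[set x | (f s x == x) && (f t x == x)]| + ends s t + 2 * edges s.
  apply: H => x i; rewrite -(interior_orbit Ts Tt (orbit_rot s t x i)).
  by move=> /interiorP/(_ _ (Orbit_refl _ _ _ _))[].
by case: (pdiv k) (pdiv_gt0 k) => // p _ /=; lia.
Qed.

Lemma tops_bound s t k : odd_pair s t k ->
  2 * pdiv k * tops s t <= #|interior s t|.
Proof.
move=> [Ts Tt st mst]; have k2 : 1 < k by case: m_cox => _ _; apply; eassumption.
apply: (card_cycles (model_invol M Ts) (model_invol M Tt)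
  (model_order M Ts Tt mst) (m_odd st mst) k2) => [x i|x|x i|x i].
- rewrite inE => /andP[Ds Dt]; have xr := orbit_rot s t x i.
  have Fx : x \in interior s t.
    exact/interiorP/(model_top_free M Ts Tt st Ds Dt).
  by rewrite -!(interior_orbit Ts Tt _ (x := x)) //; apply: Orbit_left.
- move=> /interiorP/(_ _ (Orbit_refl _ _ _ _))[fs ft]; split=> //.
  by apply: contra_neq fs; apply: (model_simple M Ts Tt st).
- rewrite !inE => /andP[Ds Dt] /andP[Ds' Dt'].
  by apply: (model_top_unique M Ts Tt st Ds Dt); first exact: orbit_rot.
rewrite !inE => /andP[Ds Dt] /andP[Ds' Dt'].
apply: (model_top_unique M Ts Tt st Ds Dt) => //.
exact/Orbit_left/orbit_rot.
Qed.

(** The form in which the two bounds are used: p is a lower bound for the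
    label of the pair. *)
Lemma pair_bound s t k p : odd_pair s t k -> 0 < p <= pdiv k ->
  p.-1 * ends s t + 2 * p * tops s t <= 2 * edges s.
Proof.
move=> st /andP[p_gt0 le_p].
have := ends_bound st; have := tops_bound st.
have : p.-1 * ends s t <= (pdiv k).-1 * ends s t by rewrite leq_mul2r; lia.
have : 2 * p * tops s t <= 2 * pdiv k * tops s t by rewrite leq_mul2r; lia.
by lia.
Qed.

Lemma tops_infinite s t : T s -> T t -> s != t -> m s t = None -> tops s t = 0.
Proof.
move=> Ts Tt st mst; apply: eq_card0 => x; rewrite !inE; apply/andP => -[Ds Dt].
by have := model_top_order M Ts Tt st Ds Dt; rewrite mst.
Qed.

End ModelCounting.

(** * The Euler characteristic and spanning trees *)

Section ModelBounds.
Local Open Scope set_scope.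
Local Open Scope nat_scope.
Variables (S : finType) (m : S -> S -> option nat) (l : seq S).
Variables (X : finType) (f : S -> X -> X) (D : S -> pred X).
Hypotheses (m_cox : is_coxeter_matrix m) (m_odd : odd_angled m).
Hypothesis M : chamber_model m (fun s => s \in l) f D.
Local Notation d := (cox_div m).
Local Notation loops := (loops f).
Local Notation ends := (ends f).
Local Notation edges := (edges D).
Local Notation tops := (tops D).

Fixpoint pair_sum (g : S -> S -> nat) (ss : seq S) : nat :=
  if ss is s :: ss' then \sum_(t <- ss') g s t + pair_sum g ss' else 0.

(** The number of descents of an alcove exceeds by at most one the number of
    pairs of them, and the base alcove has none, so counting vertices,
    edges by their upper ends and cycles by their tops bounds the Euler
    characteristic of the chamber from below by 1. *)
Lemma model_euler : 1 + \sum_(s <- l) edges s <= #|X| + pair_sum tops l.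
Proof.
have pointwise x (ss : seq S) :
    \sum_(s <- ss) (D s x : nat) <= 1 + pair_sum (fun s t => D s x && D t x) ss.
  elim: ss => [|s ss IH]; rewrite ?big_nil // big_cons /=.
  case: (D s x) => /=; last by rewrite big1_eq !add0n.
  by move: IH; set u := \sum_(j <- ss) _; lia.
have pair_sum_exchange (ss : seq S) :
    \sum_(x : X) pair_sum (fun s t => D s x && D t x) ss = pair_sum tops ss.
  elim: ss => [|s ss IH] /=; first by rewrite big1_eq.
  rewrite big_split IH exchange_big /=; congr (_ + _); apply: eq_bigr => t _.
  by rewrite /tops -sum1_card [RHS]big_mkcond /=; apply: eq_bigr => x _; rewrite inE; case: ifP.
have -> : \sum_(s <- l) edges s = \sum_(x : X) \sum_(s <- l) (D s x : nat).
  rewrite exchange_big; apply: eq_bigr => s _.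
  by rewrite /edges -sum1_card [LHS]big_mkcond /=; apply: eq_bigr => x _; rewrite inE; case: ifP.
have [x0 base] := model_base M.
rewrite -sum1_card -pair_sum_exchange -big_split (bigD1 x0) //= addnA.
rewrite [X in _ <= X](bigD1 x0) //=; apply: leq_add; last first.
  by apply: leq_sum => x _; apply: pointwise.
rewrite big_seq big1 ?leq_addr // => s sl.
by rewrite (negbTE (base s sl)).
Qed.

(** A loop at the root that is not a loop everywhere must be lost along an edge of
    any tree that spans the diagram. *)
Lemma tree_bound (r : S) (tree : seq (S * S)) :
  (forall Q : pred S, Q r -> all (fun e => Q e.1 ==> Q e.2) tree -> all Q l) ->
  #|loops r| <= \sum_(e <- tree) ends e.1 e.2.
Proof.
move=> span; pose E (e : S * S) := [set x | (f e.1 x == x) && (f e.2 x != x)].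
have sub : loops r \subset \bigcup_(e <- tree) E e.
  apply/fintype.subsetP => x; rewrite inE => rx; apply: contraT => notU.
  have [s sl] := model_moved M x.
  have /allP/(_ s sl)-> // : all (fun s => f s x == x) l.
  apply: span rx _; apply/allP => e etree; apply/implyP => e1x.
  apply: contraNT notU => e2x; rewrite (big_rem e etree) /=.
  by apply/finset.setUP; left; rewrite inE e1x.
apply: leq_trans (subset_leq_card sub) _.
elim: tree {span sub} => [|e tree IH]; rewrite ?big_nil ?cards0 // !big_cons.
apply: leq_trans (leq_card_setU _ _) _; exact: leq_add.
Qed.

Lemma label_pair s t q : s \in l -> t \in l -> d s t = Some q ->
  exists2 k, odd_pair m (fun s => s \in l) s t k & pdiv k = q.
Proof.
move=> sl tl; rewrite /cox_div; case: eqVneq => // st.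
by case mst : (m s t) => [k|] // [<-]; exists k.
Qed.

Lemma label_loops s t q : s \in l -> t \in l -> d s t = Some q ->
  #|loops s| = #|loops t| /\ edges s = edges t.
Proof.
move=> sl tl /(label_pair sl tl)[k st _].
have E := card_loops m_odd m_cox M st; split=> //.
by have := card_model M sl; rewrite (card_model M tl) E; lia.
Qed.

Lemma label_ends s t q : s \in l -> t \in l -> d s t = Some q -> ends s t = ends t s.
Proof. by move=> sl tl /(label_pair sl tl)[k st _]; exact: (ends_sym m_odd m_cox M st). Qed.

Lemma label_bound p s t q : s \in l -> t \in l -> d s t = Some q -> 0 < p <= q ->
  p.-1 * ends s t + 2 * p * tops s t <= 2 * edges s.
Proof.
move=> sl tl /(label_pair sl tl)[k st <-] pk.
exact: (pair_bound m_odd m_cox M st pk).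
Qed.

Lemma no_label_tops s t : s \in l -> t \in l -> s != t -> d s t = None ->
  tops s t = 0.
Proof.
move=> sl tl st; rewrite /cox_div (negbTE st).
by case mst : (m s t) => //= _; apply: (tops_infinite M).
Qed.

End ModelBounds.

(** * Diagrams with three or four vertices *)

Section Excluded.
Local Open Scope nat_scope.
Variables (S : finType) (m : S -> S -> option nat).
Hypotheses (m_cox : is_coxeter_matrix m) (m_odd : odd_angled m).
Local Notation d := (cox_div m).
Local Notation model l X := (@chamber_model S m (fun s => s \in l) X).

Lemma cox_div_sym s t : d s t = d t s.
Proof. by rewrite /cox_div eq_sym; case: m_cox => _ ->. Qed.

Lemma uniq3 (a b c : S) : uniq [:: a; b; c] = [&& a != b, a != c & b != c].
Proof. by rewrite /= !inE !negb_or andbT -andbA. Qed.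

Lemma uniq4 (a b c e : S) : uniq [:: a; b; c; e] =
  [&& a != b, a != c, a != e, b != c, b != e & c != e].
Proof. by rewrite /= !inE !negb_or andbT -!andbA. Qed.

Local Ltac edge_facts p sl tl st le :=
  lazymatch goal with M : chamber_model _ _ _ _ |- _ =>
    have := label_bound (p := p) m_cox m_odd M sl tl st le;
    have := label_ends m_cox m_odd M sl tl st;
    have [] := label_loops m_cox m_odd M sl tl st
  end.

Local Ltac tree_fact r t :=
  lazymatch goal with M : chamber_model _ _ _ _ |- _ =>
    have := @tree_bound S m _ _ _ _ M r t;
    rewrite !big_cons big_nil /=;
    lazymatch goal with |- (?P -> _) -> _ =>
      let G := fresh in
      let Q := fresh in
      assert (G : P) by (intro Q; simpl;
        repeat match goal with |- context [Q ?x] => case (Q x) end; done);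
      let H := fresh in intro H; specialize (H G); revert H; clear G
    end
  end.

(* The atoms are generalized because lia is slow at comparing cardinals. *)
Local Ltac count_lia :=
  repeat match goal with
  | |- context [ends ?f ?x ?y] => move: (ends f x y)
  | |- context [tops ?D ?x ?y] => move: (tops D x y)
  | |- context [edges ?D ?x] => move: (edges D x)
  | |- context [loops ?f ?x] => move: #|loops f x|
  end; clear; lia.

(** Let f be the number of loops and e the number of edges of one colour, the same for
    all three colours.  The Euler bound says that 1 + e is at most f plus the tops of
    the three pairs, and a spanning tree bounds f by the ends of its pairs.  A
    large label gives 2 n + 5 t <= e for its ends n and tops t.  Two of them pay for n + t
    each; three pay for 2 n / 3 + t each, by averaging over the spanning trees. *)
Lemma excluded_A a b c k q (X : finType) f D : uniq [:: a; b; c] ->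
  5 <= k -> 5 <= q -> d a b = Some k -> d b c = Some q ->
  d a c = None \/ (exists2 p, 5 <= p & d a c = Some p) ->
  ~ model [:: a; b; c] X f D.
Proof.
rewrite uniq3 => /and3P[nab nac nbc] k5 q5 ab bc ac M.
have la : a \in [:: a; b; c] by rewrite !inE eqxx.
have lb : b \in [:: a; b; c] by rewrite !inE eqxx !orbT.
have lc : c \in [:: a; b; c] by rewrite !inE eqxx !orbT.
have [Lab Eab] := label_loops m_cox m_odd M la lb ab.
have [Lbc Ebc] := label_loops m_cox m_odd M lb lc bc.
have := model_euler M; rewrite /= !big_cons !big_nil (card_model M la).
edge_facts 5 la lb ab k5; edge_facts 5 lb lc bc q5.
tree_fact b [:: (b, a); (b, c)].
case: ac => [ac|[p p5 ac]]; first by rewrite (no_label_tops M la lc nac ac); count_lia.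
tree_fact a [:: (a, b); (a, c)]; tree_fact c [:: (c, a); (c, b)].
by edge_facts 5 la lc ac p5; count_lia.
Qed.

(** The tree ab, bc is taken twice and the tree ab, ac once. *)
Lemma excluded_B a b c p q (X : finType) f D : uniq [:: a; b; c] ->
  7 <= p -> 5 <= q -> d a b = Some p -> d b c = Some q -> d a c = Some 3 ->
  ~ model [:: a; b; c] X f D.
Proof.
rewrite uniq3 => /and3P[nab nac nbc] p7 q5 ab bc ac M.
have la : a \in [:: a; b; c] by rewrite !inE eqxx.
have lb : b \in [:: a; b; c] by rewrite !inE eqxx !orbT.
have lc : c \in [:: a; b; c] by rewrite !inE eqxx !orbT.
have := model_euler M; rewrite /= !big_cons !big_nil (card_model M la).
edge_facts 7 la lb ab p7; edge_facts 5 lb lc bc q5.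
edge_facts 3 la lc ac (isT : 0 < 3 <= 3).
by tree_fact b [:: (b, a); (b, c)]; tree_fact a [:: (a, b); (a, c)]; count_lia.
Qed.

Section FourVertices.
Variables (a b c e : S).
Hypothesis U : uniq [:: a; b; c; e].
Variables (X : finType) (f : S -> X -> X) (D : S -> pred X).
Hypothesis M : model [:: a; b; c; e] X f D.

Let la : a \in [:: a; b; c; e]. Proof. by rewrite !inE eqxx. Qed.
Let lb : b \in [:: a; b; c; e]. Proof. by rewrite !inE eqxx !orbT. Qed.
Let lc : c \in [:: a; b; c; e]. Proof. by rewrite !inE eqxx !orbT. Qed.
Let le : e \in [:: a; b; c; e]. Proof. by rewrite !inE eqxx !orbT. Qed.

Lemma euler4 : 1 + (edges D a + (edges D b + (edges D c + edges D e))) <=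
  #|loops f a| + 2 * edges D a + (tops D a b + tops D a c + tops D a e
    + tops D b c + tops D b e + tops D c e).
Proof.
by have := model_euler M; rewrite /= !big_cons !big_nil (card_model M la); count_lia.
Qed.

(** Every spanning tree made of ab, ce and one pair labeled 3 gives the same
    bound on the tops of that pair; three such pairs are not enough to make up for the
    deficit of the two large labels. *)
Lemma excluded_C_incomplete k q : 5 <= k -> 5 <= q ->
  d a b = Some k -> d c e = Some q -> d b c = Some 3 ->
  three_or_none d a c -> three_or_none d a e -> three_or_none d b e ->
  [/\ d a c = Some 3, d a e = Some 3 & d b e = Some 3].
Proof.
move=> k5 q5 ab ce bc ac ae be.
have := U; rewrite uniq4 => /and5P[nab nac nae nbc /andP[nbe nce]].
have main : 1 + (edges D a + (edges D b + (edges D c + edges D e))) <=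
    #|loops f a| + 2 * edges D a + (tops D a b + tops D a c + tops D a e
    + tops D b c + tops D b e + tops D c e) ->
    0 < tops D a c /\ 0 < tops D a e /\ 0 < tops D b e.
  edge_facts 5 la lb ab k5; edge_facts 5 lc le ce q5.
  edge_facts 3 lb lc bc (isT : 0 < 3 <= 3).
  tree_fact b [:: (b, a); (b, c); (c, e)].
  have acB : #|loops f a| + 3 * tops D a c <= ends f a b + ends f c e + edges D a.
    case: ac => [ac|ac]; last first.
      rewrite (no_label_tops M la lc nac ac).
      edge_facts 5 la lb ab k5; edge_facts 3 lb lc bc (isT : 0 < 3 <= 3).
      by tree_fact b [:: (b, a); (b, c); (c, e)]; count_lia.
    edge_facts 3 la lc ac (isT : 0 < 3 <= 3).
    by tree_fact a [:: (a, b); (a, c); (c, e)]; count_lia.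
  have aeB : #|loops f a| + 3 * tops D a e <= ends f a b + ends f c e + edges D a.
    case: ae => [ae|ae]; last first.
      rewrite (no_label_tops M la le nae ae).
      edge_facts 5 la lb ab k5; edge_facts 3 lb lc bc (isT : 0 < 3 <= 3).
      by tree_fact b [:: (b, a); (b, c); (c, e)]; count_lia.
    edge_facts 5 lc le ce q5; edge_facts 3 la le ae (isT : 0 < 3 <= 3).
    by tree_fact a [:: (a, b); (a, e); (e, c)]; count_lia.
  have beB : #|loops f b| + 3 * tops D b e <= ends f a b + ends f c e + edges D b.
    edge_facts 5 la lb ab k5.
    case: be => [be|be]; last first.
      rewrite (no_label_tops M lb le nbe be).
      edge_facts 3 lb lc bc (isT : 0 < 3 <= 3).
      by tree_fact b [:: (b, a); (b, c); (c, e)]; count_lia.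
    edge_facts 5 lc le ce q5; edge_facts 3 lb le be (isT : 0 < 3 <= 3).
    by tree_fact b [:: (b, a); (b, e); (e, c)]; count_lia.
  by move: acB aeB beB; count_lia.
have [tac [tae tbe]] := main euler4.
split.
- by case: ac => // /(no_label_tops M la lc nac) E; rewrite E in tac.
- by case: ae => // /(no_label_tops M la le nae) E; rewrite E in tae.
- by case: be => // /(no_label_tops M lb le nbe) E; rewrite E in tbe.
Qed.

(** The Euler bound now says that 1 + 2 e is at most f plus the tops.  An average
    of the listed spanning trees is such that each pair pays for its tops and its
    share of the ends; its weights solve a small linear program. *)
Lemma excluded_D :
  d a b = Some 5 -> d b c = Some 5 -> d c e = Some 5 ->
  d a c = Some 3 -> d b e = Some 3 ->
  [\/ d a e = Some 3, d a e = Some 5 | d a e = None] -> False.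
Proof.
move=> ab bc ce ac be ae.
have := U; rewrite uniq4 => /and5P[nab nac nae nbc /andP[nbe nce]].
have five : 0 < 5 <= 5 by []. have three : 0 < 3 <= 3 by [].
have := euler4; edge_facts 5 la lb ab five; edge_facts 5 lb lc bc five.
edge_facts 5 lc le ce five; edge_facts 3 la lc ac three; edge_facts 3 lb le be three.
tree_fact a [:: (a, b); (a, c); (c, e)]; tree_fact b [:: (b, a); (b, c); (b, e)].
case: ae => ae; last first.
- rewrite (no_label_tops M la le nae ae).
  by tree_fact a [:: (a, b); (b, c); (c, e)]; count_lia.
- edge_facts 5 la le ae five.
  tree_fact a [:: (a, b); (a, e); (b, c)]; tree_fact a [:: (a, b); (a, e); (e, c)].
  tree_fact a [:: (a, e); (a, c); (c, b)]; tree_fact a [:: (a, e); (a, c); (e, b)].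
  by count_lia.
edge_facts 3 la le ae three.
tree_fact a [:: (a, b); (a, e); (b, c)]; tree_fact a [:: (a, b); (a, e); (e, c)].
by count_lia.
Qed.

Lemma excluded_E :
  d a b = Some 5 -> d a c = Some 5 -> d a e = Some 5 ->
  d b c = Some 3 -> d b e = Some 3 -> d c e = Some 3 -> False.
Proof.
move=> ab ac ae bc be ce.
have five : 0 < 5 <= 5 by []. have three : 0 < 3 <= 3 by [].
have := euler4; edge_facts 5 la lb ab five; edge_facts 5 la lc ac five.
edge_facts 5 la le ae five; edge_facts 3 lb lc bc three; edge_facts 3 lb le be three.
edge_facts 3 lc le ce three.
tree_fact a [:: (a, b); (a, e); (b, c)]; tree_fact a [:: (a, b); (a, e); (e, c)].
tree_fact a [:: (a, c); (a, e); (c, b)]; tree_fact a [:: (a, c); (a, e); (e, b)].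
by count_lia.
Qed.

End FourVertices.
End Excluded.

(** * Chains of threes between two large labels *)

Section ExcludedChain.
Local Open Scope nat_scope.
Variables (S : finType) (m : S -> S -> option nat).
Hypotheses (m_cox : is_coxeter_matrix m) (m_odd : odd_angled m).
Local Notation d := (cox_div m).

Lemma pair_sum_iota (g : S -> S -> nat) (v : nat -> S) i0 n :
  pair_sum g [seq v i | i <- iota i0 n] =
  \sum_(i0 <= i < i0 + n) \sum_(i.+1 <= j < i0 + n) g (v i) (v j).
Proof.
elim: n i0 => [|n IH] i0; first by rewrite addn0 big_geq.
rewrite /= big_ltn ?addnS ?ltnS ?leq_addr // IH addSn; congr (_ + _).
by rewrite big_map /index_iota subSS addKn.
Qed.

Section Chain.
Variables (k : nat) (v : nat -> S) (p q : nat).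
Let n := k + 5.
Local Notation l := [seq v i | i <- iota 1 n].
Hypothesis U : uniq l.
Hypotheses (p5 : 5 <= p) (q5 : 5 <= q).
Hypotheses (first_label : d (v 1) (v 2) = Some p)
  (last_label : d (v (k + 4)) (v (k + 5)) = Some q)
  (middle_label : forall i, 2 <= i <= k + 3 -> d (v i) (v i.+1) = Some 3)
  (first_skip : three_or_none d (v 1) (v 3))
  (last_skip : three_or_none d (v (k + 3)) (v (k + 5)))
  (no_label : forall i j, 1 <= i -> i.+1 < j -> j <= n ->
    (i, j) != (1, 3) -> (i, j) != (k + 3, k + 5) -> d (v i) (v j) = None).
Variables (X : finType) (f : S -> X -> X) (D : S -> pred X).
Hypothesis M : chamber_model m (fun s => s \in l) f D.

Let vl i : 1 <= i <= n -> v i \in l.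
Proof. by move=> i_n; apply: map_f; rewrite mem_iota; lia. Qed.

Let v_neq i j : 1 <= i <= n -> 1 <= j <= n -> i != j -> v i != v j.
Proof.
move=> i_n j_n; apply: contra_neq => E.
have sz : size (iota 1 n) = n by rewrite size_iota.
have := nth_uniq (v 0) (s := l) (i := i.-1) (j := j.-1); rewrite size_map sz => H.
have {H} : (nth (v 0) l i.-1 == nth (v 0) l j.-1) = (i.-1 == j.-1) by apply: H => //; lia.
rewrite !(nth_map 0) ?sz ?nth_iota; try lia.
by rewrite !add1n !prednK ?E ?eqxx; lia.
Qed.

Let step i : 1 <= i <= k + 4 -> exists2 r, d (v i) (v i.+1) = Some r & 3 <= r.
Proof.
move=> i_n; have [->|i1] := eqVneq i 1; first by exists p => //; lia.
have [->|ik] := eqVneq i (k + 4); first by exists q; rewrite -?addnS //; lia.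
by exists 3 => //; apply: middle_label; lia.
Qed.

Let f0 := #|loops f (v 1)|.
Let e0 := edges D (v 1).

Let same i : 1 <= i <= n -> #|loops f (v i)| = f0 /\ edges D (v i) = e0.
Proof.
elim: i => // -[|i] IH i_n; first by [].
have [|r ir _] := step (i := i.+1); first by lia.
have [vi vi'] : v i.+1 \in l /\ v i.+2 \in l by split; apply: vl; lia.
have [<- <-] := label_loops m_cox m_odd M vi vi' ir.
by apply: IH; lia.
Qed.

Let x i := ends f (v i) (v i.+1).
Let y i := tops D (v i) (v i.+1).

Let bound3 i j : 1 <= i <= n -> 1 <= j <= n -> d (v i) (v j) = Some 3 ->
  ends f (v i) (v j) + 3 * tops D (v i) (v j) <= e0.
Proof.
move=> i_n j_n ij.
have := label_bound (p := 3) m_cox m_odd M (vl i_n) (vl j_n) ij isT.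
by have [_ ->] := same i_n; lia.
Qed.

Let bound5 i r : 1 <= i <= k + 4 -> d (v i) (v i.+1) = Some r -> 5 <= r ->
  2 * x i + 5 * y i <= e0.
Proof.
move=> i_n ir r5; have i_n1 : 1 <= i <= n by lia.
have i_n2 : 1 <= i.+1 <= n by lia.
have := label_bound (p := 5) m_cox m_odd M (vl i_n1) (vl i_n2) ir r5.
by have [_ ->] := same i_n1; rewrite -/(x i) -/(y i); lia.
Qed.

Let skip (i j : nat) : 1 <= i -> i.+1 < j <= n -> three_or_none d (v i) (v j) ->
  tops D (v i) (v j) = 0 \/
  d (v i) (v j) = Some 3 /\ ends f (v i) (v j) + 3 * tops D (v i) (v j) <= e0.
Proof.
move=> i1 ij [ij3|ij0].
  by right; split=> //; apply: bound3 => //; lia.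
by left; apply: (no_label_tops M) => //; [| |apply: v_neq]; try apply: vl; lia.
Qed.

Let euler_chain : 1 + n * e0 <= f0 + 2 * e0 + \sum_(1 <= i < n) y i
  + tops D (v 1) (v 3) + tops D (v (k + 3)) (v (k + 5)).
Proof.
have := model_euler M; rewrite big_map pair_sum_iota.
have -> : \sum_(j <- iota 1 n) edges D (v j) = n * e0.
  rewrite big_seq (eq_bigr (fun _ => e0)) => [|i].
    by rewrite -big_seq big_const_seq count_predT size_iota iter_addn_0 mulnC.
  by rewrite mem_iota => i_n; have [|_ ->] := same (i := i); lia.
have v1 : v 1 \in l by apply: vl; lia.
rewrite (card_model M v1) -/f0 -/e0 => H.
have zero i j : 1 <= i -> i.+1 < j -> j <= n -> (i, j) != (1, 3) ->
    (i, j) != (k + 3, k + 5) -> tops D (v i) (v j) = 0.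
  move=> i1 ij jn ij1 ij2; apply: (no_label_tops M); try by apply: vl; lia.
    by apply: v_neq; lia.
  exact: no_label.
have inner i : 1 <= i < n -> \sum_(i.+1 <= j < n.+1) tops D (v i) (v j) =
    y i + (if i == 1 then tops D (v 1) (v 3) else 0)
        + (if i == k + 3 then tops D (v (k + 3)) (v (k + 5)) else 0).
  move=> i_n; rewrite big_ltn; last by lia.
  rewrite -addnA; congr (_ + _).
  have [->|i1] := eqVneq i 1.
    rewrite big_ltn; last by lia.
    rewrite [X in _ + X = _]big_nat big1 => [|j j_n]; last first.
      by apply: zero; rewrite ?xpair_eqE; lia.
    by rewrite (_ : (1 == k + 3) = false) //; lia.
  have [->|i2] := eqVneq i (k + 3).
    have -> : (k + 3).+2 = k + 5 by lia.
    by rewrite big_nat1 add0n.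
  by rewrite big_nat big1 // => j j_n; apply: zero; rewrite ?xpair_eqE; lia.
suff E : \sum_(1 <= i < 1 + n) \sum_(i.+1 <= j < 1 + n) tops D (v i) (v j) =
    \sum_(1 <= i < n) y i + tops D (v 1) (v 3) + tops D (v (k + 3)) (v (k + 5)).
  by move: H; rewrite E; clear; lia.
have pick j c : 1 <= j < n -> \sum_(1 <= i < n) (if i == j then c else 0) = c.
  move=> j_n; rewrite (bigD1_seq j) /= ?eqxx ?iota_uniq ?mem_index_iota //.
  by rewrite big1 ?addn0 // => i /negbTE->.
rewrite [1 + n]add1n big_nat_recr /=; last by rewrite /n; lia.
have -> : \sum_(n.+1 <= j < n.+1) tops D (v n) (v j) = 0 by rewrite big_geq.
by rewrite addn0 big_nat (eq_bigr _ inner) -big_nat !big_split /= !pick //; lia.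
Qed.

Let tree_chain (t1 t2 : seq (S * S)) :
  (forall Q : pred S, Q (v 1) -> all (fun e => Q e.1 ==> Q e.2) t1 ->
     Q (v 2) && Q (v 3)) ->
  (forall Q : pred S, Q (v (k + 3)) -> all (fun e => Q e.1 ==> Q e.2) t2 ->
     Q (v (k + 4)) && Q (v (k + 5))) ->
  f0 <= \sum_(e <- t1) ends f e.1 e.2 + \sum_(3 <= i < k + 3) x i
        + \sum_(e <- t2) ends f e.1 e.2.
Proof.
move=> span1 span2.
pose t := t1 ++ [seq (v i, v i.+1) | i <- index_iota 3 (k + 3)] ++ t2.
have := tree_bound M (r := v 1) (tree := t); rewrite !big_cat big_map /= addnA; apply.
move=> Q Q1; rewrite !all_cat => /and3P[/(span1 Q Q1)/andP[Q2 Q3] /allP Qx Qt2].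
have Qmid i : 3 <= i <= k + 3 -> Q (v i).
  elim: i => // i IH i_k; have [->//|i3] := eqVneq i 2.
  have /Qx /= : (v i, v i.+1) \in [seq (v i, v i.+1) | i <- index_iota 3 (k + 3)].
    by apply/mapP; exists i; rewrite // mem_index_iota; lia.
  by rewrite IH //; lia.
have /andP[Q4 Q5] : Q (v (k + 4)) && Q (v (k + 5)).
  by apply: (span2 Q) => //; apply: Qmid; lia.
apply/allP => _ /mapP[i + ->]; rewrite mem_iota => i_n.
have [->//|i1] := eqVneq i 1; have [->//|i2] := eqVneq i 2.
have [->//|i4] := eqVneq i (k + 4); have [->//|i5] := eqVneq i (k + 5).
by apply: Qmid; lia.
Qed.

(** The two skipped pairs can have tops, but then they can replace the
    neighbouring pair of the chain in a spanning tree; averaging the bounds of the two trees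
    pays for the tops of both pairs. *)
Lemma excluded_F : False.
Proof.
have b1 : 2 * x 1 + 5 * y 1 <= e0 by apply: bound5 p5 => //; lia.
have bn : 2 * x (k + 4) + 5 * y (k + 4) <= e0.
  by apply: bound5 q5; [lia|rewrite -last_label; congr (d _ (v _)); lia].
have bmid i : 2 <= i <= k + 3 -> x i + 3 * y i <= e0.
  by move=> i_k; apply: bound3; [lia|lia|apply: middle_label].
have b2 : x 2 + 3 * y 2 <= e0 by apply: bmid; lia.
have b3 : x (k + 3) + 3 * y (k + 3) <= e0 by apply: bmid; lia.
have tree0 : f0 <= x 1 + x 2 + \sum_(3 <= i < k + 3) x i + (x (k + 3) + x (k + 4)).
  have := @tree_chain [:: (v 1, v 2); (v 2, v 3)]
    [:: (v (k + 3), v (k + 3).+1); (v (k + 4), v (k + 4).+1)].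
  rewrite !big_cons !big_nil !addn0 /=; apply=> Q Q1; first by rewrite Q1 /= andbT => /andP[->].
  have -> : (k + 3).+1 = k + 4 by lia.
  have -> : (k + 4).+1 = k + 5 by lia.
  by rewrite Q1 /= andbT => /andP[->].
have [u [t1 [span1 sum1 bu]]] : exists u t1, [/\
    forall Q : pred S, Q (v 1) -> all (fun e => Q e.1 ==> Q e.2) t1 -> Q (v 2) && Q (v 3),
    \sum_(e <- t1) ends f e.1 e.2 = x 1 + u & u + 3 * tops D (v 1) (v 3) <= e0].
  have [|t0|[l3 b13]] := skip (i := 1) (j := 3) isT _ first_skip; first by rewrite /n; lia.
    exists (x 2), [:: (v 1, v 2); (v 2, v 3)]; rewrite !big_cons big_nil t0; split=> //.
    - by move=> Q Q1; rewrite /= Q1 /= andbT => /andP[->].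
    - by rewrite addn0.
    - by lia.
  exists (ends f (v 1) (v 3)), [:: (v 1, v 2); (v 1, v 3)].
  rewrite !big_cons big_nil addn0; split=> //.
  by move=> Q Q1; rewrite /= Q1 /= andbT.
have [w [t2 [span2 sum2 bw]]] : exists w t2, [/\
    forall Q : pred S, Q (v (k + 3)) -> all (fun e => Q e.1 ==> Q e.2) t2 ->
      Q (v (k + 4)) && Q (v (k + 5)),
    \sum_(e <- t2) ends f e.1 e.2 = w + x (k + 4)
    & w + 3 * tops D (v (k + 3)) (v (k + 5)) <= e0].
  have [||t0|[l3 b13]] := skip (i := k + 3) (j := k + 5) _ _ last_skip; try by rewrite /n; lia.
    exists (x (k + 3)), [:: (v (k + 3), v (k + 4)); (v (k + 4), v (k + 5))].
    rewrite !big_cons big_nil t0 addn0 /x -!addnS; split=> //; last by move: b3; rewrite /x -!addnS; lia.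
    by move=> Q Q1; rewrite /= Q1 /= andbT => /andP[->].
  exists (ends f (v (k + 3)) (v (k + 5))), [:: (v (k + 3), v (k + 5)); (v (k + 5), v (k + 4))].
  rewrite !big_cons big_nil addn0; split=> //.
    by move=> Q Q1; rewrite /= Q1 /= andbT => /andP[->] /= ->.
  rewrite /x -addnS; congr (_ + _); apply: esym.
  by apply: (label_ends m_cox m_odd M _ _ last_label); apply: vl; rewrite /n; lia.
have tree1 := tree_chain span1 span2; rewrite sum1 sum2 in tree1.
have mid : \sum_(3 <= i < k + 3) x i + 3 * \sum_(3 <= i < k + 3) y i <= k * e0.
  rewrite big_distrr -big_split /= -[k in k * e0](addnK 3) -sum_nat_const_nat.
  by rewrite [X in X <= _]big_nat [X in _ <= X]big_nat; apply: leq_sum => i i_k; apply: bmid; lia.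
have euler := euler_chain.
have sumy : \sum_(1 <= i < n) y i =
    y 1 + y 2 + \sum_(3 <= i < k + 3) y i + y (k + 3) + y (k + 4).
  rewrite big_ltn; last by rewrite /n; lia.
  rewrite big_ltn; last by rewrite /n; lia.
  have -> : n = (k + 3).+2 by rewrite /n; lia.
  rewrite big_nat_recr; last by lia.
  rewrite big_nat_recr /=; last by lia.
  have -> : k + 4 = (k + 3).+1 by lia.
  by rewrite !addnA.
rewrite sumy /n mulnDl in euler.
move: b1 bn b2 b3 tree0 bu bw tree1 mid euler.
move: (tops D (v 1) (v 3)) (tops D (v (k + 3)) (v (k + 5))).
move: (\sum_(3 <= i < k + 3) x i) (\sum_(3 <= i < k + 3) y i) (k * e0).
by move: (x 1) (x 2) (x (k + 3)) (x (k + 4)) (y 1) (y 2) (y (k + 3)) (y (k + 4)) f0 e0; clear; lia.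
Qed.

End Chain.
End ExcludedChain.

(** * Two disjoint large labels joined by four threes *)

Section Discharging.
Local Open Scope nat_scope.

(** A conjunction over all bit strings that reaches one leaf at a time. *)
Fixpoint all_bits n (P : seq bool -> bool) (acc : seq bool) : bool :=
  if n is n'.+1 then
    if all_bits n' P (true :: acc) then all_bits n' P (false :: acc) else false
  else P acc.

Lemma all_bitsP n P acc : all_bits n P acc ->
  forall s, size s = n -> P (catrev s acc).
Proof.
elim: n acc => [|n IH] acc /=; first by move=> Pa [].
case: ifP => // Pt Pf [//|b s] [sz] /=.
by case: b; [apply: IH Pt _ sz|apply: IH Pf _ sz].
Qed.

(** The local configuration at an alcove x, for the colours 0, 1, 2, 3 with large
    labels on 01 and 23: [ui] says that the edge of colour i is present,
    [qij] that the ij-orbit is a full cycle, [ki] that the i-neighbour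
    is a leaf, and [ri] that the i-neighbour is overcharged in a full
    cycle through x, as defined by [overcharged]. *)
Definition consistent (u0 u1 u2 u3 q01 q23 q02 q03 q12 q13 k0 k1 k2 k3
    r0 r1 r2 r3 : bool) : bool :=
  [&& [|| u0, u1, u2 | u3],
      [&& q01 ==> u0 && u1, q23 ==> u2 && u3, q02 ==> u0 && u2,
          q03 ==> u0 && u3, q12 ==> u1 && u2 & q13 ==> u1 && u3],
      [|| k0, k1, k2 | k3] ==> [&& u0, u1, u2 & u3],
      [&& k0 ==> ~~ [|| q01, q02 | q03], k1 ==> ~~ [|| q01, q12 | q13],
          k2 ==> ~~ [|| q23, q02 | q12] & k3 ==> ~~ [|| q23, q03 | q13]],
      ~~ (k0 && k1) && ~~ (k2 && k3),
      [|| r0, r1, r2 | r3] ==> ~~ [|| k0, k1, k2 | k3]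
    & [&& r0 ==> q02 (+) q03, r1 ==> q12 (+) q13,
          r2 ==> q02 (+) q12 & r3 ==> q03 (+) q13]].

(** An alcove whose neighbours of colours i' and j are leaves, while its
    ij'-orbit is a full cycle; i, i' and j, j' are the pairs of large label. *)
Definition overcharged (ki' kj kj' qij qij' : bool) : bool :=
  ki' && (kj && qij' || kj' && qij).

Definition leaf_bits (u0 u1 u2 u3 : bool) : bool := u0 + u1 + u2 + u3 == 1.

(** 120 times the contribution of x to the Euler characteristic, after multiples of
    the bounds on the ends and the transfer of charges, with the terms of
    either sign on their own side. *)
Definition charges (u0 u1 u2 u3 q01 q23 q02 q03 q12 q13 k0 k1 k2 k3
    r0 r1 r2 r3 : bool) : bool :=
  120 + 12 * (q01 + q23) + 20 * (q02 + q03 + q12 + q13)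
  + 20 * ([&& u0, u1 & ~~ q01] + [&& u2, u3 & ~~ q23])
  + 10 * ([&& u0, u2 & ~~ q02] + [&& u0, u3 & ~~ q03]
        + [&& u1, u2 & ~~ q12] + [&& u1, u3 & ~~ q13])
  + 20 * (k0 + k1 + k2 + k3) + 5 * (r0 + r1 + r2 + r3)
  <= 60 * (u0 + u1 + u2 + u3) + 30 * ((u0 (+) u1) + (u2 (+) u3))
  + 5 * ((u0 (+) u2) + (u0 (+) u3) + (u1 (+) u2) + (u1 (+) u3))
  + 20 * leaf_bits u0 u1 u2 u3
  + 5 * (overcharged k1 k2 k3 q02 q03 + overcharged k0 k2 k3 q12 q13
       + overcharged k3 k0 k1 q02 q12 + overcharged k2 k0 k1 q03 q13).

(** There are finitely many local configurations, and each is checked. *)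
Lemma consistent_charges u0 u1 u2 u3 q01 q23 q02 q03 q12 q13 k0 k1 k2 k3
    r0 r1 r2 r3 :
  consistent u0 u1 u2 u3 q01 q23 q02 q03 q12 q13 k0 k1 k2 k3 r0 r1 r2 r3 ->
  charges u0 u1 u2 u3 q01 q23 q02 q03 q12 q13 k0 k1 k2 k3 r0 r1 r2 r3.
Proof.
pose P s := if s is [:: u0; u1; u2; u3; q01; q23; q02; q03; q12; q13; k0; k1;
  k2; k3; r0; r1; r2; r3] then
  if consistent u0 u1 u2 u3 q01 q23 q02 q03 q12 q13 k0 k1 k2 k3 r0 r1 r2 r3 then
  charges u0 u1 u2 u3 q01 q23 q02 q03 q12 q13 k0 k1 k2 k3 r0 r1 r2 r3 else true
  else true.
have /all_bitsP H : all_bits 18 P [::] by vm_compute.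
have := H [:: r3; r2; r1; r0; k3; k2; k1; k0; q13; q12; q03; q02; q23; q01;
  u3; u2; u1; u0] erefl.
by rewrite /P /=; case: ifP => // nc _; rewrite nc.
Qed.

End Discharging.

Section CompleteFour.
Local Open Scope set_scope.
Local Open Scope nat_scope.
Variables (S : finType) (m : S -> S -> option nat).
Hypotheses (m_cox : is_coxeter_matrix m) (m_odd : odd_angled m).

Section Pair.
Variables (T : set S) (X : finType) (f : S -> X -> X) (D : S -> pred X).
Hypothesis M : chamber_model m T f D.
Variables (s t : S) (k : nat).
Hypothesis st : odd_pair m T s t k.

Let Ts : T s. Proof. by case: st. Qed.
Let Tt : T t. Proof. by case: st. Qed.
Let fsK := model_invol M Ts.
Let ftK := model_invol M Tt.
Let order_ts : forall x, iter k (f t \o f s) x = x.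
Proof.
by case: (odd_pair_sym m_cox st) => _ _ _ mts; apply: (model_order M Tt Ts mts).
Qed.
Let k_odd : odd k. Proof. by case: st => _ _ /m_odd H /H. Qed.

Let rot_neq n y : coprime n k -> f t (f s y) = f s y -> f s y != y ->
  iter n (f t \o f s) y != y.
Proof.
move=> nk fixed; apply: contra_neq => /(rot_fixed_coprime order_ts nk).
by rewrite /= fixed.
Qed.

(** If y and its s-neighbour were the ends of a path of two points, its order 2 would
    divide k; the next two lemmas exclude paths of 3 and 4 points likewise. *)
Lemma leaf_neighbour y : f t (f s y) = f s y -> f s y != y -> f t y != y.
Proof.
move=> fixed sy; apply/eqP => ty; have := rot_neq _ fixed sy.
by move=> /(_ 2); rewrite coprime2n k_odd /= fixed fsK ty eqxx => /(_ isT).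
Qed.

Lemma leaves_not_opposite y : 5 <= pdiv k -> f t (f s y) = f s y ->
  f s (f t y) = f t y -> f s y != y -> False.
Proof.
move=> k5 fixed fixed' sy; have := rot_neq _ fixed sy => /(_ 3).
rewrite /= fixed fsK fixed' ftK eqxx; case/(_ _)/negP => //.
apply: coprime_lt_pdiv; last by lia.
by case: st => _ _ st' mst; case: m_cox => _ _ /(_ _ _ _ st' mst).
Qed.

Lemma leaves_not_parallel y : f t (f s y) = f s y ->
  f t (f s (f t y)) = f s (f t y) -> f s y != y -> False.
Proof.
move=> fixed fixed' sy; have := rot_neq _ fixed sy => /(_ 4).
rewrite /= fixed fsK fixed' fsK ftK eqxx; case/(_ _)/negP => //.
by rewrite (_ : 4 = 2 ^ 2) // coprimeXl // coprime2n.
Qed.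

Lemma count_moved : \sum_(x : X) (f s x != x) = 2 * edges D s.
Proof.
have := card_model M Ts; rewrite -(cardsC (loops f s)) => /addnI <-.
rewrite -sum1_card [RHS]big_mkcond /=; apply: eq_bigr => x _.
by rewrite !inE; case: eqP.
Qed.

Lemma count_ends : \sum_(x : X) ((f s x == x) && (f t x != x)) = ends f s t.
Proof.
rewrite /ends -sum1_card [RHS]big_mkcond /=; apply: eq_bigr => x _.
by rewrite inE; case: ifP.
Qed.

End Pair.

Section PairCounts.
Variables (T : set S) (X : finType) (f : S -> X -> X) (D : S -> pred X).
Hypothesis M : chamber_model m T f D.
Variables (s t : S) (k : nat).
Hypothesis st : odd_pair m T s t k.
Let ts := odd_pair_sym m_cox st.

Lemma count_xor : \sum_(x : X) ((f s x != x) (+) (f t x != x)) = 2 * ends f s t.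
Proof.
rewrite mul2n -addnn {2}(ends_sym m_odd m_cox M st).
rewrite -(count_ends f s t) -(count_ends f t s) -big_split /=.
by apply: eq_bigr => x _; do 2!case: eqP.
Qed.

Lemma count_interior : \sum_(x : X) (x \in interior f s t) = #|interior f s t|.
Proof. by rewrite -sum1_card [RHS]big_mkcond; apply: eq_bigr => x _; case: ifP. Qed.

Lemma interior_moved x : x \in interior f s t -> (f s x != x) && (f t x != x).
Proof. by move=> /interiorP/(_ _ (Orbit_refl _ _ _ _))[-> ->]. Qed.

Lemma count_both :
  \sum_(x : X) [&& f s x != x, f t x != x & x \notin interior f s t]
  + ends f s t + #|interior f s t| = 2 * edges D s.
Proof.
rewrite (ends_sym m_odd m_cox M st) -(count_moved M st).
rewrite -(count_ends f t s) -count_interior -!big_split /=.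
apply: eq_bigr => x _; have := @interior_moved x.
by case: (x \in _) => [/(_ isT)/andP[]|_];
  by case: (f s x == x); case: (f t x == x).
Qed.

Lemma leaf_not_interior y : f t (f s y) = f s y ->
  (y \notin interior f s t) && (y \notin interior f t s).
Proof.
move=> fixed; apply/andP; split; apply/negP => /interiorP H.
  by have [_] := H _ (Orbit_left (Orbit_refl f s t y)); rewrite fixed eqxx.
by have [+ _] := H _ (Orbit_right (Orbit_refl f t s y)); rewrite fixed eqxx.
Qed.

End PairCounts.

Lemma sum_involution (X : finType) (g : X -> X) (F : X -> nat) :
  involutive g -> \sum_x F (g x) = \sum_x F x.
Proof. by move=> gK; rewrite [RHS](reindex_inj (can_inj gK)). Qed.

Lemma sum_weighted (X : finType) (c0 c1 c2 c3 c4 c5 c6 : nat)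
    (A1 A2 A3 A4 A5 A6 B1 B2 B3 B4 B5 : X -> nat) :
  (forall x, c0 + c1 * A1 x + c2 * A2 x + c2 * A3 x + c3 * A4 x + c2 * A5 x + c4 * A6 x
     <= c5 * B1 x + c6 * B2 x + c4 * B3 x + c2 * B4 x + c4 * B5 x) ->
  c0 * #|X| + c1 * \sum_x A1 x + c2 * \sum_x A2 x + c2 * \sum_x A3 x
    + c3 * \sum_x A4 x + c2 * \sum_x A5 x + c4 * \sum_x A6 x
  <= c5 * \sum_x B1 x + c6 * \sum_x B2 x + c4 * \sum_x B3 x + c2 * \sum_x B4 x
    + c4 * \sum_x B5 x.
Proof.
move=> point; have := @leq_sum X (index_enum X) xpredT _ _ (fun x _ => point x).
by rewrite !big_split /= -!big_distrr /= big_const iter_addn_0.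
Qed.

Lemma implyb_and (p q r : bool) : p ==> q -> p ==> r -> p ==> q && r.
Proof. by case: p => //= -> ->. Qed.

(** The i-neighbour of an overcharged alcove has no leaf beside it and lies on exactly
    one of the cycles of colours ij and ij', which is why it can take charge over. *)
Lemma overcharged_neighbour (y' yj yj' qj qj' xs x' xj xj' : bool) :
  (yj ==> ~~ qj) && (yj' ==> ~~ qj') ->
  [&& xs ==> ~~ qj && ~~ qj', xj ==> ~~ qj & xj' ==> ~~ qj'] ->
  [&& ~~ (y' && x'), ~~ (yj && xj) & ~~ (yj' && xj')] ->
  overcharged y' yj yj' qj qj' ->
  (qj (+) qj') && ~~ [|| xs, x', xj | xj'].
Proof.
by case: y'; case: yj; case: yj'; case: qj; case: qj'; case: xs; case: x'; case: xj; case: xj'.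
Qed.

Section Complete.
Variables (a b c e : S).
Local Notation l := [:: a; b; c; e].
Hypothesis U : uniq l.
Variables (k q : nat).
Hypotheses (k5 : 5 <= k) (q5 : 5 <= q).
Local Notation d := (cox_div m).
Hypotheses (ab : d a b = Some k) (ce : d c e = Some q).
Hypotheses (ac : d a c = Some 3) (ae : d a e = Some 3) (bc : d b c = Some 3)
  (be : d b e = Some 3).
Variables (X : finType) (f : S -> X -> X) (D : S -> pred X).
Hypothesis M : chamber_model m (fun s => s \in l) f D.

Let la : a \in l. Proof. by rewrite !inE eqxx. Qed.
Let lb : b \in l. Proof. by rewrite !inE eqxx !orbT. Qed.
Let lc : c \in l. Proof. by rewrite !inE eqxx !orbT. Qed.
Let le : e \in l. Proof. by rewrite !inE eqxx !orbT. Qed.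

Let pair s t : s \in l -> t \in l -> s != t ->
  exists r, odd_pair m (fun s => s \in l) s t r.
Proof.
have P s' t' r : s' \in l -> t' \in l -> d s' t' = Some r ->
    exists r', odd_pair m (fun s => s \in l) s' t' r'.
  by move=> ls lt /(label_pair ls lt)[r' st _]; exists r'.
have P' s' t' r : s' \in l -> t' \in l -> d s' t' = Some r ->
    exists r', odd_pair m (fun s => s \in l) t' s' r'.
  by move=> ls lt /(P _ _ _ ls lt)[r' /(odd_pair_sym m_cox) st]; exists r'.
rewrite !inE => /or4P[]/eqP-> /or4P[]/eqP->; rewrite ?eqxx // => _.
all: try by [exact: (P _ _ _ _ _ ab)|exact: (P _ _ _ _ _ ac)|exact: (P _ _ _ _ _ ae)
  |exact: (P _ _ _ _ _ bc)|exact: (P _ _ _ _ _ be)|exact: (P _ _ _ _ _ ce)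
  |exact: (P' _ _ _ _ _ ab)|exact: (P' _ _ _ _ _ ac)|exact: (P' _ _ _ _ _ ae)
  |exact: (P' _ _ _ _ _ bc)|exact: (P' _ _ _ _ _ be)|exact: (P' _ _ _ _ _ ce)].
Qed.

(* lf s x: the edge of colour s is the only one at x; mk s x: x has such a
   neighbour across the wall of type s. *)
Let lf s x := (f s x != x) && all (fun t => (t == s) || (f t x == x)) l.
Let mk s x := (f s x != x) && all (fun t => (t == s) || (f t (f s x) == f s x)) l.

Let mkE s x : s \in l -> mk s x = lf s (f s x).
Proof. by move=> ls; rewrite /mk /lf (model_invol M ls) eq_sym. Qed.

Let mk_fixed s t y : mk s y -> t \in l -> t != s -> f t (f s y) = f s y.
Proof. by case/andP=> _ /allP H lt ts; have := H t lt; rewrite (negbTE ts) => /eqP. Qed.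

Let mk_moved s t y : mk s y -> s \in l -> t \in l -> f t y != y.
Proof.
move=> my ls lt; have [->|ts] := eqVneq t s; first by case/andP: my.
have st : s != t by rewrite eq_sym.
have [r Pst] := pair ls lt st; apply: (leaf_neighbour M Pst).
  exact: mk_fixed my lt ts.
by case/andP: my.
Qed.

Let mk_not_interior s t y : mk s y -> s \in l -> t \in l -> t != s ->
  (y \notin interior f s t) && (y \notin interior f t s).
Proof. by move=> my ls lt ts; apply/leaf_not_interior/mk_fixed. Qed.

Let mk_parallel s t y : mk s y -> mk s (f t y) -> s \in l -> t \in l -> t != s -> False.
Proof.
move=> my mty ls lt ts; have st : s != t by rewrite eq_sym.
have [r Pst] := pair ls lt st.
apply: (leaves_not_parallel M Pst (mk_fixed my lt ts) (mk_fixed mty lt ts)).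
by case/andP: my.
Qed.

Let mk_opposite s t r y : mk s y -> mk t y -> s \in l -> t \in l -> t != s ->
  d s t = Some r -> 5 <= r -> False.
Proof.
move=> my my' ls lt ts st r5; have [r' Pst Er] := label_pair ls lt st.
have st' : s != t by rewrite eq_sym.
apply: (leaves_not_opposite M Pst _ (mk_fixed my lt ts) (mk_fixed my' ls st')).
  by rewrite Er.
by case/andP: my.
Qed.

Let Q s t x := x \in interior f s t.

Let dl s' j j' (qj qj' : pred X) x := overcharged (mk s' x) (mk j x) (mk j' x) (qj x) (qj' x).
Let dla := dl b c e (Q a c) (Q a e).
Let dlb := dl a c e (Q b c) (Q b e).
Let dlc := dl e a b (Q a c) (Q b c).
Let dle := dl c a b (Q a e) (Q b e).

Let Q_moved s t x : Q s t x ==> (f s x != x) && (f t x != x).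
Proof. by apply/implyP/interior_moved. Qed.

Let Q_l s t x : s \in l -> t \in l -> Q s t (f s x) = Q s t x.
Proof.
move=> ls lt; rewrite /Q (interior_orbit M ls lt (y := f s x)) //.
exact/Orbit_left/Orbit_refl.
Qed.

Let Q_r s t x : s \in l -> t \in l -> Q s t (f t x) = Q s t x.
Proof.
move=> ls lt; rewrite /Q (interior_orbit M ls lt (y := f t x)) //.
exact/Orbit_right/Orbit_refl.
Qed.

Let nab : a != b. Proof. by have := U; rewrite uniq4 => /andP[]. Qed.
Let nac : a != c. Proof. by have := U; rewrite uniq4 => /and3P[]. Qed.
Let nae : a != e. Proof. by have := U; rewrite uniq4 => /and4P[]. Qed.
Let nbc : b != c. Proof. by have := U; rewrite uniq4 => /and5P[]. Qed.
Let nbe : b != e. Proof. by have := U; rewrite uniq4 => /and5P[_ _ _ _ /andP[]]. Qed.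
Let nce : c != e. Proof. by have := U; rewrite uniq4 => /and5P[_ _ _ _ /andP[]]. Qed.
Let nba : b != a. Proof. by rewrite eq_sym. Qed.
Let nca : c != a. Proof. by rewrite eq_sym. Qed.
Let nea : e != a. Proof. by rewrite eq_sym. Qed.
Let ncb : c != b. Proof. by rewrite eq_sym. Qed.
Let neb : e != b. Proof. by rewrite eq_sym. Qed.
Let nec : e != c. Proof. by rewrite eq_sym. Qed.

Let mk_Q s t x : s \in l -> t \in l -> t != s -> mk s x ==> ~~ Q s t x.
Proof. by move=> ls lt ts; apply/implyP => /mk_not_interior/(_ ls lt ts)/andP[]. Qed.

Let mk_Q' s t x : s \in l -> t \in l -> t != s -> mk s x ==> ~~ Q t s x.
Proof. by move=> ls lt ts; apply/implyP => /mk_not_interior/(_ ls lt ts)/andP[]. Qed.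

Let mk_par s t x : s \in l -> t \in l -> t != s -> ~~ (mk s (f t x) && mk s x).
Proof.
move=> ls lt ts; apply/andP => -[m1 m2].
exact: (mk_parallel m2 m1 ls lt ts).
Qed.

Lemma consistent_at x :
  consistent (f a x != x) (f b x != x) (f c x != x) (f e x != x)
    (Q a b x) (Q c e x) (Q a c x) (Q a e x) (Q b c x) (Q b e x)
    (mk a x) (mk b x) (mk c x) (mk e x)
    (dla (f a x)) (dlb (f b x)) (dlc (f c x)) (dle (f e x)).
Proof.
have ra : dla (f a x) ->
    (Q a c x (+) Q a e x) && ~~ [|| mk a x, mk b x, mk c x | mk e x].
  rewrite /dla /dl (Q_l x la lc) (Q_l x la le); apply: overcharged_neighbour.
  - by rewrite -(Q_l x la lc) -(Q_l x la le) !mk_Q'.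
  - by rewrite (implyb_and (mk_Q _ _ _ _) (mk_Q _ _ _ _)) // !mk_Q'.
  - by rewrite !mk_par.
have rb : dlb (f b x) ->
    (Q b c x (+) Q b e x) && ~~ [|| mk b x, mk a x, mk c x | mk e x].
  rewrite /dlb /dl (Q_l x lb lc) (Q_l x lb le); apply: overcharged_neighbour.
  - by rewrite -(Q_l x lb lc) -(Q_l x lb le) !mk_Q'.
  - by rewrite (implyb_and (mk_Q _ _ _ _) (mk_Q _ _ _ _)) // !mk_Q'.
  - by rewrite !mk_par.
have rc : dlc (f c x) ->
    (Q a c x (+) Q b c x) && ~~ [|| mk c x, mk e x, mk a x | mk b x].
  rewrite /dlc /dl (Q_r x la lc) (Q_r x lb lc); apply: overcharged_neighbour.
  - by rewrite -(Q_r x la lc) -(Q_r x lb lc) !mk_Q.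
  - by rewrite (implyb_and (mk_Q' _ _ _ _) (mk_Q' _ _ _ _)) // !mk_Q.
  - by rewrite !mk_par.
have re : dle (f e x) ->
    (Q a e x (+) Q b e x) && ~~ [|| mk e x, mk c x, mk a x | mk b x].
  rewrite /dle /dl (Q_r x la le) (Q_r x lb le); apply: overcharged_neighbour.
  - by rewrite -(Q_r x la le) -(Q_r x lb le) !mk_Q.
  - by rewrite (implyb_and (mk_Q' _ _ _ _) (mk_Q' _ _ _ _)) // !mk_Q.
  - by rewrite !mk_par.
have pa y : ~~ (mk a y && mk b y).
  by apply/andP => -[m1 m2]; apply: (mk_opposite m1 m2 la lb nba ab k5).
have pc y : ~~ (mk c y && mk e y).
  by apply/andP => -[m1 m2]; apply: (mk_opposite m1 m2 lc le nec ce q5).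
have moved : [|| f a x != x, f b x != x, f c x != x | f e x != x].
  have [s + fs] := model_moved M x.
  by rewrite !inE => /or4P[]/eqP sE; move: fs; rewrite sE => ->; rewrite ?orbT.
have full : [|| mk a x, mk b x, mk c x | mk e x] ==>
    [&& f a x != x, f b x != x, f c x != x & f e x != x].
  by apply/implyP => /or4P[] mx; rewrite !(mk_moved mx).
rewrite /consistent moved full !Q_moved pa pc /=.
apply/and5P; split; last (apply/andP; split); last first.
- by apply/implyP => /re/andP[].
- by apply/implyP => /rc/andP[].
- by apply/implyP => /rb/andP[].
- by apply/implyP => /ra/andP[].
- by apply/implyP => /or4P[/ra|/rb|/rc|/re] /andP[_];
     rewrite !negb_or => /and4P[-> -> -> ->].
by apply/and4P; split; rewrite !negb_or; apply: implyb_and;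
   try (apply: implyb_and); try exact: mk_Q; try exact: mk_Q'.
Qed.

Let sum_mk s : s \in l -> \sum_x mk s x = \sum_x lf s x.
Proof.
move=> ls; rewrite -(sum_involution (fun x => lf s x : nat) (model_invol M ls)).
by apply: eq_bigr => x _; rewrite mkE.
Qed.

Let leaf_bitsE x : leaf_bits (f a x != x) (f b x != x) (f c x != x) (f e x != x) =
  lf a x + lf b x + lf c x + lf e x :> nat.
Proof.
rewrite /lf /leaf_bits /= !eqxx (negbTE nab) (negbTE nac) (negbTE nae) (negbTE nbc)
  (negbTE nbe) (negbTE nce) (negbTE nba) (negbTE nca) (negbTE nea) (negbTE ncb)
  (negbTE neb) (negbTE nec) /=.
by case: (f a x == x); case: (f b x == x); case: (f c x == x); case: (f e x == x).
Qed.

Let pair_counts p s t r : s \in l -> t \in l -> d s t = Some r -> 0 < p <= r ->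
  [/\ 2 * p * tops D s t <= \sum_x Q s t x,
      p.-2 * ends f s t <= \sum_x [&& f s x != x, f t x != x & ~~ Q s t x],
      \sum_x ((f s x != x) (+) (f t x != x)) = 2 * ends f s t
    & \sum_x (f s x != x) = 2 * edges D s /\ \sum_x (f t x != x) = 2 * edges D t].
Proof.
move=> ls lt /(label_pair ls lt)[r' Pst <-] /andP[p_gt0 p_le].
have boundE := ends_bound m_odd m_cox M Pst; have boundT := tops_bound m_odd m_cox M Pst.
have both := count_both M Pst; rewrite -/(Q s t) in both.
rewrite (count_xor M Pst) (count_moved M Pst) (count_moved M (odd_pair_sym m_cox Pst)).
rewrite [\sum_x Q s t x]count_interior.
have le1 : 2 * p * tops D s t <= 2 * pdiv r' * tops D s t.
  by rewrite leq_mul2r leq_mul2l p_le !orbT.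
have le2 : p.-2 * ends f s t <= (pdiv r').-2 * ends f s t.
  by rewrite leq_mul2r; apply/orP; right; move: p_le; clear; lia.
split=> //; first by apply: leq_trans boundT.
apply: leq_trans le2 _; move: boundE both; rewrite /Q.
move: (ends f s t) #|interior f s t| (edges D s) (\sum_x _) => E I e0 B.
by case: (pdiv r') => [|[|u]] /=; clear; lia.
Qed.

(** No average over spanning trees suffices here, so the Euler characteristic is
    distributed over the alcoves.  Each gets its share of edges and tops and of the
    bounds on the ends, a leaf passes its excess to its only neighbour, and an
    overcharged alcove passes some of its charge on.  Then no alcove has a
    positive charge, while the total is at least 120. *)
Lemma excluded_C_complete : False.
Proof.
pose both s t x := [&& f s x != x, f t x != x & ~~ Q s t x].
pose xor s t x := (f s x != x) (+) (f t x != x).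
have point x :
  120 + 12 * (Q a b x + Q c e x) + 20 * (Q a c x + Q a e x + Q b c x + Q b e x)
  + 20 * (both a b x + both c e x)
  + 10 * (both a c x + both a e x + both b c x + both b e x)
  + 20 * (mk a x + mk b x + mk c x + mk e x)
  + 5 * (dla (f a x) + dlb (f b x) + dlc (f c x) + dle (f e x))
  <= 60 * ((f a x != x) + (f b x != x) + (f c x != x) + (f e x != x))
  + 30 * (xor a b x + xor c e x) + 5 * (xor a c x + xor a e x + xor b c x + xor b e x)
  + 20 * (lf a x + lf b x + lf c x + lf e x)
  + 5 * (dla x + dlb x + dlc x + dle x).
  by have := consistent_charges (consistent_at x); rewrite /charges leaf_bitsE.
have {point} := sum_weighted point; rewrite /both /xor !big_split /= !sum_mk //.
have reidx s (F : pred X) : s \in l -> \sum_x F (f s x) = \sum_x F x.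
  by move=> ls; apply: (sum_involution (fun x => F x : nat) (model_invol M ls)).
rewrite !reidx //.
have [] := @pair_counts 5 _ _ _ la lb ab k5; have [] := @pair_counts 5 _ _ _ lc le ce q5.
have three : 0 < 3 <= 3 by [].
have [] := @pair_counts 3 _ _ _ la lc ac three; have [] := @pair_counts 3 _ _ _ la le ae three.
have [] := @pair_counts 3 _ _ _ lb lc bc three; have [] := @pair_counts 3 _ _ _ lb le be three.
have := euler4 M.
have [] := label_loops m_cox m_odd M la lb ab; have [] := label_loops m_cox m_odd M la lc ac.
have [] := label_loops m_cox m_odd M la le ae.
have := card_model M la.
rewrite -[5.-2]/3 -[3.-2]/1.
repeat match goal with
| |- context [ends ?f ?x ?y] => move: (ends f x y)
| |- context [tops ?D ?x ?y] => move: (tops D x y)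
| |- context [edges ?D ?x] => move: (edges D x)
| |- context [loops ?f ?x] => move: #|loops f x|
| |- context [@bigop.body ?R ?I ?i ?r ?b] => move: (@bigop.body R I i r b)
end.
by move: #|X|; clear; lia.
Qed.
End Complete.

End CompleteFour.

(** * Finite index reflection subgroups from finite actions *)

Section FiniteIndexFromAction.
Variables (S : finType) (m : S -> S -> option nat).
Hypothesis m_cox : is_coxeter_matrix m.
Local Notation W := (coxeter_group m).
Local Notation gen := (coxeter_gen m).

(** The reflections of the form s^(g x) with s fixing x generate a subgroup H: by
    induction on the length, every element is some [g x] times an element of H, since
    a generator either moves x or is absorbed into H.  H is proper because it fixes
    x0. *)
Lemma finite_index_of_action (X : finType) (f : S -> X -> X) (x0 : X) (g : X -> W) :
  is_coxeter_action m f -> g x0 = 1 ->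
  (forall s x, f s x != x -> gen s * g x = g (f s x)) ->
  (exists s, f s x0 != x0) ->
  has_finite_index_reflection_subgroup m setT.
Proof.
move=> fact g1 gstep [s0 s0x0].
have actM := cox_actM fact; have actg := cox_act_gen fact.
pose good x := cox_act f (g x) x0 = x.
pose A : set W := [set r | exists s x, [/\ f s x = x, good x & r = gen s ^ g x]].
have sH := generated_subgroup A; set H := generated A in sH.
have actV (w : W) x y : cox_act f w x = y -> cox_act f w^-1 y = x.
  by move=> <-; rewrite -(cox_actM fact) mulVg (cox_act1 fact).
have fixH : H `<=` [set w | cox_act f w x0 = x0].
  apply: generated_min => [|_ [s [x [fsx gx ->]]]].
    split=> [|u v /= u0 v0]; first exact: cox_act1.
    by rewrite actM (actV _ _ _ v0).
  by rewrite /= conjgE !actM gx actg fsx; apply: actV.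
exists H.
  split; last first.
    by exists A => // _ [s [x [_ _ ->]]]; exists s => //; exists (g x) => //; apply: special_setT.
  split=> [w _|/(_ (gen s0) (special_setT _))/fixH /=]; first exact: special_setT.
  by rewrite actg => /eqP; apply/negP.
have cosets w : exists x h, [/\ good x, H h & w = g x * h].
  elim/(special_ind m_cox): w / (special_setT w) => [|s w _ _ [x [h [gx Hh ->]]]].
    exists x0, 1; rewrite g1 mulg1; split=> //; last exact: subgroup1.
    by rewrite /good g1 cox_act1.
  have [fsx|fsx] := eqVneq (f s x) x; last first.
    exists (f s x), h; rewrite -gstep // mulgA; split=> //.
    by rewrite /good -gstep // actM gx actg.
  exists x, (gen s ^ g x * h); split=> //; last by rewrite [RHS]mulgA -conjgC mulgA.
  by apply: (subgroupM sH) => //; apply: sub_generated; exists s, x.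
pose coset (w : W) : set W := [set w * h | h in H].
apply: (@sub_finite_set _ _ [set coset (g x) | x in [set: X]]); last first.
  exact/finite_image/finite_finset.
move=> _ [w _ <-]; have [x [h [_ Hh ->]]] := cosets w; exists x => //.
rewrite eqEsubset; split=> _ [h' Hh' <-].
  exists (h^-1 * h'); last by rewrite -mulgA mulVKg.
  by apply: (subgroupM sH) => //; apply: (subgroupV sH).
by exists (h * h'); rewrite ?mulgA //; apply: (subgroupM sH).
Qed.

Section Pendants.
Local Open Scope nat_scope.
Variables (A : pred S) (Z : finType) (f0 : S -> Z -> Z) (Y : pred Z).
Variables (g0 : Z -> W) (z0 : Z).
Hypothesis f0K : forall s, A s -> involutive (f0 s).
Hypothesis f0_order : forall s t k, A s -> A t -> m s t = Some k ->
  forall z, iter k (f0 s \o f0 t) z = z.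
Hypothesis three : forall s t k, ~~ A t -> s != t -> m s t = Some k -> 3 %| k.
Hypothesis Y_disjoint : forall s z, A s -> Y z -> ~~ Y (f0 s z).
Hypothesis Y_cover : forall s z, A s -> ~~ Y z -> ~~ Y (f0 s z) -> f0 s z = z.
Hypothesis g0_base : g0 z0 = 1%g.
Hypothesis g0_step : forall s z, A s -> f0 s z != z -> (gen s * g0 z)%g = g0 (f0 s z).
Hypothesis moved : exists s, if A s then f0 s z0 != z0 else Y z0.

(** [inr (c, z)] is the new c-neighbour of z. *)
Definition pendant_act (s : S) (x : Z + S * Z) : Z + S * Z :=
  match x with
  | inl z => if A s then inl (f0 s z) else if Y z then inr (s, z) else inl z
  | inr (c, z) => if [&& c == s, ~~ A s & Y z] then inl z else inr (c, z)
  end.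

Lemma pendant_invol s : involutive (pendant_act s).
Proof.
move=> [z|[c z]] /=.
  case: ifP => [As|nAs] /=; first by rewrite As f0K.
  by case: ifP => Yz /=; rewrite ?eqxx ?nAs ?Yz.
case: ifP => [/and3P[/eqP-> nA Yz]|E] /=; last by rewrite E.
by rewrite (negbTE nA) Yz.
Qed.

(** The edge z, s z has exactly one end in Y, and the point that hangs there in colour
    t completes a path of three points. *)
Lemma pendant_braid_mixed s t x : A s -> ~~ A t ->
  pendant_act s (pendant_act t (pendant_act s x)) =
  pendant_act t (pendant_act s (pendant_act t x)).
Proof.
move=> As /negbTE nAt; case: x => [z|[c z]].
  have [Yz|/negbTE nYz] := boolP (Y z).
    have /negbTE nYsz := Y_disjoint As Yz.
    do 6?[rewrite /= ?As ?nAt ?Yz ?nYsz ?andbF ?eqxx /=].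
    by rewrite f0K.
  have [Ysz|nYsz] := boolP (Y (f0 s z)).
    by do 6?[rewrite /= ?As ?nAt ?nYz ?Ysz ?andbF ?eqxx /=].
  have sz := Y_cover As (negbT nYz) nYsz.
  by do 6?[rewrite /= ?As ?nAt ?nYz ?sz ?andbF ?eqxx /=].
have [/andP[/eqP-> Yz]|/negbTE E] := boolP ((c == t) && Y z).
  have /negbTE nYsz := Y_disjoint As Yz.
  by do 6?[rewrite /= ?As ?nAt ?Yz ?nYsz ?andbF ?eqxx /=].
by do 6?[rewrite /= ?As ?nAt ?E ?andbF /=].
Qed.

(** Two points that hang at z form a path of three points through z. *)
Lemma pendant_braid_new s t x : ~~ A s -> ~~ A t -> s != t ->
  pendant_act s (pendant_act t (pendant_act s x)) =
  pendant_act t (pendant_act s (pendant_act t x)).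
Proof.
move=> nAs nAt st; have ts : t != s by rewrite eq_sym.
move: nAs nAt st ts => /negbTE nAs /negbTE nAt /negbTE st /negbTE ts.
case: x => [z|[c z]].
  case Yz : (Y z); by do 6?[rewrite /= ?nAs ?nAt ?Yz ?st ?ts ?eqxx /=].
case Yz : (Y z); last by do 6?[rewrite /= ?nAs ?nAt ?Yz ?andbF /=].
have [->|/negbTE cs] := eqVneq c s; first by do 6?[rewrite /= ?nAs ?nAt ?Yz ?st ?ts ?eqxx /=].
have [->|/negbTE ct] := eqVneq c t; by do 6?[rewrite /= ?nAs ?nAt ?Yz ?st ?ts ?cs ?ct ?eqxx /=].
Qed.

Lemma pendant_action : is_coxeter_action m pendant_act.
Proof.
split=> [|s t k mst x]; first exact: pendant_invol.
have [st|st] := eqVneq s t.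
  move: mst; rewrite -st; case: m_cox => -> _ _ [<-] /=.
  exact: pendant_invol.
have [/andP[As At]|nAA] := boolP (A s && A t).
  case: x => [z|[c z]].
    rewrite -{2}(f0_order As At mst z); elim: k {mst} => //= n ->.
    by rewrite /= At /= As.
  by elim: k {mst} => //= n ->; rewrite /= At andbF /= As andbF.
have k3 : 3 %| k.
  move: nAA; rewrite negb_and => /orP[nA|nA]; last exact: three mst.
  by apply: (three (s := t) nA); rewrite 1?eq_sym //; case: m_cox => _ ->.
have braid y : pendant_act s (pendant_act t (pendant_act s y)) =
  pendant_act t (pendant_act s (pendant_act t y)).
  have [As|nAs] := boolP (A s); have [At|nAt] := boolP (A t).
  - by rewrite As At in nAA.
  - exact: pendant_braid_mixed.
  - exact/esym/pendant_braid_mixed.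
  - exact: pendant_braid_new.
have it3 y : iter 3 (pendant_act s \o pendant_act t) y = y.
  by rewrite /= braid !pendant_invol.
by rewrite -(divnK k3); elim: (k %/ 3) => // n IH; rewrite mulSn iterD IH it3.
Qed.

(** Every point of Y gets one new neighbour for each colour outside A.  Each edge
    of the old graph has exactly one end in Y, so it forms a path of three
    points with the new edge there, as a label 3 requires, and so do two new
    edges at the same point. *)
Lemma finite_index_of_pendants : has_finite_index_reflection_subgroup m setT.
Proof.
pose g (x : Z + S * Z) : W :=
  match x with inl z => g0 z | inr (c, z) => (gen c * g0 z)%g end.
apply: (finite_index_of_action (x0 := inl z0) (g := g) pendant_action g0_base).
  move=> s [z|[c z]] /=.
    case: ifP => [As fz|nAs]; first by rewrite g0_step.
    by case: ifP => //; rewrite eqxx.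
  case: ifP => [/and3P[/eqP-> _ _] _|_]; last by rewrite eqxx.
  by rewrite (coxeter_genK m_cox).
have [s zs] := moved; exists s => /=; case: ifP zs => [_ //|_ ->] //.
Qed.

End Pendants.

Local Open Scope nat_scope.

Lemma iter_dvdn (X : Type) (F : X -> X) n k : (forall x, iter n F x = x) -> n %| k ->
  forall x, iter k F x = x.
Proof.
by move=> nF /dvdnP[q ->] x; elim: q => //= q IH; rewrite mulSn iterD IH nF.
Qed.

(** A star: one point with a neighbour in every colour. *)
Lemma finite_index_of_threes : 0 < #|S| ->
  (forall s t k, s != t -> m s t = Some k -> 3 %| k) ->
  has_finite_index_reflection_subgroup m setT.
Proof.
move=> /card_gt0P[s0 _] three.
apply: (@finite_index_of_pendants pred0 unit (fun _ => id) predT (fun=> 1%g) tt) => //.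
- by move=> s t k _; apply: three.
- by exists s0.
Qed.

Section OneBigEdge.
Variables (a b : S) (n : nat).
Hypothesis ab : a != b.
Hypothesis mab : m a b = Some n.*2.+3.
Hypothesis three : forall s t k, t \notin [:: a; b] -> s != t -> m s t = Some k -> 3 %| k.

Let K := n.*2.+3.
(** The reflection z -> c - z of Z/K on representatives.  With c = 0 and c = 1 these make
    a path of K points; Y consists of every other point of it. *)
Definition flip (c z : nat) : nat := if z <= c then c - z else K + c - z.

Lemma flip_lt c z : c < K -> z < K -> flip c z < K.
Proof. by rewrite /flip => cK zK; case: (leqP z c); lia. Qed.

Lemma flipK c z : c < K -> z < K -> flip c (flip c z) = z.
Proof. by rewrite /flip => cK zK; case: (leqP z c) => zc; case: leqP => ?; lia. Qed.

Definition dihedral_flip (s : S) (z : 'I_K) : 'I_K := inord (flip (s == b) z).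

Lemma val_flip s (z : 'I_K) : dihedral_flip s z = flip (s == b) z :> nat.
Proof. by rewrite inordK // flip_lt //; case: eqP. Qed.

Lemma flip_rotate s t j (z : 'I_K) : iter j (dihedral_flip s \o dihedral_flip t) z =
  (z + j * (K + (s == b) - (t == b))) %% K :> nat.
Proof.
elim: j => [|j IH]; first by rewrite addn0 modn_small.
rewrite iterS /= !val_flip IH mulSn.
set u := j * _.
have -> : z + (K + (s == b) - (t == b) + u) = (z + u) + (K + (s == b) - (t == b)) by lia.
rewrite -[RHS]modnDml.
have: (z + u) %% K < K by rewrite ltn_mod.
move: (_ %% K) => r rK; set y := LHS; set x := r + _.
have yK : y < K by rewrite !flip_lt //; case: eqP.
have : exists q, x = q * K + y.
  suff: x = y \/ x = K + y \/ x = K.*2 + y.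
    by case=> [|[]] ->; [exists 0 | exists 1; rewrite mul1n | exists 2; rewrite mul2n].
  rewrite /x /y /flip; have : 2 < K by [].
  move: (K) rK => k rk k2.
  case: (s == b); case: (t == b) => /=; case: (leqP r _) => ?; case: leqP => ?; lia.
by case=> q ->; rewrite modnMDl modn_small.
Qed.

(** The alternating word that leads from 0 to z along the path. *)
Definition dihedral_coset (z : nat) : W :=
  (if z == 0 then 1 else if z <= n.+1
   then gen b * (gen a * gen b) ^+ z.-1 else (gen a * gen b) ^+ (K - z))%g.

Lemma dihedral_coset_lo i : 0 < i <= n.+1 ->
  dihedral_coset i = (gen b * (gen a * gen b) ^+ i.-1)%g.
Proof. by case: i => // i /= ni; rewrite /dihedral_coset /= ni. Qed.

Lemma dihedral_coset_hi i : i <= n.+1 ->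
  dihedral_coset ((K - i) %% K) = ((gen a * gen b) ^+ i)%g.
Proof.
case: (posnP i) => [-> _|i0 ni]; first by rewrite subn0 modnn expg0.
rewrite modn_small /dihedral_coset; last by rewrite /K; lia.
have -> : (K - i == 0) = false by rewrite /K; lia.
have -> : (K - i <= n.+1) = false by rewrite /K; lia.
by rewrite subKn // /K; lia.
Qed.

Lemma finite_index_of_one_big : has_finite_index_reflection_subgroup m setT.
Proof.
have genK s w : (gen s * (gen s * w))%g = w by rewrite mulgA (coxeter_gen2 m_cox) mul1g.
have mba : m b a = Some K by case: m_cox => _ <-.
apply: (@finite_index_of_pendants (mem [:: a; b]) 'I_K dihedral_flip
  (fun z => 0 < z <= n.+1) dihedral_coset ord0) => //.
- by move=> s _ z; apply: ord_inj; rewrite !val_flip flipK //; case: eqP.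
- move=> s t k As At mst z; apply: ord_inj; rewrite /= flip_rotate.
  have Kk : K %| k * (K + (s == b) - (t == b)).
    move: As At mst; rewrite !inE => /orP[]/eqP-> /orP[]/eqP->; rewrite ?eqxx ?(negbTE ab).
    - by move=> _; rewrite addn0 subn0 dvdn_mull.
    - by rewrite mab => -[<-]; rewrite dvdn_mulr.
    - by rewrite mba => -[<-]; rewrite dvdn_mulr.
    - by move=> _; rewrite addnK dvdn_mull.
  by rewrite -modnDmr (eqnP Kk) addn0 modn_small.
- move=> s z _; rewrite val_flip /flip /K; have := ltn_ord z; rewrite /K => zK.
  by case: (leqP z (s == b)); case: (s == b); lia.
- move=> s z _ nY nY'; apply: ord_inj; move: nY nY'; rewrite val_flip.
  rewrite /flip /K; have := ltn_ord z; rewrite /K => zK.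
  move: (nat_of_ord z) zK => y yK; case: (leqP y (s == b)); case: (s == b) => /=; rewrite -?leqNgt ?negb_and => *; lia.
- move=> s [y yK] /= As; rewrite -val_eqE /= val_flip /=.
  have [i in1 yi] : exists2 i, i <= n.+1 & y = i /\ 0 < i \/ y = (K - i) %% K.
    have [yn|yn] := leqP y n.+1.
      have [y0|y0] := posnP y; first by exists 0 => //; right; rewrite y0 subn0 modnn.
      by exists y; [|left].
    exists (K - y); first by rewrite /K in yK *; lia.
    by right; rewrite subKn ?(ltnW yK) // modn_small.
  have hi j : 0 < j -> j <= n.+1 -> K - j = (K - j) %% K.
    by move=> *; rewrite modn_small // /K; lia.
  move: As; rewrite /= !inE => /orP[]/eqP->; rewrite ?eqxx ?(negbTE ab) /flip /=.
    case: yi => [[-> i0] _|->].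
      rewrite leqNgt i0 /= addn0 hi // dihedral_coset_lo ?i0 // dihedral_coset_hi //.
      by case: i i0 {in1} => // i _; rewrite expgS mulgA.
    rewrite dihedral_coset_hi //; case: i in1 => [|i] in1.
      by rewrite subn0 modnn.
    rewrite -hi // leqNgt subn_gt0 (_ : i.+1 < K) /=; last by rewrite /K; lia.
    rewrite addn0 => _; rewrite subKn; last by rewrite /K; lia.
    by rewrite dihedral_coset_lo // expgS -mulgA genK.
  case: yi => [[-> i0]|->].
    case: i i0 in1 => // -[|i] _ in1; first by rewrite dihedral_coset_lo //= mulg1 genK.
    rewrite dihedral_coset_lo //= genK addn1 subSS hi ?dihedral_coset_hi //; exact: ltnW.
  rewrite dihedral_coset_hi //; case: i in1 => [|i] in1.
    by rewrite subn0 modnn /= mulg1 dihedral_coset_lo //= mulg1.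
  rewrite -hi // leqNgt (_ : 1 < K - i.+1) /=; last by rewrite /K; lia.
  rewrite (_ : K + 1 - (K - i.+1) = i.+2); last by rewrite /K; lia.
  case: (ltnP i n) => [lin _|nli].
    by rewrite (@dihedral_coset_lo i.+1.+1) // genK.
  have -> : K - i.+1 = i.+2 by rewrite /K; lia.
  by case/eqP.
- by exists b; rewrite /= !inE eqxx orbT -val_eqE /= val_flip eqxx.
Qed.

End OneBigEdge.

Section TwoBigEdges.
Variables (a b c : S) (n kab kbc : nat).
Hypothesis abc : uniq [:: a; b; c].
Hypothesis mab : m a b = Some kab.
Hypothesis mbc : m b c = Some kbc.
Hypothesis mac : m a c = Some n.+1.
Hypothesis five_ab : 5 %| kab.
Hypothesis five_bc : 5 %| kbc.
Hypothesis three_ac : 3 %| n.+1.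
Hypothesis three : forall s t k,
  t \notin [:: a; b; c] -> s != t -> m s t = Some k -> 3 %| k.

(** The points p z and q z alternate along a cycle of colours a and c.  Each p z has
    a b-neighbour u z, which in turn has the leaves ua z and uc z in the
    colours a and c, and each q z has a leaf l z in the colour b.  Then a and b
    form the paths l, q, p, u, ua of five points, and b and c similarly.  Every edge
    has one end among the points q z and u z, which make up Y. *)
Let site := (option bool * bool * 'I_n.+1)%type.
Local Notation p z := (None, false, z).
Local Notation q z := (None, true, z).
Local Notation u z := (Some false, false, z).
Local Notation l z := (Some false, true, z).
Local Notation ua z := (Some true, false, z).
Local Notation uc z := (Some true, true, z).

Definition act_a (x : site) : site :=
  match x with
  | p z => q z | q z => p z
  | u z => ua z | ua z => u z
  | _ => x
  end.

Definition act_b (x : site) : site :=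
  match x with
  | p z => u z | u z => p z
  | q z => l z | l z => q z
  | _ => x
  end.

Definition act_c (x : site) : site :=
  match x with
  | p z => q (ord_pred z) | q z => p (ordS z)
  | u z => uc z | uc z => u z
  | _ => x
  end.

Definition ring_act (s : S) : site -> site :=
  if s == a then act_a else if s == b then act_b else act_c.

Definition ring_coset (x : site) : W :=
  let r (z : 'I_n.+1) := ((gen c * gen a) ^+ z)%g in
  match x with
  | p z => r z | q z => gen a * r z
  | u z => gen b * r z | l z => gen b * (gen a * r z)
  | ua z => gen a * (gen b * r z) | uc z => gen c * (gen b * r z)
  end%g.

Lemma val_iter_ordS j (z : 'I_n.+1) : iter j (@ordS _) z = (z + j) %% n.+1 :> nat.
Proof.
elim: j => [|j IH]; first by rewrite addn0 modn_small.
by rewrite /= IH -addn1 modnDml -addnA addn1.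
Qed.

Lemma iter_ordS (z : 'I_n.+1) : iter n.+1 (@ordS _) z = z.
Proof. by apply: ord_inj; rewrite val_iter_ordS modnDr modn_small. Qed.

Lemma iter_ord_pred (z : 'I_n.+1) : iter n.+1 (@ord_pred _) z = z.
Proof.
have E j y : iter j (@ord_pred _) (iter j (@ordS _) y) = y.
  by elim: j y => // j IH y; rewrite iterSr iterS ordSK IH.
by rewrite -{1}(iter_ordS z) E.
Qed.

Lemma act_aK : involutive act_a. Proof. by case=> [[[[]|] []] z]. Qed.
Lemma act_bK : involutive act_b. Proof. by case=> [[[[]|] []] z]. Qed.
Lemma act_cK : involutive act_c.
Proof. by case=> [[[[]|] []] z] //=; rewrite ?ordSK ?ord_predK. Qed.

Lemma act_ab x : iter 5 (act_a \o act_b) x = x.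
Proof. by case: x => [[[[]|] []] z]. Qed.

Lemma act_bc x : iter 5 (act_b \o act_c) x = x.
Proof. by case: x => [[[[]|] []] z] //=; rewrite ?ordSK ?ord_predK. Qed.

Lemma act_ac x : iter n.+1 (act_a \o act_c) x = x.
Proof.
have side y : isSome y.1.1 -> iter n.+1 (act_a \o act_c) y = y.
  have [j nE] := dvdnP three_ac; move=> y1.
  suff: iter (j * 3) (act_a \o act_c) y = y by rewrite -nE.
  case: y y1 => [[[[]|] []] z] // _; elim: j {nE} => // j IH; by rewrite mulSn iterD IH.
case: x => [[[i|] e] z]; first exact: side.
have P j : iter j (act_a \o act_c) (p z) = p (iter j (@ord_pred _) z).
  by elim: j => // j IH; rewrite iterS IH.
have Q j : iter j (act_a \o act_c) (q z) = q (iter j (@ordS _) z).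
  by elim: j => // j IH; rewrite iterS IH.
by case: e; rewrite ?P ?Q ?iter_ordS ?iter_ord_pred.
Qed.

Lemma iter_swap (X : Type) (g h : X -> X) k : involutive g -> involutive h ->
  (forall x, iter k (g \o h) x = x) -> forall x, iter k (h \o g) x = x.
Proof.
move=> gK hK gh x.
have E j y : iter j (h \o g) y = g (iter j (g \o h) (g y)).
  by elim: j y => [|j IH] y /=; rewrite ?gK // IH /= gK.
by rewrite E gh gK.
Qed.

Lemma finite_index_of_two_big : has_finite_index_reflection_subgroup m setT.
Proof.
have genK s w : (gen s * (gen s * w))%g = w by rewrite mulgA (coxeter_gen2 m_cox) mul1g.
have m_sym s t : m s t = m t s by case: m_cox.
move: abc => /=; rewrite !inE negb_or andbT => /andP[/andP[/negbTE ab /negbTE ac] /negbTE bc].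
have ra : ring_act a = act_a by rewrite /ring_act eqxx.
have rb : ring_act b = act_b by rewrite /ring_act eqxx (eq_sym b) ab.
have rc : ring_act c = act_c by rewrite /ring_act !(eq_sym c) ac bc.
have mca : m c a = Some n.+1 by rewrite m_sym.
have rcaS (z : 'I_n.+1) : ((gen c * gen a) ^+ ordS z = gen c * (gen a * (gen c * gen a) ^+ z))%g.
  rewrite mulgA -expgS; have := ltn_ord z; rewrite /= ltnS leq_eqVlt => /orP[/eqP->|zn].
    by rewrite modnn (coxeter_braid mca).
  by rewrite modn_small.
have rcaP (z : 'I_n.+1) : (gen c * (gen a * (gen c * gen a) ^+ ord_pred z) = (gen c * gen a) ^+ z)%g.
  by rewrite -rcaS ord_predK.
have one s g k : involutive g -> m s s = Some k -> forall x : site, iter k (g \o g) x = x.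
  by move=> gK; case: m_cox => -> _ _ [<-] x; apply: gK.
apply: (@finite_index_of_pendants (mem [:: a; b; c]) site ring_act
  (fun x => x.1 \in [:: (None, true); (Some false, false)]) ring_coset (p ord0)) => //.
- by move=> s; rewrite /= !inE => /or3P[]/eqP->; rewrite ?ra ?rb ?rc;
    [exact: act_aK|exact: act_bK|exact: act_cK].
- move=> s t k; rewrite /= !inE => /or3P[]/eqP-> /or3P[]/eqP->; rewrite ?ra ?rb ?rc => mst.
  - exact: (one _ _ _ act_aK mst).
  - by apply: (iter_dvdn act_ab); move: mst; rewrite mab => -[<-].
  - by apply: (iter_dvdn act_ac); move: mst; rewrite mac => -[<-].
  - by apply: (iter_dvdn (iter_swap act_aK act_bK act_ab)); move: mst; rewrite m_sym mab => -[<-].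
  - exact: (one _ _ _ act_bK mst).
  - by apply: (iter_dvdn act_bc); move: mst; rewrite mbc => -[<-].
  - by apply: (iter_dvdn (iter_swap act_aK act_cK act_ac)); move: mst; rewrite m_sym mac => -[<-].
  - by apply: (iter_dvdn (iter_swap act_bK act_cK act_bc)); move: mst; rewrite m_sym mbc => -[<-].
  - exact: (one _ _ _ act_cK mst).
- by move=> s [[[[]|] []] z]; rewrite /= !inE => /or3P[]/eqP->; rewrite ?ra ?rb ?rc.
- by move=> s [[[[]|] []] z]; rewrite /= !inE => /or3P[]/eqP->; rewrite ?ra ?rb ?rc.
- move=> s x; rewrite /= !inE => /or3P[]/eqP->; rewrite ?ra ?rb ?rc; case: x => [[[[]|] []] z];
    rewrite /= ?eqxx ?genK // ?rcaS ?rcaP ?genK //.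
  by rewrite -{1}rcaP genK.
- by exists a; rewrite /= !inE eqxx ra.
Qed.

End TwoBigEdges.
End FiniteIndexFromAction.

(** * Large edges in a diagram *)

Section Classification.
Local Open Scope nat_scope.
Variables (S : finType) (m : S -> S -> option nat).
Hypotheses (S_gt0 : 0 < #|S|) (m_cox : is_coxeter_matrix m) (m_odd : odd_angled m).
Hypothesis W_min : minimal_no_finite_index_reflection_subgroup m.
Hypothesis conn : diagram_connected (cox_div m).
Local Notation d := (cox_div m).
Hypothesis unlisted : ~ (diagram_A d \/ diagram_B d \/ diagram_C d \/
  diagram_D d \/ diagram_E d \/ diagram_F d).

(** A pattern without finite index reflection subgroup cannot live on a proper subset
    of the vertices, by minimality. *)
Lemma spanning n (v : nat -> S) : 0 < n -> uniq [seq v i | i <- iota 1 n] ->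
  (forall (X : finType) (f : S -> X -> X) D,
     ~ chamber_model m (fun s => s \in [seq v i | i <- iota 1 n]) f D) ->
  vertices n v.
Proof.
move=> n0 U nM; pose T : set S := fun s => s \in [seq v i | i <- iota 1 n].
suff allT s : T s by apply: uniq_perm => // [|s]; rewrite ?enum_uniq // mem_enum allT.
apply: contrapT => nTs.
have [|X [f [D]]] := finite_index_model m_cox m_odd (T := T); last exact: nM.
apply: (proj2 W_min); first by exists (v 1); apply: map_f; rewrite mem_iota; lia.
by split=> // /(_ s I).
Qed.

Definition big s t := if d s t is Some k then 5 <= k else false.

Lemma big_sym s t : big s t = big t s.
Proof. by rewrite /big (cox_div_sym m_cox). Qed.

Lemma bigP s t : reflect (exists2 k, 5 <= k & d s t = Some k) (big s t).
Proof.
rewrite /big; case: (d s t) => [k|]; last by constructor=> -[].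
by apply: (iffP idP) => [k5|[_ k5 [->]] //]; exists k.
Qed.

Lemma big_neq s t : big s t -> s != t.
Proof. by apply: contraL => /eqP->; rewrite /big /cox_div eqxx. Qed.

Lemma labelP s t k : d s t = Some k ->
  [/\ s != t, prime k, odd k & exists2 n, m s t = Some n & k %| n].
Proof.
rewrite /cox_div; case: eqVneq => // st; case E: (m s t) => [n|] //= [<-].
have n2 : 2 <= n by case: m_cox => _ _ /(_ _ _ _ st E).
split=> //; first exact: pdiv_prime.
  exact: dvdn_odd (pdiv_dvd n) (m_odd st E).
by exists n => //; apply: pdiv_dvd.
Qed.

Lemma label_cases s t : ~~ big s t -> three_or_none d s t.
Proof.
rewrite /big /three_or_none; case E: (d s t) => [k|]; last by right.
case: (labelP E) => _ /prime_gt1 k1 ok _ k5; left; congr Some.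
by case: k k1 ok k5 {E} => [|[|[|[|[|k]]]]].
Qed.

Lemma small_three s t k : ~~ big s t -> s != t -> m s t = Some k -> 3 %| k.
Proof.
move=> /label_cases st; rewrite /three_or_none /cox_div => /negbTE nst E.
by move: st; rewrite /three_or_none /cox_div nst E /= => -[[<-]|//]; apply: pdiv_dvd.
Qed.

(** All other labels give the diagrams A and B on these three vertices. *)
Lemma adjacent_big a b c : big a b -> big b c -> a != c ->
  [/\ d a b = Some 5, d b c = Some 5 & d a c = Some 3].
Proof.
move=> ab bc nac; have nab := big_neq ab; have nbc := big_neq bc.
have [k k5 abk] := bigP _ _ ab; have [q q5 bcq] := bigP _ _ bc.
have U : uniq [:: a; b; c] by rewrite uniq3 nab nac.
have U' : uniq [:: c; b; a] by rewrite -rev_uniq.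
have ac : d a c = Some 3.
  have noA : ~ (d a c = None \/ exists2 p, 5 <= p & d a c = Some p).
    move=> ac; apply: unlisted; left.
    exists (nth a [:: a; a; b; c]), k, q; split=> //.
    by apply: spanning => // X f D; apply: (excluded_A m_cox m_odd U k5 q5 abk bcq ac).
  have [acb|/label_cases[]//] := boolP (big a c).
    by case: noA; right; apply/bigP.
  by move=> ac; case: noA; left.
have five s t j : d s t = Some j -> 5 <= j -> ~ 7 <= j -> d s t = Some 5.
  by move=> st j5 j7; rewrite st; congr Some; case: (labelP st) => _ _ oj _; lia.
split=> //; [apply: (five _ _ _ abk) => // k7|apply: (five _ _ _ bcq) => // q7]; apply: unlisted.
  right; left; exists (nth a [:: a; a; b; c]), k, q; split=> //.
  by apply: spanning => // X f D; apply: (excluded_B m_cox m_odd U k7 q5 abk bcq ac).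
move: abk bcq ac; rewrite !(cox_div_sym m_cox _ c) (cox_div_sym m_cox a) => ba cb ca.
right; left; exists (nth a [:: a; c; b; a]), q, k; split=> //.
by apply: spanning => // X f D; apply: (excluded_B m_cox m_odd U' q7 k5 cb ba ca).
Qed.

Lemma no_three_big b a c e : uniq [:: a; c; e] -> big b a -> big b c -> ~ big b e.
Proof.
rewrite uniq3 => /and3P[nac nae nce] ba bc be.
have := (ba, bc); rewrite !(big_sym b) => -[ab cb].
have [_ bc5 ac3] := adjacent_big ab bc nac.
have [_ be5 ae3] := adjacent_big ab be nae.
have [cb5 _ ce3] := adjacent_big cb be nce.
have [_ ba5 _] : [/\ d c b = Some 5, d b a = Some 5 & d c a = Some 3].
  by apply: adjacent_big => //; rewrite eq_sym.
apply: unlisted; do 4 right; left; exists (nth a [:: a; b; a; c; e]); split=> //.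
apply: spanning => //.
  by rewrite uniq4 nac nae nce !big_neq.
by move=> X f D M; apply: (excluded_E m_cox m_odd M).
Qed.

Lemma no_big_path a b c e : uniq [:: a; b; c; e] -> big a b -> big b c -> ~ big c e.
Proof.
move=> U; have := U; rewrite uniq4 => /and5P[nab nac nae nbc /andP[nbe nce]] ab bc ce.
have [ab5 bc5 ac3] := adjacent_big ab bc nac.
have [_ ce5 be3] := adjacent_big bc ce nbe.
have ae : [\/ d a e = Some 3, d a e = Some 5 | d a e = None].
  have [ae|/label_cases ae] := boolP (big a e); last by case: ae => [?|?]; [constructor 1|constructor 3].
  by constructor 2; have [] := adjacent_big ae (etrans (big_sym e c) ce) nac.
apply: unlisted; do 3 right; left; exists (nth a [:: a; a; b; c; e]); split=> //.
by apply: spanning => // X f D M; apply: (excluded_D m_cox m_odd U M).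
Qed.

(** By [no_big_path] there is no large label across, and a 3 on bc gives the
    diagram C. *)
Lemma no_cross a b c e : uniq [:: a; b; c; e] -> big a b -> big c e -> d b c = None.
Proof.
have nbig a' b' c' e' : uniq [:: a'; b'; c'; e'] -> big a' b' -> big c' e' -> ~~ big b' c'.
  by move=> U ab ce; apply/negP => bc; apply: no_big_path U ab bc ce.
move=> U ab ce; have := U; rewrite uniq4 => /and5P[nab nac nae nbc /andP[nbe nce]].
have [|//] := label_cases (nbig _ _ _ _ U ab ce) => bc.
have ac : three_or_none d a c.
  apply/label_cases/(nbig b a c e) => //; last by rewrite big_sym.
  by rewrite uniq4 (eq_sym b) nab nbc nbe nac nae nce.
have ae : three_or_none d a e.
  apply/label_cases/(nbig b a e c); rewrite 1?big_sym //.
  by rewrite uniq4 (eq_sym b) nab nbc nbe nac nae eq_sym nce.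
have be : three_or_none d b e.
  apply/label_cases/(nbig a b e c); rewrite // 1?big_sym //.
  by rewrite uniq4 nab nbc nbe nac nae eq_sym nce.
have [k k5 abk] := bigP _ _ ab; have [q q5 ceq] := bigP _ _ ce.
case: unlisted; do 2 right; left; exists (nth a [:: a; a; b; c; e]), k, q; split=> //.
apply: spanning => // X f D M.
have [ac3 ae3 be3] := excluded_C_incomplete m_cox m_odd U M k5 q5 abk ceq bc ac ae be.
exact: (excluded_C_complete m_cox m_odd U k5 q5 abk ceq ac3 ae3 bc be3 M).
Qed.

(* Hypotheses other than inequalities between indices slow lia down. *)
Local Ltac arith :=
  repeat match goal with
  | H : ?T |- _ => lazymatch T with
    | is_true (leq _ _) => fail
    | is_true (_ && _) => fail
    | is_true (_ || _) => fail
    | @eq ?A _ _ => tryif unify A nat then fail else clear H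
    | _ => clear H
    end
  end; lia.

Definition linked k a b c e (p : nat -> S) :=
  [/\ uniq [:: a; b; c; e], big a b /\ big c e, p 0 = b, p k = c &
      forall i, i < k -> d (p i) (p i.+1) != None].

Lemma linked_rev k a b c e p : linked k a b c e p ->
  linked k e c b a (fun i => p (k - i)).
Proof.
case=> U [ab ce] p0 pk step; split.
- by rewrite -rev_uniq.
- by rewrite !(big_sym _ a, big_sym e).
- by rewrite subn0.
- by rewrite subnn.
- move=> i ik; rewrite (cox_div_sym m_cox) (_ : k - i = (k - i.+1).+1); last by arith.
  by apply: step; arith.
Qed.

Lemma linked_suffix k a b c e p i a' b' : linked k a b c e p -> i < k -> 
  p i = b' -> big a' b' -> uniq [:: a'; b'; c; e] ->
  linked (k - i) a' b' c e (fun j => p (i + j)).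
Proof.
case=> U [ab ce] p0 pk step ik pi ab' U'; split=> //; rewrite ?addn0 // ?subnKC //.
  exact: ltnW.
by move=> j jk; rewrite addnS; apply: step; arith.
Qed.

Lemma linked_shortcut k a b c e p i j : linked k a b c e p -> i.+1 < j -> j <= k ->
  d (p i) (p j) != None ->
  linked (k - (j - i.+1)) a b c e (fun t => if t <= i then p t else p (t + (j - i.+1))).
Proof.
case=> U bb p0 pk step ij jk dij; split=> //=.
  by rewrite leqNgt (_ : i < _) /= ?subnK //; arith.
move=> t tk; case: (ltngtP t i) => [ti|ti|->].
- by apply: step; arith.
- by rewrite addSn; apply: step; arith.
- by rewrite (_ : i.+1 + _ = j) //; arith.
Qed.

(** For the shortest walk between two disjoint large edges, every departure from the
    diagram F would give a shorter walk between two such edges. *)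
Section Shortest.
Variables (k : nat).
Hypothesis shorter : forall j a b c e p, j < k -> ~ linked j a b c e p.

Lemma no_chord a b c e p i j : linked k a b c e p -> i.+1 < j -> j <= k ->
  d (p i) (p j) = None.
Proof.
move=> L ij jk; apply/eqP; apply: contrapT => /negP dij.
by apply: (shorter _ (linked_shortcut L ij jk dij)); arith.
Qed.

Lemma path_interior a b c e p i : linked k a b c e p -> 0 < i < k ->
  p i \notin [:: a; b; c; e].
Proof.
move=> L /andP[i0 ik].
have out a' b' c' e' p' j : linked k a' b' c' e' p' -> 0 < j < k ->
    p' j != a' /\ p' j != b'.
  move=> L' /andP[j0 jk]; have [U [ab ce] _ _ _] := L'.
  split; apply/eqP => pj.
    apply: (shorter _ (linked_suffix (a' := b') L' jk pj _ _)); first by arith.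
      by rewrite big_sym.
    move: U; rewrite !uniq4 => /and5P[nab nac nae nbc /andP[nbe nce]].
    by rewrite eq_sym nab nac nae nbc nbe nce.
  by apply: (shorter _ (linked_suffix L' jk pj ab U)); arith.
have [pa pb] : p i != a /\ p i != b by apply: out L _; rewrite i0.
have [] := out _ _ _ _ _ (k - i) (linked_rev L); first by arith.
by rewrite subKn ?(ltnW ik) // => pe pc; rewrite !inE !negb_or pa pb pc pe.
Qed.

Lemma path_inj a b c e p i j : linked k a b c e p -> i < j -> j <= k -> p i != p j.
Proof.
move=> L ij jk; have [U [ab ce] p0 pk step] := L.
have [jk'|] := ltnP j k.
  apply/eqP => E; have := step j jk'; rewrite -E (no_chord L) //; arith.
move=> kj; have -> : j = k by arith.
rewrite pk; have [->|i0] := posnP i.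
  by rewrite p0; move: U; rewrite uniq4 => /and5P[].
have := path_interior (i := i) L; rewrite i0 !inE !negb_or => /(_ _)/and4P[] //; arith.
Qed.

(** A large edge on the walk is disjoint from ab or from ce, and closer to it. *)
Lemma path_three a b c e p i : linked k a b c e p -> 1 < k -> i < k ->
  d (p i) (p i.+1) = Some 3.
Proof.
have early a' b' c' e' p' j : linked k a' b' c' e' p' -> j.+1 < k -> ~ big (p' j) (p' j.+1).
  move=> L jk pj; have [U [ab ce] p0 pk step] := L.
  apply: (shorter _ (linked_suffix (a' := p' j) L jk (erefl _) pj _)); first by arith.
  have nj i0 : i0 < k -> p' i0 \notin [:: c'; e'].
    case: i0 => [_|i0 ik].
      by move: U; rewrite p0 uniq4 !inE !negb_or => /and5P[_ _ _ -> /andP[->]].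
    by have := path_interior (i := i0.+1) L; rewrite !inE !negb_or => /(_ ik)/and4P[_ _ -> ->].
  move: (nj j) (nj j.+1); rewrite uniq4 big_neq // !inE !negb_or.
  move=> /(_ _)/andP[|-> ->]; first by arith.
  by move=> /(_ _)/andP[|-> ->]; rewrite ?big_neq.
move=> L k1 ik; have [U [ab ce] p0 pk step] := L.
have nb : ~~ big (p i) (p i.+1).
  have [ik'|ki] := ltnP i.+1 k; first by apply/negP/(early _ _ _ _ _ _ L ik').
  have := early _ _ _ _ _ 0 (linked_rev L) k1.
  by rewrite subn0 (_ : k = i.+1) ?subSS ?subn0 1?big_sym; [move/negP|arith].
by have [//|pn] := label_cases nb; have := step i ik; rewrite pn.
Qed.

Lemma end_skip a b c e p : linked k a b c e p -> 1 < k -> three_or_none d a (p 1).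
Proof.
move=> L k1; have [U [ab ce] p0 pk step] := L; apply/label_cases/negP => ap.
apply: (shorter _ (linked_suffix L k1 (erefl _) ap _)); first by arith.
have := path_interior (i := 1) L; rewrite k1 !inE !negb_or => /(_ isT)/and4P[n1 n2 n3 n4].
move: U; rewrite !uniq4 => /and5P[nab nac nae nbc /andP[nbe nce]].
by rewrite eq_sym n1 nac nae n3 n4 nce.
Qed.

Lemma end_free a b c e p i : linked k a b c e p -> 1 < i -> i <= k -> d a (p i) = None.
Proof.
move=> L i1; have [U [ab ce] p0 pk step] := L.
move: (U); rewrite uniq4 => /and5P[nab nac nae nbc /andP[nbe nce]].
rewrite leq_eqVlt => /orP[/eqP->|ik].
  rewrite pk; apply: (@no_cross b a c e) => //; last by rewrite big_sym.
  by rewrite uniq4 eq_sym nab nac nae nbc nbe nce.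
apply/eqP; apply: contrapT => /negP dai.
apply: (@shorter (k - i).+1 b a c e (fun j => if j is j'.+1 then p (i + j') else a)); first by arith.
split=> //.
- by rewrite uniq4 eq_sym nab nac nae nbc nbe nce.
- by rewrite big_sym.
- by rewrite subnKC // ltnW.
- by case=> [|j] jk; rewrite ?addn0 // addnS; apply: step; arith.
Qed.

End Shortest.

(** The shortest walk, together with a and e, spans the diagram F. *)
Lemma no_linked k a b c e p : ~ linked k a b c e p.
Proof.
elim/ltn_ind: k a b c e p => k IH a b c e p L; have [U [ab ce] p0 pk step] := L.
have shorter j a' b' c' e' p' : j < k -> ~ linked j a' b' c' e' p' by move=> jk; apply: IH.
move: (U); rewrite uniq4 => /and5P[nab nac nae nbc /andP[nbe nce]].
have k1 : 1 < k.
  case: k pk step {L IH shorter} => [|[|//]] pk step.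
    by move: nbc; rewrite -p0 pk eqxx.
  by have := step 0 isT; rewrite p0 pk (no_cross U).
have L' := linked_rev L.
pose v i := if i == 1 then a else if i == k + 3 then e else p (i - 2).
have vp i : 2 <= i <= k + 2 -> v i = p (i - 2).
  by rewrite /v => ik; do 2![case: eqP => [?|_]; first by arith].
have v1 : v 1 = a by [].
have ve : v (k + 3) = e by rewrite /v eqxx; case: eqP => //; arith.
have p_out i : i <= k -> (p i != a) && (p i != e).
  case: (posnP i) => [-> _|i0]; first by rewrite p0 eq_sym nab nbe.
  rewrite leq_eqVlt => /orP[/eqP->|ik]; first by rewrite pk eq_sym nac nce.
  by have := path_interior shorter (i := i) L; rewrite i0 !inE !negb_or => /(_ ik)/and4P[-> _ _ ->].
have [h hk] : exists h, k = h + 2 by exists (k - 2); arith.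
have Uv : uniq [seq v i | i <- iota 1 (h + 5)].
  rewrite map_inj_in_uniq ?iota_uniq // => i j; rewrite !mem_iota => i_n j_n.
  have lt s t : 1 <= s -> s < t -> t <= k + 3 -> v s <> v t.
    move=> s1 st tk; apply/eqP; case: (ltngtP t (k + 3)) tk st => // [tk|->] _ st; last rewrite ve.
      rewrite [v t]vp; last by arith.
      have [s2|s2] := leqP 2 s; first by rewrite vp ?(path_inj shorter L) //; arith.
      have -> : s = 1 by arith.
      rewrite v1 eq_sym.
      by have /andP[] : (p (t - 2) != a) && (p (t - 2) != e) by apply: p_out; arith.
    have [s2|s2] := leqP 2 s; last by have -> : s = 1 by arith.
    rewrite vp; last by arith.
    by have /andP[] : (p (s - 2) != a) && (p (s - 2) != e) by apply: p_out; arith.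
  move=> vij; case: (ltngtP i j) => // ij; first by case: (lt i j) => //; arith.
  by case: (lt j i) => //; arith.
have [x x5 abx] := bigP _ _ ab; have [y y5 cey] := bigP _ _ ce.
have first_label : d (v 1) (v 2) = Some x by rewrite v1 vp; [rewrite p0|arith].
have last_label : d (v (h + 4)) (v (h + 5)) = Some y.
  have -> : h + 5 = k + 3 by arith.
  by rewrite ve vp; [rewrite (_ : _ - 2 = k) ?pk //; arith|arith].
have middle i : 2 <= i <= h + 3 -> d (v i) (v i.+1) = Some 3.
  move=> ih; rewrite !vp; [|arith|arith].
  by rewrite (_ : i.+1 - 2 = (i - 2).+1); [apply: (path_three shorter L); arith|arith].
have first_skip : three_or_none d (v 1) (v 3).
  by rewrite v1 vp; [apply: (end_skip shorter L)|arith].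
have last_skip : three_or_none d (v (h + 3)) (v (h + 5)).
  have -> : h + 5 = k + 3 by arith.
  rewrite ve vp; last by arith.
  have := end_skip shorter L' k1; rewrite /three_or_none (cox_div_sym m_cox e).
  by rewrite (_ : k - 1 = h + 3 - 2) //; arith.
have no_label i j : 1 <= i -> i.+1 < j -> j <= h + 5 ->
    (i, j) != (1, 3) -> (i, j) != (h + 3, h + 5) -> d (v i) (v j) = None.
  rewrite !xpair_eqE !negb_and => i1 ij jn not_first not_last.
  case: (ltngtP j (k + 3)) => [jk|jk|jk]; first 2 last.
  - rewrite jk ve; have [i2|i2] := leqP 2 i.
      rewrite vp; last by arith.
      rewrite (cox_div_sym m_cox) (_ : i - 2 = k - (k - (i - 2))); last by arith.
      by apply: (end_free shorter L'); arith.
    have -> : i = 1 by arith.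
    rewrite v1; apply: (@no_cross b a e c); rewrite 1?big_sym //.
    by rewrite uniq4 (eq_sym b) (eq_sym e) nab nac nae nbc nbe nce.
  - rewrite [v j]vp; last by arith.
    have [i2|i2] := leqP 2 i; first by rewrite vp; [apply: (no_chord shorter L); arith|arith].
    have i1' : i = 1 by arith.
    by rewrite i1' v1; apply: (end_free shorter L); arith.
  - by arith.
apply: unlisted; do 5 right; exists (h + 5), v, x, y.
have -> : (h + 5).-1 = h + 4 by arith.
have -> : h + 5 - 2 = h + 3 by arith.
split; last by split.
split=> //; first by arith.
apply: spanning => // [|X f D M]; first by arith.
exact: (excluded_F m_cox m_odd Uv x5 y5 first_label last_label middle first_skip
  last_skip no_label M).
Qed.

Lemma big_meet a b c e : big a b -> big c e -> c \notin [:: a; b] -> e \in [:: a; b].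
Proof.
move=> ab ce nc; apply: contraT => ne.
have U : uniq [:: a; b; c; e].
  move: nc ne; rewrite uniq4 (big_neq ab) (big_neq ce) !inE !negb_or !(eq_sym _ c) !(eq_sym _ e).
  by move=> /andP[-> ->] /andP[-> ->].
have /connectP[p bp pc] := conn b c.
case: (@no_linked (size p) a b c e (nth b (b :: p))).
split=> //; first by rewrite pc (last_nth b).
by move=> i ip; have /(pathP b)/(_ i ip) := bp.
Qed.

(** The large edges meet pairwise and neither three at a vertex nor three in a triangle
    are possible, so there are at most two, and the group acts on one of the
    finite sets constructed above. *)
Lemma unlisted_false : False.
Proof.
apply: (proj1 W_min).
have [/existsP[a /existsP[b ab]]|] := boolP [exists a, exists b, big a b]; last first.
  move=> nb; apply: (finite_index_of_threes m_cox S_gt0) => s t k st; apply: small_three => //.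
  by apply: contra nb => b; apply/existsP; exists s; apply/existsP; exists t.
have [/existsP[[[x y] z] /and3P[xy yz nxz]]|one] :=
  boolP [exists u : S * S * S, [&& big u.1.1 u.1.2, big u.1.2 u.2 & u.1.1 != u.2]].
  have [xy5 yz5 xz3] := adjacent_big xy yz nxz.
  have [_ _ _ [kxy mxy dxy]] := labelP xy5; have [_ _ _ [kyz myz dyz]] := labelP yz5.
  have [_ _ _ [[|n] mxz dxz]] := labelP xz3; first by case: m_cox => _ _ /(_ _ _ _ nxz mxz).
  have U : uniq [:: x; y; z] by rewrite uniq3 nxz (big_neq xy) (big_neq yz).
  apply: (finite_index_of_two_big m_cox U mxy myz mxz) => // s t k nt st.
  apply: small_three => //; apply/negP => st'; move: nt; rewrite !inE !negb_or => /and3P[tx ty tz].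
  have sxy : s \in [:: x; y].
    by apply: (big_meet xy (c := t)); rewrite 1?big_sym // !inE negb_or tx.
  have syz : s \in [:: y; z].
    by apply: (big_meet yz (c := t)); rewrite 1?big_sym // !inE negb_or ty.
  have sy : s = y.
    move: sxy syz; rewrite !inE => /orP[]/eqP-> //; rewrite (negbTE nxz) orbF.
    by move/eqP.
  apply: (@no_three_big y x z t) => //; rewrite -?sy // 1?big_sym ?sy //.
  by rewrite uniq3 nxz !(eq_sym _ t) tx.
have [k k5 abk] := bigP _ _ ab; have [nab _ _ [n mab kn]] := labelP abk.
have on := m_odd nab mab; have n2 : 1 < n by case: m_cox => _ _ /(_ _ _ _ nab mab).
have nE : n = (n - 3)./2.*2.+3 by lia.
rewrite nE in mab; apply: (finite_index_of_one_big m_cox nab mab) => s t j nt st.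
apply: small_three => //; apply/negP => st'.
have sab : s \in [:: a; b] by apply: (big_meet ab (c := t)); rewrite 1?big_sym.
case/negP: one; apply/existsP.
move: sab nt st'; rewrite !inE negb_or => /orP[]/eqP-> /andP[ta tb] st'.
  by exists (b, a, t); rewrite /= big_sym ab st' eq_sym.
by exists (a, b, t); rewrite /= ab st' eq_sym.
Qed.

End Classification.

Theorem theorem6p1 (S : finType) (m : S -> S -> option nat)
    (S_gt0 : (0 < #|S|)%N)
    (m_cox : is_coxeter_matrix m)
    (m_odd : odd_angled m)
    (W_min : minimal_no_finite_index_reflection_subgroup m)
    (conn : diagram_connected (cox_div m)) :
  diagram_A (cox_div m) \/ diagram_B (cox_div m) \/ diagram_C (cox_div m) \/
  diagram_D (cox_div m) \/ diagram_E (cox_div m) \/ diagram_F (cox_div m).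
Proof.
by apply: contrapT => unlisted; apply: (unlisted_false S_gt0 m_cox m_odd W_min conn unlisted).
Qed.
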